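(* Let $M$ be a closed smooth oriented real manifold of real dimension $\dim_{\mathbb{R}}(M)=2n$. Then $M$ admits a CR regular embedding $M\hookrightarrow\mathbb{C}^{n+1}$ if and only if there are an almost-complex structure $J_M$ on $M$ and an almost-complex structure $\hat{J}$ on $\mathbb{R}^{2n+2}$ for which there is a pseudo-holomorphic embedding $(M,J_M)\hookrightarrow(\mathbb{R}^{2n+2},\hat{J})$.
   Context: An almost-complex structure on a smooth manifold $M$ is a smooth bundle automorphism $J_M:TM\to TM$ with $J_M^2=-\mathrm{id}$; it is not required to be integrable. A smooth embedding $f:M\hookrightarrow N$ between almost-complex manifolds $(M,J_M)$ and $(N,J_N)$ is a pseudo-holomorphic embedding if $Tf\circ J_M=J_N\circ Tf$. Let $M$ be a smooth real manifold of real dimension $2n$, let $X$ be a complex manifold of complex dimension $n+1$ with complex structure $J$, and let $f:M\hookrightarrow X$ be a smooth embedding. A point $p\in M$ is CR regular if $\dim_{\mathbb{C}}(f_*T_pM\cap J f_*T_pM)=n-1$, where the intersection is taken in $T_{f(p)}X$. The embedding $f$ is a CR regular embedding if every point $p\in M$ is CR regular. Here $X=\mathbb{C}^{n+1}$ carries its standard complex structure. *)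

(* Defs.v *)
(* MathComp-Analysis; the real numbers are an arbitrary [R : realType]. *)
From HB Require Import structures.
From mathcomp Require Import all_boot all_order all_algebra.
From mathcomp Require Import complex.
From mathcomp Require Import all_classical all_reals all_analysis.

Set Implicit Arguments.
Unset Strict Implicit.
Unset Printing Implicit Defensive.

Import Order.TTheory GRing.Theory Num.Theory.
Import numFieldNormedType.Exports.

Local Open Scope classical_set_scope.
Local Open Scope ring_scope.

(* C^k on an open set [U], through iterated directional derivatives. *)
Fixpoint Ck_on (R : realType) (V W : normedModType R) (k : nat) (U : set V)
    (f : V -> W) : Prop :=
  (forall x, U x -> {for x, continuous f}) /\
  if k is k'.+1 then
    forall v : V, (forall x, U x -> derivable f x v) /\
                  Ck_on k' U (fun x => 'D_v f x)
  else True.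

Definition smooth_on (R : realType) (V W : normedModType R) (U : set V)
    (f : V -> W) : Prop := forall k, Ck_on k U f.

(* A topological space with a smooth atlas of dimension [d].  Hausdorffness,
   second countability and compactness are imposed by [closed_manifold].
   [pref x] is a preferred chart around [x]; it serves to give the tangent space
   at [x] a concrete model. *)
Record smooth_space (R : realType) (d : nat) := SmoothSpace {
  carrier :> topologicalType ;
  chart_index : Type ;
  dom : chart_index -> set carrier ;
  chart : chart_index -> carrier -> 'rV[R]_d ;
  chart_inv : chart_index -> 'rV[R]_d -> carrier ;
  pref : carrier -> chart_index ;
  open_dom : forall i, open (dom i) ;
  open_cod : forall i, open (chart i @` dom i) ;
  chartK : forall i x, dom i x -> chart_inv i (chart i x) = x ;
  chart_cont : forall i x, dom i x -> {for x, continuous (chart i)} ;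
  chart_inv_cont : forall i y,
    (chart i @` dom i) y -> {for y, continuous (chart_inv i)} ;
  dom_pref : forall x, dom (pref x) x ;
  transition_smooth : forall i j,
    smooth_on (chart i @` (dom i `&` dom j)) (chart j \o chart_inv i) }.

Definition closed_manifold (R : realType) (d : nat) (M : smooth_space R d)
    : Prop :=
  [/\ hausdorff_space M, @second_countable M & compact [set: M]].

Lemma Ck_on_cst (R : realType) (V W : normedModType R) k (U : set V) (w : W) :
  Ck_on k U (fun _ => w).
Proof.
elim: k w => [|k IHk] w /=; split => //; try by move=> x _; exact: cvg_cst.
move=> v; split=> [x _|]; first exact: derivable_cst.
have -> : (fun x : V => 'D_v (fun _ : V => w) x) = (fun=> 0).
  by apply/funext => x; exact: derive_cst.
exact: IHk.
Qed.

Lemma smooth_on_id (R : realType) (V : normedModType R) (U : set V) :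
  smooth_on U (fun x : V => x).
Proof.
case=> [|k] /=; split => //; try by move=> x _; exact: cvg_id.
move=> v; split=> [x _|]; first exact: derivable_id.
have -> : (fun x : V => 'D_v (fun z : V => z) x) = (fun=> v).
  by apply/funext => x; exact: derive_id.
exact: Ck_on_cst.
Qed.

Definition euclid (R : realType) (d : nat) : smooth_space R d.
Proof.
refine (@SmoothSpace R d 'rV[R]_d unit (fun _ => setT)
  (fun _ x => x) (fun _ x => x) (fun _ => tt) _ _ _ _ _ _ _).
- by move=> _; exact: openT.
- by move=> _; rewrite image_id; exact: openT.
- by [].
- by move=> _ x _; exact: cvg_id.
- by move=> _ x _; exact: cvg_id.
- by [].
- by move=> _ _; exact: smooth_on_id.
Defined.

(* [T_x M] is the space of row vectors ['rV_d], read as coordinates in the chart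
   [pref x]; linear maps act on row vectors from the right, [v |-> v *m A].
   [coord_change i j x] takes the coordinates of a tangent vector at [x] in
   chart [i] to its coordinates in chart [j]. *)
Definition coord_change (R : realType) (d : nat) (M : smooth_space R d)
    (i j : chart_index M) (x : M) : 'M[R]_d :=
  'J (chart j \o chart_inv i) (chart i x).

Definition tangent_map (R : realType) (d e : nat) (M : smooth_space R d)
    (N : smooth_space R e) (f : M -> N) (x : M) : 'M[R]_(d, e) :=
  'J (chart (pref (f x)) \o f \o chart_inv (pref x)) (chart (pref x) x).

Definition smooth_map (R : realType) (d e : nat) (M : smooth_space R d)
    (N : smooth_space R e) (f : M -> N) : Prop :=
  continuous f /\
  forall (i : chart_index M) (j : chart_index N),
    smooth_on (chart i @` (dom i `&` f @^-1` dom j))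
              (chart j \o f \o chart_inv i).

(* The last clause says that [f] is a homeomorphism onto its image. *)
Definition smooth_embedding (R : realType) (d e : nat) (M : smooth_space R d)
    (N : smooth_space R e) (f : M -> N) : Prop :=
  [/\ smooth_map f, injective f, forall x, row_free (tangent_map f x) &
      forall A : set M, open A -> exists2 B : set N, open B & A = f @^-1` B].

(* An orientation chooses one of the two orientations of each [T_x M]: [o x]
   tells whether the standard frame of the chart [pref x] is positive at [x].
   [frame_sign o i x] then tells the same of the standard frame of chart [i],
   and continuity of the choice is local constancy of these signs. *)
Definition frame_sign (R : realType) (d : nat) (M : smooth_space R d)
    (o : M -> bool) (i : chart_index M) (x : M) : bool :=
  o x (+) (\det (coord_change i (pref x) x) < 0).

Record orientation (R : realType) (d : nat) (M : smooth_space R d) :=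
  Orientation {
    positive_frame : M -> bool ;
    orientation_cont : forall i x, dom i x ->
      \forall y \near x,
        frame_sign positive_frame i y = frame_sign positive_frame i x }.

(* The local expression in chart [i] of the endomorphism field [A x : T_x M ->
   T_x M], as a function of the coordinates [y]. *)
Definition local_endo (R : realType) (d : nat) (M : smooth_space R d)
    (A : M -> 'M[R]_d) (i : chart_index M) (y : 'rV[R]_d) : 'M[R]_d :=
  let x := chart_inv i y in
  coord_change i (pref x) x *m A x *m coord_change (pref x) i x.

Record almost_complex (R : realType) (d : nat) (M : smooth_space R d) :=
  AlmostComplex {
    acs :> M -> 'M[R]_d ;
    acs_sqr : forall x, acs x *m acs x = - 1%:M ;
    acs_smooth : forall i, smooth_on (chart i @` dom i) (local_endo acs i) }.

Definition pseudo_holomorphic_embedding (R : realType) (d e : nat)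
    (M : smooth_space R d) (JM : almost_complex M)
    (N : smooth_space R e) (JN : almost_complex N) (f : M -> N) : Prop :=
  smooth_embedding f /\
  forall x, JM x *m tangent_map f x = tangent_map f x *m JN (f x).

(* C^m is R^(m + m), the row [(x, y)] standing for [x + i y]; [standard_J] is
   multiplication by i, [(x, y) |-> (- y, x)]. *)
Definition Cspace (R : realType) (m : nat) : smooth_space R (m + m) :=
  euclid R (m + m).

Definition standard_J (R : realType) (m : nat) : 'M[R]_(m + m) :=
  block_mx 0 1%:M (- 1%:M) 0.

Definition to_complex (R : realType) (k m : nat) (A : 'M[R]_(k, m + m))
    : 'M[R[i]]_(k, m) :=
  \matrix_(i, j) Complex (A i (lshift m j)) (A i (rshift m j)).

(* The complex dimension of the row space of [A], seen in C^m.  The rank is that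
   of the complex span of the rows, which is the row space itself when the
   latter is stable under [standard_J]. *)
Definition complex_dim (R : realType) (k m : nat) (A : 'M[R]_(k, m + m)) : nat :=
  \rank (to_complex A).

(* [f_* T_x M], [J f_* T_x M] and their intersection are given as row spaces.
   The subtraction [n - 1] is meaningful for [0 < n] only. *)
Definition CR_regular (R : realType) (n : nat) (M : smooth_space R (2 * n))
    (f : M -> Cspace R n.+1) (x : M) : Prop :=
  let T := tangent_map f x in
  complex_dim (T :&: T *m standard_J R n.+1)%MS = (n - 1)%N.

Definition CR_regular_embedding (R : realType) (n : nat)
    (M : smooth_space R (2 * n)) (f : M -> Cspace R n.+1) : Prop :=
  smooth_embedding f /\ forall x, CR_regular f x.

(* Main.v *)
(* A CR regular embedding f has a normal plane nu which is nowhere complex.  With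
   (xi, eta) an oriented orthonormal frame of nu and theta = <J xi, eta>, which is
   never -1, there is a skew S anticommuting with J such that the conjugate of J
   by 1 + S maps xi to eta; being orthogonal it preserves the tangent spaces.
   Extending S from f(M) to the whole space gives the almost-complex structure of
   the ambient space.

   Conversely, let Jhat preserve the tangent spaces of f.  Along f, it is homotopic
   to a constant structure through x |-> Jhat (t f(x)), which cuts the passage
   from Jhat to the constant structure into finitely many small steps.  For Jhat
   itself the monomorphism v |-> v + <v, e> n is CR regular, where n is a
   nonvanishing normal field and e a nonvanishing tangent field.  The field n
   is obtained by transporting a constant section of a bundle of projections on
   the ambient space which extends nu.  The field e exists because TM is, as a
   bundle, the orthogonal complement of a complex line {m, J m} with m : M -> R^N
   nowhere zero; as dim M < N - 1, m misses a direction and can be deformed to a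
   constant.  Nash-style convex integration realizes such a formal solution by an
   embedding: f is corrected by (1/k) Phi(x, k f_j(x)) in normal directions, one
   ambient coordinate f_j at a time.  For each coordinate CR regularity excludes
   at most one value of the derivative, so an explicit loop with the required
   mean avoids it.  Each small step towards the constant structure changes the
   regularity condition little enough to provide a new formal solution, and a
   constant structure is linearly equivalent to the standard one. *)

From HB Require Import structures.
Require Import Defs.
From mathcomp Require Import all_boot all_order all_algebra.
From mathcomp Require Import all_classical all_reals all_analysis.
From mathcomp Require Import complex ring lra zify.

Set Implicit Arguments.
Unset Strict Implicit.
Unset Printing Implicit Defensive.

Import Order.TTheory GRing.Theory Num.Theory.
Import numFieldNormedType.Exports.

Local Open Scope classical_set_scope.
Local Open Scope ring_scope.

(** * Functions of class C^k *)

(** Corrections along the normal planes of [f] can only realize formal solutions whose tangential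
    component is invertible. A trivialization of [Jhat] along [f] turns regularity for [Jhat] into
    regularity for a constant structure, but it may rotate the tangent spaces arbitrarily far.
    Cutting it into factors close to the identity keeps the tangential component invertible at every
    stage. Regularity is measured by matrices [B x] attached to the points of [M], not to their
    images, so it keeps its meaning while the embedding moves.

    Tangent spaces are read in charts [pref x] that need not vary continuously with [x]. The proof
    therefore works with matrices of the ambient space: the tangential projection [tproj f], the
    rotation [normal_rot] of the normal plane and the derivatives [Dmat f g]. The orientation enters
    through [normal_rot], which it makes smooth. Compactness supplies the radius of the tube, the
    frequency of each oscillation and the number of steps. *)

Section Line.
Context {R : realType} {V W : normedModType R}.

Lemma line_quotientE (f : V -> W) (u v : V) (s : R) :
  (fun h : R => h^-1 *: (f ((h *: (1 : R) + s) *: v + u) - f (s *: v + u))) =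
  (fun h : R => h^-1 *: (f (h *: v + (s *: v + u)) - f (s *: v + u))).
Proof.
by apply/funext => h; rewrite [h *: 1]mulr1 scalerDl -addrA.
Qed.

Lemma is_derive_line (f : V -> W) (u v : V) (s : R) :
  derivable f (s *: v + u) v ->
  is_derive s 1 (fun t : R => f (t *: v + u)) ('D_v f (s *: v + u)).
Proof.
move=> df; apply: DeriveDef.
  by rewrite /derivable /= line_quotientE.
by rewrite /derive /= line_quotientE.
Qed.

Lemma derive_line (f : V -> W) (u v : V) :
  'D_1 (fun t : R => f (t *: v + u)) 0 = 'D_v f u.
Proof. by rewrite /derive /= line_quotientE scale0r add0r. Qed.

End Line.

Section CkBasic.
Context {R : realType} {V W : normedModType R}.
Implicit Types (U : set V) (f g : V -> W).

Lemma Ck_on_continuous k U f x : Ck_on k U f -> U x -> {for x, continuous f}.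
Proof. by case: k => [|k] [h _]; exact: h. Qed.

Lemma Ck_onW k U f : Ck_on k.+1 U f -> Ck_on k U f.
Proof.
elim: k f => [|k IH] f [cf df]; first by split.
by split=> // v; have [dv Dv] := df v; split=> //; exact: IH.
Qed.

(** [Ck_on] asks for continuity and derivatives in the ambient space at each point of [U], not
    relative to [U], so it passes to arbitrary subsets. Openness comes in when a function is
    replaced by one that agrees with it on [U]. *)
Lemma Ck_on_sub k U U' f : U' `<=` U -> Ck_on k U f -> Ck_on k U' f.
Proof.
move=> UU; elim: k f => [|k IH] f [cf df].
  by split=> // x /UU; exact: cf.
split=> [x /UU|v]; first exact: cf.
by have [dv Dv] := df v; split=> [x /UU|]; [exact: dv|exact: IH].
Qed.

Lemma eq_Ck_on k U f g : open U -> (forall x, U x -> f x = g x) ->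
  Ck_on k U f -> Ck_on k U g.
Proof.
move=> oU; elim: k f g => [|k IH] f g fg [cf df].
  split=> // x Ux; have fgx : {near x, f =1 g}.
    by apply: filterS (open_nbhs_nbhs (conj oU Ux)) => y; exact: fg.
  apply: cvg_trans; first exact: (near_eq_cvg fgx).
  by rewrite -fg //; exact: cf.
have nfg x : U x -> {near x, f =1 g}.
  by move=> Ux; apply: filterS (open_nbhs_nbhs (conj oU Ux)) => y; exact: fg.
split=> [x Ux|v].
  apply: cvg_trans; first exact: (near_eq_cvg (nfg _ Ux)).
  by rewrite -fg //; exact: cf.
have [dv Dv] := df v; split=> [x Ux|].
  exact: near_eq_derivable (nfg _ Ux) (dv _ Ux).
apply: IH Dv => x Ux; exact: near_eq_derive (nfg _ Ux).
Qed.

Lemma Ck_on_local k U f :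
  (forall x, U x -> exists2 U', U' x & Ck_on k U' f) -> Ck_on k U f.
Proof.
elim: k f => [|k IH] f H.
  by split=> // x /H[U' U'x [cf _]]; exact: cf.
split=> [x /H[U' U'x [cf _]]|v]; first exact: cf.
split=> [x /H[U' U'x [_ /(_ v)[dv _]]]|]; first exact: dv.
by apply: IH => x /H[U' U'x [_ /(_ v)[_ Dv]]]; exists U'.
Qed.

Lemma smooth_on_sub U U' f : U' `<=` U -> smooth_on U f -> smooth_on U' f.
Proof. by move=> UU fU k; exact: Ck_on_sub (fU k). Qed.

Lemma eq_smooth_on U f g : open U -> (forall x, U x -> f x = g x) ->
  smooth_on U f -> smooth_on U g.
Proof. by move=> oU fg fU k; exact: eq_Ck_on (fU k). Qed.

Lemma smooth_on_local U f :
  (forall x, U x -> exists2 U', U' x & smooth_on U' f) -> smooth_on U f.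
Proof.
move=> H k; apply: Ck_on_local => x /H[U' U'x fU']; exists U' => //; exact: fU'.
Qed.

Lemma smooth_on_derive U f v : smooth_on U f -> smooth_on U ('D_v f).
Proof. by move=> fU k; have [_ /(_ v)[]] := fU k.+1. Qed.

Lemma smooth_on_derivable U f x v : smooth_on U f -> U x -> derivable f x v.
Proof. by move=> fU; have [_ /(_ v)[+ _]] := fU 1%N; exact. Qed.

Lemma Ck_onD k U f g : open U -> Ck_on k U f -> Ck_on k U g ->
  Ck_on k U (fun x => f x + g x).
Proof.
move=> oU; elim: k f g => [|k IH] f g [cf df] [cg dg].
  by split=> // x Ux; apply: cvgD; [exact: cf|exact: cg].
split=> [x Ux|v]; first by apply: cvgD; [exact: cf|exact: cg].
have [dvf Dvf] := df v; have [dvg Dvg] := dg v.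
split=> [x Ux|]; first by apply: derivableD; [exact: dvf|exact: dvg].
apply: eq_Ck_on (IH _ _ Dvf Dvg) => // x Ux.
by rewrite -deriveD //; [exact: dvf|exact: dvg].
Qed.

Lemma Ck_onZ k U (c : R) f : open U -> Ck_on k U f ->
  Ck_on k U (fun x => c *: f x).
Proof.
move=> oU; elim: k f => [|k IH] f [cf df].
  by split=> // x Ux; apply: cvgZl_tmp; exact: cf.
split=> [x Ux|v]; first by apply: cvgZl_tmp; exact: cf.
have [dvf Dvf] := df v.
split=> [x Ux|]; first by apply: derivableZ; exact: dvf.
apply: eq_Ck_on (IH _ Dvf) => // x Ux.
by rewrite -deriveZ //; exact: dvf.
Qed.

End CkBasic.

Section CkMatrix.
Context {R : realType} {V : normedModType R}.

Lemma cvg_mxP (T : Type) (F : set_system T) {FF : Filter F} m n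
    (f : T -> 'M[R]_(m, n)) (A : 'M[R]_(m, n)) :
  (forall i j, (fun x => f x i j) @ F --> A i j) -> f @ F --> A.
Proof.
move=> fA; apply/cvgrPdist_lt => e e0; near=> x.
rewrite [ltLHS]mx_normrE; apply/bigmax_ltP; split=> // -[i j] _ /=.
rewrite !mxE; move: i j; near: x.
apply: filter_forall => i; apply: filter_forall => j.
exact: ((cvgrPdist_lt _ _).1 (fA i j)).
Unshelve. all: by end_near. Qed.

Lemma cvg_mx_coord (T : Type) (F : set_system T) {FF : Filter F} m n
    (f : T -> 'M[R]_(m, n)) (A : 'M[R]_(m, n)) i j :
  f @ F --> A -> (fun x => f x i j) @ F --> A i j.
Proof. move=> fA; apply: (@cvg_comp _ _ _ f (fun B : 'M[R]_(m, n) => B i j) _ _ _ fA).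
exact: coord_continuous. Qed.

Lemma Ck_on_mxP k (U : set V) m n (f : V -> 'M[R]_(m, n)) : open U ->
  Ck_on k U f <-> (forall i j, Ck_on k U (fun x => f x i j)).
Proof.
move=> oU; elim: k f => [|k IH] f; split.
- by move=> [cf _] i j; split=> // x Ux; exact: cvg_mx_coord (cf _ Ux).
- by move=> H; split=> // x Ux; apply: cvg_mxP => i j; exact: (H i j).1.
- move=> [cf df] i j; split=> [x Ux|v]; first exact: cvg_mx_coord (cf _ Ux).
  have [dv Dv] := df v; split=> [x Ux|]; first exact: (derivable_mxP _ _ _).1 (dv _ Ux) i j.
  apply: eq_Ck_on ((IH _).1 Dv i j) => // x Ux.
  by rewrite derive_mx ?mxE //; exact: dv.
- move=> H; split=> [x Ux|v]; first by apply: cvg_mxP => i j; exact: (H i j).1.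
  have dv x : U x -> derivable f x v.
    by move=> Ux; apply/derivable_mxP => i j; have [_ /(_ v)[+ _]] := H i j; exact.
  split=> //; apply/IH => i j; have [_ /(_ v)[_]] := H i j.
  by apply: eq_Ck_on => // x Ux; rewrite derive_mx ?mxE //; exact: dv.
Qed.

Lemma smooth_on_mxP (U : set V) m n (f : V -> 'M[R]_(m, n)) : open U ->
  smooth_on U f <-> (forall i j, smooth_on U (fun x => f x i j)).
Proof.
move=> oU; split=> [H i j k|H k]; first exact: (Ck_on_mxP _ _ oU).1 (H k) i j.
by apply/Ck_on_mxP => // i j; exact: H.
Qed.

End CkMatrix.

Section CkScalar.
Context {R : realType} {V : normedModType R}.
Implicit Types (U : set V) (f g : V -> R).

Lemma Ck_onM k U f g : open U -> Ck_on k U f -> Ck_on k U g ->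
  Ck_on k U (fun x => f x * g x).
Proof.
move=> oU; elim: k f g => [|k IH] f g hf hg.
  by split=> // x Ux; apply: cvgM; [exact: hf.1|exact: hg.1].
have [cf df] := hf; have [cg dg] := hg.
split=> [x Ux|v]; first by apply: cvgM; [exact: cf|exact: cg].
have [dvf Dvf] := df v; have [dvg Dvg] := dg v.
split=> [x Ux|]; first by apply: derivableM; [exact: dvf|exact: dvg].
have := Ck_onD oU (IH _ _ (Ck_onW hf) Dvg) (IH _ _ (Ck_onW hg) Dvf).
apply: eq_Ck_on => // x Ux.
by rewrite [in RHS]deriveM //; [exact: dvf|exact: dvg].
Qed.

Lemma Ck_onV k U f : open U -> (forall x, U x -> f x != 0) ->
  Ck_on k U f -> Ck_on k U (fun x => (f x)^-1).
Proof.
move=> oU f0; elim: k => [|k IH] hf.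
  by split=> // x Ux; apply: cvgV; [exact: f0|exact: hf.1].
have [cf df] := hf.
split=> [x Ux|v]; first by apply: cvgV; [exact: f0|exact: cf].
have [dvf Dvf] := df v.
split=> [x Ux|]; first by apply: derivableV; [exact: f0|exact: dvf].
have h1 := IH (Ck_onW hf).
have := Ck_onZ (-1) oU (Ck_onM oU (Ck_onM oU h1 h1) Dvf).
apply: eq_Ck_on => // x Ux.
rewrite [in RHS]deriveV ?f0 //; last exact: dvf.
by rewrite scaleN1r -[in RHS]exprVn scaleNr expr2.
Qed.

(** The tower [G] of derivatives is given in advance. The derivative of [G n \o f] is [G n.+1 \o f]
    times that of [f], so the induction on [k] needs the claim for all [n] at once. *)
Lemma Ck_on_comp1 k U (A : set R) (G : nat -> R -> R) f : open U ->
  (forall n x, A x -> is_derive x 1 (G n) (G n.+1 x)) ->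
  (forall x, U x -> A (f x)) -> Ck_on k U f ->
  forall n, Ck_on k U (fun x => G n (f x)).
Proof.
move=> oU dG UA; elim: k => [|k IH] hf n.
  split=> // x Ux; have cG : {for f x, continuous (G n)}.
    apply: differentiable_continuous; apply/derivable1_diffP.
    by have [] := dG n _ (UA _ Ux).
  apply: (@cvg_comp _ _ _ f (G n) _ _ _ (hf.1 _ Ux)); exact: cG.
have [cf df] := hf.
have dfGn x : U x -> differentiable (G n) (f x).
  by move=> Ux; apply/derivable1_diffP; have [] := dG n _ (UA _ Ux).
have isD x v : U x -> is_derive x v (fun x => G n (f x)) (G n.+1 (f x) * 'D_v f x).
  move=> Ux; have [dvf _] := df v.
  have := @is_derive1_comp _ (G n) (fun t => f (t *: v + x)) 0.
  have dv : derivable f (0 *: v + x) v by rewrite scale0r add0r; exact: dvf.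
  have := is_derive_line dv; rewrite scale0r add0r => d1.
  move=> /(_ (G n.+1 (f x)) ('D_v f x)).
  move=> H; have {}H : is_derive (f x) 1 (G n) (G n.+1 (f x)) ->
      is_derive (0 : R) 1 (fun t : R => f (t *: v + x)) ('D_v f x) ->
      is_derive (0 : R) 1 (G n \o (fun t : R => f (t *: v + x))) (G n.+1 (f x) * 'D_v f x).
    by move=> h1 h2; apply: H => //; rewrite scale0r add0r.
  have [D E] := H (dG n _ (UA _ Ux)) d1.
  apply: DeriveDef; first by apply/derivable1P.
  rewrite -E /derive /=.
  have -> : (fun h : R => h^-1 *: (G n (f (h *: v + x)) - G n (f x))) =
            (fun h : R => h^-1 *:
              ((G n \o (fun t : R => f (t *: v + x))) (h *: 1 + 0) - (G n \o (fun t : R => f (t *: v + x))) 0)).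
    by apply/funext => h /=; rewrite addr0 scale0r add0r [h *: 1]mulr1.
  by [].
split=> [x Ux|v].
  exact: (@cvg_comp _ _ _ f (G n) _ _ _ (cf _ Ux)) (differentiable_continuous (dfGn _ Ux)).
have [dvf Dvf] := df v.
split=> [x Ux|]; first by have [] := isD x v Ux.
have := Ck_onM oU (IH (Ck_onW hf) n.+1) Dvf.
by apply: eq_Ck_on => // x Ux; have [_ ->] := isD x v Ux.
Qed.

End CkScalar.


Section FilterHelpers.

Lemma near_ballP (R : realType) (V : normedModType R) (p : V) (P : V -> Prop) :
  (\forall x \near p, P x) <->
  exists2 r : R, 0 < r & forall x, `|x - p| < r -> P x.
Proof.
split=> [/nbhs_ballP[r r0 H]|[r r0 H]].
  by exists r => // x xr; apply: H; rewrite -ball_normE /= distrC.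
apply/nbhs_ballP; exists r => // x; rewrite -ball_normE /= distrC; exact: H.
Qed.

Lemma cvg_sumr (R : realType) (V : normedModType R) (T : Type)
    (F : set_system T) (FF : Filter F) (I : Type) (r : seq I) (P : pred I)
    (f : I -> T -> V) (a : I -> V) :
  (forall i, P i -> f i @ F --> a i) ->
  (fun x => \sum_(i <- r | P i) f i x) @ F --> \sum_(i <- r | P i) a i.
Proof.
move=> H; elim: r => [|i r IH].
  under eq_fun do rewrite big_nil; rewrite big_nil; exact: cvg_cst.
under eq_fun do rewrite big_cons; rewrite big_cons.
by case: ifP => Pi //; apply: cvgD => //; exact: H.
Qed.

Lemma continuous_ballP (R : realType) (V W : normedModType R) (f : V -> W) (p : V) :
  {for p, continuous f} <-> forall e : R, 0 < e ->
    exists2 r : R, 0 < r & forall x, `|x - p| < r -> `|f x - f p| < e.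
Proof.
split=> [/cvgrPdist_lt H e /H/near_ballP[r r0 Hr]|H].
  by exists r => // x /Hr; rewrite distrC.
apply/cvgrPdist_lt => e /H[r r0 Hr]; apply/near_ballP; exists r => // x /Hr.
by rewrite distrC.
Qed.

Lemma open_normB (R : realType) (V : normedModType R) (p : V) (t : R) :
  open [set x | `|x - p| < t].
Proof.
rewrite openE => x /= xt; apply/near_ballP.
exists (t - `|x - p|); first by rewrite subr_gt0.
move=> w; rewrite ltrBrDr; apply: le_lt_trans.
by rewrite -{1}(subrK x w) -addrA ler_normD.
Qed.

Lemma closed_normB (R : realType) (V : normedModType R) (p : V) (t : R) :
  closed [set x | `|x - p| <= t].
Proof.
apply: (@closed_comp _ _ (fun x => `|x - p|) [set s | s <= t]).
  move=> x _; apply: cvg_norm; apply: cvgB; [exact: cvg_id|exact: cvg_cst].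
exact: closed_le.
Qed.

Lemma scaler_subVr (R : fieldType) (V : lmodType R) (a : R) (u w : V) :
  a != 0 -> u - a^-1 *: w = a^-1 *: (a *: u - w).
Proof. by move=> a0; rewrite scalerBr scalerA mulVf // scale1r. Qed.

Lemma continuous_at_normB (R : realType) (V W : normedModType R) (f g : V -> W)
    (p : V) : {for p, continuous f} -> {for p, continuous g} ->
  {for p, continuous (fun x => `|f x - g x|)}.
Proof. by move=> cf cg; apply: cvg_norm; apply: cvgB. Qed.

Lemma diff_of_approx (R : realType) (V : normedModType R) (f : V -> R) (p : V)
    (L : {linear V -> R}) : continuous L ->
  (forall e : R, 0 < e ->
     \forall h \near (0 : V), `|f (h + p) - f p - L h| <= e * `|h|) ->
  differentiable f p /\ 'd f p = L :> (V -> R).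
Proof.
move=> Lc H; have fE : f \o shift p = cst (f p) + L +o_ (0 : V) id.
  apply/eqaddoP => e e0; apply: filterS (H e e0) => h.
  suff -> : (f \o shift p - (cst (f p) + L)) h = f (h + p) - f p - L h by [].
  by rewrite !fctE /= opprD addrA.
have dE := diff_unique Lc fE.
by split=> //; apply/diff_locallyP; rewrite dE; split.
Qed.

End FilterHelpers.

(** * Mean value estimates and strict differentiability *)

Section Strict.
Context {R : realType}.

Lemma line_mvt (V : normedModType R) (f : V -> R) (u v : V) (t c e : R) :
  (forall s : R, `|s| <= `|t| -> derivable f (s *: v + u) v /\
     `|'D_v f (s *: v + u) - c| <= e) ->
  `|f (t *: v + u) - f u - t * c| <= e * `|t|.
Proof.
move=> H.
pose g (s : R) := f (s *: v + u).
have gd (s : R) : `|s| <= `|t| -> is_derive s 1 g ('D_v f (s *: v + u)).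
  by move=> /H[d _]; exact: is_derive_line.
have gc (s : R) : `|s| <= `|t| -> {for s, continuous g}.
  move=> /gd[d _]; apply: differentiable_continuous.
  exact/derivable1_diffP.
have g0 : g 0 = f u by rewrite /g scale0r add0r.
rewrite -/(g t) -g0.
have [t0|t0] := leP 0 t.
  have [||s sI ->] := @MVT_segment R g (fun s => 'D_v f (s *: v + u)) 0 t t0.
  - move=> s /[!in_itv]/= /andP[s0 st]; apply: gd.
    by rewrite !ger0_norm // ltW.
  - apply: continuous_in_subspaceT => s /[!inE]/= /[!in_itv]/= /andP[s0 st].
    by apply: gc; rewrite !ger0_norm.
  move: sI; rewrite in_itv /= => /andP[s0 st].
  rewrite subr0 [t * c]mulrC -mulrBl normrM ler_wpM2r //.
  by apply: (H s _).2; rewrite !ger0_norm.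
have t0' := ltW t0.
have [||s sI E] := @MVT_segment R g (fun s => 'D_v f (s *: v + u)) t 0 t0'.
- move=> s /[!in_itv]/= /andP[st s0]; apply: gd.
  by rewrite !ler0_norm ?lerN2 // ltW.
- apply: continuous_in_subspaceT => s /[!inE]/= /[!in_itv]/= /andP[st s0].
  by apply: gc; rewrite !ler0_norm ?lerN2.
move: sI; rewrite in_itv /= => /andP[st s0].
have -> : g t - g 0 - t * c = ('D_v f (s *: v + u) - c) * t.
  by rewrite -(opprB (g 0)) E sub0r mulrN opprK mulrBl [t * c]mulrC.
rewrite normrM ler_wpM2r //.
by apply: (H s _).2; rewrite !ler0_norm // lerN2.
Qed.

Lemma mx_norm_le m n (A : 'M[R]_(m, n)) (e : R) : 0 <= e ->
  (forall i j, `|A i j| <= e) -> `|A| <= e.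
Proof.
by move=> e0 H; rewrite [leLHS]mx_normrE; apply/bigmax_leP; split=> // -[i j] _; exact: H.
Qed.

Lemma mx_norm_lt m n (A : 'M[R]_(m, n)) (e : R) : 0 < e ->
  (forall i j, `|A i j| < e) -> `|A| < e.
Proof.
by move=> e0 H; rewrite [ltLHS]mx_normrE; apply/bigmax_ltP; split=> // -[i j] _; exact: H.
Qed.

Lemma mx_norm_coord m n (A : 'M[R]_(m, n)) i j : `|A i j| <= `|A|.
Proof.
by rewrite [leRHS]mx_normrE; exact: (le_bigmax _ (fun ij : 'I_m * 'I_n => `|A ij.1 ij.2|) (i, j)).
Qed.

Context {d : nat}.
Implicit Types (U : set 'rV[R]_d) (x p : 'rV[R]_d).

(** Both points vary, as the inverse function theorem and the Lipschitz bounds require. A path from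
    [x'] to [x] that changes one coordinate at a time is governed on each edge by one partial
    derivative, and these are continuous at [p]. *)
Lemma strict_derivative U (f : 'rV[R]_d -> R) p (e : R) : open U -> U p ->
  Ck_on 1 U f -> 0 < e ->
  exists2 r, 0 < r & forall x x', `|x - p| < r -> `|x' - p| < r ->
    `|f x - f x' - \sum_i (x - x') 0 i * 'D_'e_i f p|
      <= e * \sum_i `|(x - x') 0 i|.
Proof.
move=> oU Up [cf df] e0.
have nU : \forall x \near p, U x by exact: open_nbhs_nbhs (conj oU Up).
have nD : \forall x \near p, forall i : 'I_d,
    `|'D_'e_i f x - 'D_'e_i f p| <= e.
  have nDi (i : 'I_d) : \forall x \near p, `|'D_'e_i f x - 'D_'e_i f p| <= e;
    last exact: (@filter_forall _ _ _ _ (nbhs_filter p) nDi).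
  have [_ [cD _]] := df 'e_i.
  have /cvgrPdist_le /(_ e e0) := cD _ Up.
  by apply: filterS => x; rewrite distrC.
have [r0 r00 ball_r0] := (near_ballP (p : 'rV[R]_d) _).1 (filterI nU nD).
(* Thirds: the corners of the path lie within [r0 / 3] of [p], and the increment along an edge is
   below [2 * r0 / 3]. *)
exists (r0 / 3) => [|x x' xp x'p]; first by rewrite divr_gt0.
have xpi i : `|x 0 i - p 0 i| < r0 / 3.
  by apply: le_lt_trans xp; have := mx_norm_coord (x - p) 0 i; rewrite !mxE.
have x'pi i : `|x' 0 i - p 0 i| < r0 / 3.
  by apply: le_lt_trans x'p; have := mx_norm_coord (x' - p) 0 i; rewrite !mxE.
pose z (k : nat) : 'rV[R]_d := \row_i (if (i < k)%N then x 0 i else x' 0 i).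
have zd : z d = x by apply/rowP => i; rewrite mxE ltn_ord.
have z0 : z 0%N = x' by apply/rowP => i; rewrite mxE.
have -> : f x - f x' = \sum_(i < d) (f (z i.+1) - f (z i)).
  by rewrite -(big_mkord xpredT (fun i => f (z i.+1) - f (z i))) telescope_sumr // zd z0.
rewrite mulr_sumr -sumrB; apply: le_trans (ler_norm_sum _ _ _) _.
apply: ler_sum => k _.
have -> : z k.+1 = (x - x') 0 k *: 'e_k + z k.
  apply/rowP => i; rewrite !mxE eqxx /= ltnS leq_eqVlt.
  have [->|ik] := eqVneq i k; first by rewrite !eqxx ltnn mulr1 subrK.
  have ik' := ik; rewrite -val_eqE /= in ik'.
  by rewrite (negPf ik') ?(negPf ik) mulr0 add0r.
apply: line_mvt => s sk.
have /ball_r0[Us Ds] : `|s *: 'e_k + z k - p| < r0.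
  apply: mx_norm_lt => // i j; rewrite ord1 !mxE eqxx /=.
  have zj : `|(if (j < k)%N then x 0 j else x' 0 j) - p 0 j| < r0 / 3.
    by case: ifP.
  have sr : `|s| < r0 / 3 + r0 / 3.
    apply: le_lt_trans sk _; rewrite !mxE.
    have -> : x 0 k - x' 0 k = (x 0 k - p 0 k) - (x' 0 k - p 0 k) by ring.
    by apply: le_lt_trans (ler_normB _ _) _; rewrite ltrD.
  rewrite -addrA; apply: le_lt_trans (ler_normD _ _) _.
  have -> : r0 = r0 / 3 + r0 / 3 + r0 / 3 by field.
  rewrite ltrD //; case: eqP => _; rewrite ?mulr1 ?mulr0 ?normr0 //.
  by apply: addr_gt0; rewrite divr_gt0.
by split; [have [+ _] := df 'e_k; exact|exact: Ds].
Qed.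

Lemma sum_norm_le x : \sum_i `|x 0 i| <= d%:R * `|x|.
Proof.
apply: (@le_trans _ _ (\sum_(i < d) `|x|)).
  by apply: ler_sum => i _; exact: mx_norm_coord.
by rewrite sumr_const card_ord mulr_natl.
Qed.

Lemma C1_differentiable U (f : 'rV[R]_d -> R) p : open U -> U p ->
  Ck_on 1 U f -> differentiable f p /\
  forall v, 'd f p v = \sum_i v 0 i * 'D_'e_i f p.
Proof.
move=> oU Up Cf.
pose L (v : 'rV[R]_d) : R := \sum_i v 0 i * 'D_'e_i f p.
have Llin : linear L.
  move=> a u v; rewrite /L scaler_sumr -big_split /=; apply: eq_bigr => i _.
  by rewrite !mxE mulrDl -mulrA.
pose HL := GRing.isLinear.Build R 'rV[R]_d R _ L Llin.
pose Ll : {linear 'rV[R]_d -> R} := HB.pack L HL.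
have Lcont : continuous Ll.
  move=> x; rewrite /continuous_at /=.
  have -> : (L : 'rV[R]_d -> R) = (fun v => \sum_i v 0 i * 'D_'e_i f p).
    by [].
  apply: (@cvg_sumr _ _ _ _ (nbhs_filter x)) => i _.
  apply: cvgMr_tmp; exact: coord_continuous.
have [e e0|df dE] := diff_of_approx Lcont (f := f) (p := p); last first.
  by split=> // v; rewrite dE.
have d0 : 0 < (d.+1%:R : R) by rewrite ltr0n.
have [r r0 Hr] := strict_derivative oU Up Cf (divr_gt0 e0 d0).
apply: (near_ballP (0 : 'rV[R]_d) _).2; exists r => // h; rewrite subr0 => hr.
have := Hr (h + p) p; rewrite addrK subrr normr0 => /(_ hr r0) H.
apply: le_trans H _.
apply: (@le_trans _ _ (e / d.+1%:R * (d%:R * `|h|))).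
  by apply: ler_wpM2l; [rewrite ltW // divr_gt0|exact: sum_norm_le].
rewrite mulrA; apply: ler_wpM2r => //.
rewrite -mulrA ler_piMr ?ltW // mulrC ltr_pdivrMr // mul1r ltr_nat.
exact: ltnSn.
Qed.

End Strict.


(** * Smooth functions and the inverse function theorem *)

Section SmoothFun1.
Context {R : realType}.

(** Sine, cosine, square root and [flat_exp] have such towers in closed form, because each belongs
    to an explicit family stable under differentiation. *)
Definition smooth_fun1 (A : set R) (g : R -> R) : Prop :=
  exists2 G : nat -> R -> R, G 0%N = g &
    forall n x, A x -> is_derive x 1 (G n) (G n.+1 x).

Lemma is_derive_sincos (a b x : R) :
  is_derive x 1 (fun y => a * sin y + b * cos y) (- b * sin x + a * cos x).
Proof. by apply: is_derive_eq; rewrite /GRing.scale /=; ring. Qed.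

Lemma smooth_sincos (a b : R) :
  smooth_fun1 setT (fun x => a * sin x + b * cos x).
Proof.
pose c := (fun n => iter n (fun ab : R * R => (- ab.2, ab.1)) (a, b)).
exists (fun n x => (c n).1 * sin x + (c n).2 * cos x) => // n x _.
exact: is_derive_sincos.
Qed.

Lemma smooth_sin : smooth_fun1 setT (@sin R).
Proof.
have -> : @sin R = fun x => 1 * sin x + 0 * cos x.
  by apply/funext => x; rewrite mul1r mul0r addr0.
exact: smooth_sincos.
Qed.

Lemma smooth_cos : smooth_fun1 setT (@cos R).
Proof.
have -> : @cos R = fun x => 0 * sin x + 1 * cos x.
  by apply/funext => x; rewrite mul1r mul0r add0r.
exact: smooth_sincos.
Qed.

Lemma is_derive_sqrtX (c : R) n (x : R) : 0 < x ->
  is_derive x 1 (fun y => c * (Num.sqrt y * y ^- n))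
    (c * (2^-1 - n%:R) * (Num.sqrt x * x ^- n.+1)).
Proof.
move=> x0; have xN0 : x != 0 by rewrite gt_eqF.
have dV : is_derive x 1 (fun y : R => y ^- n) ((- n%:R) * x ^- n.+1).
  have xn0 : x ^+ n != 0 by rewrite expf_neq0.
  have dX := is_deriveX n (is_derive_id x (1 : R)); rewrite exprfctE in dX.
  have H := @is_deriveV R (fun y : R => y ^+ n) x _ 1 xn0 dX.
  apply: is_derive_eq.
  rewrite /GRing.scale /= mulr1; case: n xn0 {dX} H => [|n] xn0 H.
    by rewrite mulr0n !(mul0r, mulr0) oppr0 mul0r.
  rewrite -mulr_natl !exprS ; field.
  by rewrite xN0 expf_neq0.
have dS := is_derive1_sqrt x0.
have s0 : Num.sqrt x != 0 by rewrite sqrtr_eq0 -ltNge.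
apply: is_derive_eq; rewrite /GRing.scale /= exprS.
have sE : x = Num.sqrt x ^+ 2 by rewrite sqr_sqrtr // ltW.
have xn0 : x ^+ n != 0 by rewrite expf_neq0.
move: (x ^+ n) xn0 {dV dS} => y y0; move: (Num.sqrt x) sE s0 => s -> s0.
by field; rewrite s0 y0.
Qed.

Lemma smooth_sqrt : smooth_fun1 [set x | 0 < x] (@Num.sqrt R).
Proof.
pose c := fix c n : R := if n is k.+1 then c k * (2^-1 - k%:R) else 1.
exists (fun n x => c n * (Num.sqrt x * x ^- n)) => [|n x x0].
  by apply/funext => x; rewrite /= expr0 invr1 mulr1 mul1r.
exact: is_derive_sqrtX.
Qed.

(** The family p(1/x) exp(-1/x), extended by 0, is stable under differentiation: p becomes X^2 (p -
    p'). The cutoff [flat_exp 1] thus comes with all its derivatives. *)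
Definition flat_exp (p : {poly R}) (x : R) : R :=
  if 0 < x then p.[x^-1] * expR (- x^-1) else 0.

Lemma exprn_expRN_le k (u : R) : 0 <= u -> u ^+ k * expR (- u) <= k`!%:R.
Proof.
move=> u0; rewrite expRN -ler_pdivlMr ?invr_gt0 ?expR_gt0 // invrK.
case: k => [|k].
  rewrite expr0 fact0 mul1r; apply: le_trans (expR_ge1Dx u); by rewrite lerDl.
rewrite mulrC -ler_pdivrMr ?ltr0n ?fact_gt0 //.
by apply: le_trans (expR_ge1Dxn k u0); rewrite lerDr.
Qed.

Lemma horner_expRN_le (p : {poly R}) :
  exists C : R, forall u, 0 <= u -> `|p.[u] * expR (- u)| <= C.
Proof.
exists (\sum_(i < size p) `|p`_i| * i`!%:R) => u u0.
rewrite horner_coef mulr_suml; apply: le_trans (ler_norm_sum _ _ _) _.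
apply: ler_sum => i _; rewrite -mulrA normrM ler_wpM2l //.
rewrite ger0_norm ?mulr_ge0 ?exprn_ge0 ?expR_ge0 //.
exact: exprn_expRN_le.
Qed.

Lemma is_derive_flat_exp p (x : R) :
  is_derive x 1 (flat_exp p) (flat_exp ('X ^+ 2 * (p - p^`())) x).
Proof.
have [x0|x0|->] := ltgtP x 0.
- apply: (@near_eq_is_derive _ _ _ (cst 0)).
    have : \forall y \near x, y < 0 by exact: lt_nbhsl.
    by apply: filterS => y y0; rewrite /flat_exp ltNge (ltW y0).
  by rewrite /flat_exp ltNge (ltW x0) /=; exact: is_derive_cst.
- apply: (@near_eq_is_derive _ _ _ (fun y : R => p.[y^-1] * expR (- y^-1))).
    have : \forall y \near x, 0 < y by exact: lt_nbhsr.
    by apply: filterS => y y0; rewrite /flat_exp y0.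
  rewrite /flat_exp x0.
  have xN0 : x != 0 by rewrite gt_eqF.
  have dV : is_derive x 1 (fun y : R => y^-1) (- x ^- 2).
    have := @is_deriveV R (fun y : R => y) x _ 1 xN0 (is_derive_id x (1 : R)).
    by move=> H; apply: is_derive_eq; rewrite /GRing.scale /= mulr1.
  have dp : is_derive x^-1 1 (horner p) (p^`()).[x^-1].
    apply: DeriveDef; first exact: derivable_horner.
    by rewrite -derive1E -derivE.
  have d1 := @is_derive1_comp _ (horner p) (fun y => y^-1) x _ _ dp dV.
  have d2 : is_derive x 1 (fun y : R => - y^-1) (- - x ^- 2).
    exact: is_deriveN.
  have d3 := @is_derive1_comp _ (@expR R) (fun y => - y^-1) x _ _
    (is_derive_expR _) d2.
  have := is_deriveM d1 d3 => H; apply: is_derive_eq.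
  rewrite /GRing.scale /= !hornerE /=; field.
  exact: xN0.
(* At [0] the difference quotient is [h] times a member of the same family, with polynomial
   [p * 'X ^+ 2], and that member is bounded. *)
- have [C HC] := horner_expRN_le (p * 'X ^+ 2).
  have C0 : 0 <= C by apply: le_trans (HC 0 _).
  rewrite [X in is_derive _ _ _ X]/flat_exp ltxx.
  suff H : (fun h : R => h^-1 *: (flat_exp p (h *: 1 + 0) - flat_exp p 0)) @ 0^' --> (0 : R).
    by apply: DeriveDef; [apply/cvg_ex; exists (0 : R)|exact/cvg_lim].
  apply/cvgrPdist_le => e e0; near=> h.
  have h0 : h != 0 by near: h; exact: nbhs_dnbhs_neq.
  have hC : `|h| < e / (C + 1).
    by near: h; apply: dnbhs0_lt; rewrite divr_gt0 // ltr_pwDr.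
  rewrite addr0 [h *: 1]mulr1 sub0r normrN /flat_exp ltxx subr0.
  case: ifP => hp; last by rewrite scaler0 normr0 ltW.
  have -> : h^-1 *: (p.[h^-1] * expR (- h^-1)) =
            h * ((p * 'X ^+ 2).[h^-1] * expR (- h^-1)).
    by rewrite /GRing.scale /= !hornerE /=; field; rewrite h0.
  rewrite normrM; apply: (@le_trans _ _ (e / (C + 1) * C)).
    apply: ler_pM => //; first exact: ltW.
    by apply: HC; rewrite invr_ge0 ltW.
  rewrite -mulrA ler_piMr ?ltW // mulrC ltr_pdivrMr ?mul1r ?ltrDl //.
  by rewrite ltr_pwDr.
Unshelve. all: by end_near. Qed.

Lemma smooth_flat_exp p : smooth_fun1 setT (flat_exp p).
Proof.
exists (fun n => flat_exp (iter n (fun q => 'X ^+ 2 * (q - q^`())) p)) => // n x _.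
exact: is_derive_flat_exp.
Qed.

Lemma flat_exp1_gt0 (x : R) : (0 < flat_exp 1 x) = (0 < x).
Proof.
by rewrite /flat_exp; case: ifP => x0; rewrite ?ltxx // hornerC mul1r expR_gt0.
Qed.

Lemma flat_exp1_ge0 (x : R) : 0 <= flat_exp 1 x.
Proof. by rewrite /flat_exp; case: ifP => // _; rewrite hornerC mul1r expR_ge0. Qed.

Lemma flat_exp_eq0 p (x : R) : x <= 0 -> flat_exp p x = 0.
Proof. by move=> x0; rewrite /flat_exp ltNge x0. Qed.

End SmoothFun1.


(** * Closure properties common to smooth and continuous functions *)

Section SmoothAlgebra.
Context {R : realType} {X : Type}.

(* Formal closure properties shared by the smooth functions on an open set, the
   smooth functions on a manifold and the continuous functions. *)
Record smooth_algebra (D : set X) (S : (X -> R) -> Prop) : Prop := SmoothAlg {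
  salg_eq : forall f g, (forall x, D x -> f x = g x) -> S f -> S g ;
  salg_cst : forall c, S (fun=> c) ;
  salgD : forall f g, S f -> S g -> S (fun x => f x + g x) ;
  salgM : forall f g, S f -> S g -> S (fun x => f x * g x) ;
  salgV : forall f, (forall x, D x -> f x != 0) -> S f -> S (fun x => (f x)^-1) ;
  salg_comp1 : forall (A : set R) (g : R -> R) f, smooth_fun1 A g ->
    (forall x, D x -> A (f x)) -> S f -> S (fun x => g (f x)) }.

Definition salg_mx (S : (X -> R) -> Prop) m n (A : X -> 'M[R]_(m, n)) : Prop :=
  forall i j, S (fun x => A x i j).

Context {D : set X} {S : (X -> R) -> Prop} (HS : smooth_algebra D S).

Lemma salgN f : S f -> S (fun x => - f x).
Proof.
move=> Sf; apply: (salg_eq HS) (salgM HS (salg_cst HS (-1)) Sf) => x _.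
by rewrite mulN1r.
Qed.

Lemma salgB f g : S f -> S g -> S (fun x => f x - g x).
Proof. by move=> Sf Sg; apply: (salgD HS) => //; exact: salgN. Qed.

Lemma salg_sum I (r : seq I) (P : pred I) (F : I -> X -> R) :
  (forall i, P i -> S (F i)) -> S (fun x => \sum_(i <- r | P i) F i x).
Proof.
move=> SF; elim: r => [|i r IH].
  by apply: (salg_eq HS) (salg_cst HS 0) => x _; rewrite big_nil.
have [Pi|nPi] := boolP (P i).
  by apply: (salg_eq HS) (salgD HS (SF i Pi) IH) => x _; rewrite big_cons Pi.
by apply: (salg_eq HS) IH => x _; rewrite big_cons (negPf nPi).
Qed.

Lemma salg_prod I (r : seq I) (P : pred I) (F : I -> X -> R) :
  (forall i, P i -> S (F i)) -> S (fun x => \prod_(i <- r | P i) F i x).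
Proof.
move=> SF; elim: r => [|i r IH].
  by apply: (salg_eq HS) (salg_cst HS 1) => x _; rewrite big_nil.
have [Pi|nPi] := boolP (P i).
  by apply: (salg_eq HS) (salgM HS (SF i Pi) IH) => x _; rewrite big_cons Pi.
by apply: (salg_eq HS) IH => x _; rewrite big_cons (negPf nPi).
Qed.

Lemma salgX f k : S f -> S (fun x => f x ^+ k).
Proof.
move=> Sf; elim: k => [|k IH]; first exact: (salg_cst HS 1).
by apply: (salg_eq HS) (salgM HS Sf IH) => x _; rewrite exprS.
Qed.

Lemma salg_mxcst m n (A : 'M[R]_(m, n)) : salg_mx S (fun=> A).
Proof. by move=> i j; exact: (salg_cst HS). Qed.

Lemma salg_mxeq m n (A B : X -> 'M[R]_(m, n)) :
  (forall x, D x -> A x = B x) -> salg_mx S A -> salg_mx S B.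
Proof. by move=> AB SA i j; apply: (salg_eq HS) (SA i j) => x /AB->. Qed.

Lemma salg_mxD m n (A B : X -> 'M[R]_(m, n)) :
  salg_mx S A -> salg_mx S B -> salg_mx S (fun x => A x + B x).
Proof.
move=> SA SB i j; apply: (salg_eq HS) (salgD HS (SA i j) (SB i j)) => x _.
by rewrite mxE.
Qed.

Lemma salg_mxN m n (A : X -> 'M[R]_(m, n)) :
  salg_mx S A -> salg_mx S (fun x => - A x).
Proof.
by move=> SA i j; apply: (salg_eq HS) (salgN (SA i j)) => x _; rewrite mxE.
Qed.

Lemma salg_mxB m n (A B : X -> 'M[R]_(m, n)) :
  salg_mx S A -> salg_mx S B -> salg_mx S (fun x => A x - B x).
Proof. by move=> SA SB; apply: salg_mxD => //; exact: salg_mxN. Qed.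

Lemma salg_mxZ m n (c : X -> R) (A : X -> 'M[R]_(m, n)) :
  S c -> salg_mx S A -> salg_mx S (fun x => c x *: A x).
Proof.
move=> Sc SA i j; apply: (salg_eq HS) (salgM HS Sc (SA i j)) => x _.
by rewrite mxE.
Qed.

Lemma salg_mxM m n p (A : X -> 'M[R]_(m, n)) (B : X -> 'M[R]_(n, p)) :
  salg_mx S A -> salg_mx S B -> salg_mx S (fun x => A x *m B x).
Proof.
move=> SA SB i j.
apply: (salg_eq HS) (salg_sum (index_enum _) (P := xpredT)
  (fun k _ => salgM HS (SA i k) (SB k j))) => x _.
by rewrite mxE.
Qed.

Lemma salg_mxT m n (A : X -> 'M[R]_(m, n)) :
  salg_mx S A -> salg_mx S (fun x => (A x)^T).
Proof.
by move=> SA i j; apply: (salg_eq HS) (SA j i) => x _; rewrite mxE.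
Qed.

Lemma salg_det n (A : X -> 'M[R]_n) : salg_mx S A -> S (fun x => \det (A x)).
Proof.
move=> SA; apply: salg_sum => s _; apply: (salgM HS); first exact: (salg_cst HS).
by apply: salg_prod => i _; exact: SA.
Qed.

Lemma salg_mxV n (A : X -> 'M[R]_n) : (forall x, D x -> A x \in unitmx) ->
  salg_mx S A -> salg_mx S (fun x => invmx (A x)).
Proof.
move=> uA SA.
apply: (@salg_mxeq _ _ (fun x => (\det (A x))^-1 *: \adj (A x))).
  by move=> x Dx; rewrite /invmx uA.
apply: salg_mxZ.
  apply: (salgV HS); last exact: salg_det.
  by move=> x /uA; rewrite unitmxE unitfE.
move=> i j.
have Sm : S (fun x => (-1) ^+ (j + i) * \det (row' j (col' i (A x)))).
  apply: (salgM HS); first exact: (salg_cst HS).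
  apply: salg_det => k l; apply: (salg_eq HS) (SA (lift j k) (lift i l)) => x _.
  by rewrite !mxE.
by apply: (salg_eq HS) Sm => x _; rewrite mxE.
Qed.

Lemma salg_row_mx m n1 n2 (A : X -> 'M[R]_(m, n1)) (B : X -> 'M[R]_(m, n2)) :
  salg_mx S A -> salg_mx S B -> salg_mx S (fun x => row_mx (A x) (B x)).
Proof.
move=> SA SB i j; have [k|k] := fintype.splitP j => jk.
  apply: (salg_eq HS) (SA i k) => x _; rewrite (_ : j = lshift n2 k) ?row_mxEl //.
  exact: val_inj.
apply: (salg_eq HS) (SB i k) => x _; rewrite (_ : j = rshift n1 k) ?row_mxEr //.
exact: val_inj.
Qed.

Lemma salg_col_mx m1 m2 n (A : X -> 'M[R]_(m1, n)) (B : X -> 'M[R]_(m2, n)) :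
  salg_mx S A -> salg_mx S B -> salg_mx S (fun x => col_mx (A x) (B x)).
Proof.
move=> SA SB; apply: (@salg_mxeq _ _ (fun x => (row_mx (A x)^T (B x)^T)^T)).
  by move=> x _; rewrite tr_row_mx !trmxK.
by apply: salg_mxT; apply: salg_row_mx; exact: salg_mxT.
Qed.

Lemma salg_block_mx m1 m2 n1 n2 (A : X -> 'M[R]_(m1, n1))
    (B : X -> 'M[R]_(m1, n2)) (C : X -> 'M[R]_(m2, n1))
    (E : X -> 'M[R]_(m2, n2)) :
  salg_mx S A -> salg_mx S B -> salg_mx S C -> salg_mx S E ->
  salg_mx S (fun x => block_mx (A x) (B x) (C x) (E x)).
Proof. by move=> SA SB SC SE; apply: salg_col_mx; apply: salg_row_mx. Qed.

Lemma salg_mxtrace n (A : X -> 'M[R]_n) : salg_mx S A -> S (fun x => \tr (A x)).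
Proof. by move=> SA; apply: salg_sum => i _; exact: SA. Qed.

End SmoothAlgebra.

Lemma Ck_on_le (R : realType) (V W : normedModType R) k l (U : set V) (f : V -> W) :
  (k <= l)%N -> Ck_on l U f -> Ck_on k U f.
Proof.
move=> kl; rewrite -(subnK kl); elim: (l - k)%N => [//|j IH].
by rewrite addSn => /Ck_onW.
Qed.

Section SmoothOn.
Context {R : realType} {V : normedModType R}.

Lemma smooth_on_algebra (U : set V) : open U ->
  smooth_algebra U (fun h : V -> R => smooth_on U h).
Proof.
move=> oU; split.
- by move=> f g fg; exact: eq_smooth_on.
- by move=> c k; exact: Ck_on_cst.
- by move=> f g Sf Sg k; exact: Ck_onD.
- by move=> f g Sf Sg k; exact: Ck_onM.
- by move=> f f0 Sf k; exact: Ck_onV.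
- by move=> A _ f [G <- dG] DA Sf k; exact: (Ck_on_comp1 oU dG DA (Sf k)).
Qed.

Lemma smooth_on_mxE (U : set V) m n (A : V -> 'M[R]_(m, n)) : open U ->
  smooth_on U A <-> salg_mx (fun h : V -> R => smooth_on U h) A.
Proof. exact: smooth_on_mxP. Qed.

Lemma is_derive_diff_comp (W : normedModType R) (f : V -> W) (g : W -> R) x v :
  differentiable g (f x) -> derivable f x v ->
  is_derive x v (fun y => g (f y)) ('d g (f x) ('D_v f x)).
Proof.
move=> dg df; pose h (t : R) := f (t *: v + x).
have h0 : h 0 = f x by rewrite /h scale0r add0r.
have dh : differentiable h 0.
  by apply/derivable1_diffP; exact: (derivable1P _ _ _).1.
have dg' : differentiable g (h 0) by rewrite h0.
have dgh : differentiable (g \o h) 0 by exact: differentiable_comp.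
have Dh : 'D_1 h 0 = 'D_v f x by exact: derive_line.
have E : 'D_v (fun y => g (f y)) x = 'D_1 (g \o h) 0.
  by rewrite -(derive_line (fun y => g (f y))).
apply: DeriveDef.
  by apply/derivable1P; apply/derivable1_diffP.
by rewrite E deriveE // diff_comp //= h0 -(deriveE _ dh) Dh.
Qed.

Lemma is_derive_comp m (f : V -> 'rV[R]_m) (g : 'rV[R]_m -> R) x v
    (O : set 'rV[R]_m) : open O -> O (f x) -> Ck_on 1 O g -> derivable f x v ->
  is_derive x v (fun y => g (f y))
    (\sum_j 'D_v (fun y => f y 0 j) x * 'D_'e_j g (f x)).
Proof.
move=> oO Ofx Cg df.
have [dg gE] := C1_differentiable oO Ofx Cg.
have [D E] := is_derive_diff_comp dg df.
apply: DeriveDef => //; rewrite E gE.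
by apply: eq_bigr => j _; rewrite derive_mx // mxE.
Qed.

Lemma Ck_on_comp k m (U : set V) (O : set 'rV[R]_m) (f : V -> 'rV[R]_m)
    (g : 'rV[R]_m -> R) : open U -> open O -> (forall x, U x -> O (f x)) ->
  Ck_on k U f -> Ck_on k O g -> Ck_on k U (fun x => g (f x)).
Proof.
move=> oU oO UO; elim: k g => [|k IH] g hf hg.
  split=> // x Ux; apply: (@cvg_comp _ _ _ f g _ _ _ (hf.1 _ Ux)).
  exact: hg.1 _ (UO _ Ux).
have [cf df] := hf; have [cg dg] := hg.
have cgf x : U x -> {for x, continuous (fun x => g (f x))}.
  move=> Ux; apply: (@cvg_comp _ _ _ f g _ _ _ (cf _ Ux)).
  exact: cg _ (UO _ Ux).
split=> // v; have [dvf Dvf] := df v.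
have C1 : Ck_on 1 O g by apply: Ck_on_le hg.
have isD x : U x -> is_derive x v (fun y => g (f y))
    (\sum_j 'D_v (fun y => f y 0 j) x * 'D_'e_j g (f x)).
  by move=> Ux; apply: is_derive_comp oO (UO _ Ux) C1 (dvf _ Ux).
split=> [x Ux|]; first by have [] := isD x Ux.
apply: (@eq_Ck_on _ _ _ _ _
  (fun x => \sum_j 'D_v (fun y => f y 0 j) x * 'D_'e_j g (f x))) => //.
  by move=> x Ux; have [_ ->] := isD x Ux.
elim: (index_enum _) => [|j r IHr].
  by under eq_fun do rewrite big_nil; exact: Ck_on_cst.
under eq_fun do rewrite big_cons; apply: Ck_onD => //; apply: Ck_onM => //.
  have [_ /(_ v)[_ +]] := (Ck_on_mxP k.+1 f oU).1 hf 0 j.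
  exact.
exact: (IH ('D_'e_j g) (Ck_onW hf) (dg 'e_j).2).
Qed.

Lemma smooth_on_comp m (U : set V) (O : set 'rV[R]_m) (f : V -> 'rV[R]_m)
    (g : 'rV[R]_m -> R) : open U -> open O -> (forall x, U x -> O (f x)) ->
  smooth_on U f -> smooth_on O g -> smooth_on U (fun x => g (f x)).
Proof. by move=> oU oO UO Sf Sg k; exact: (Ck_on_comp oU oO UO (Sf k) (Sg k)). Qed.

End SmoothOn.

(** * The inverse function theorem *)

Section InverseFunction.
Context {R : realType} {d : nat}.

Definition jac m n (F : 'rV[R]_m -> 'rV[R]_n) (x : 'rV[R]_m) : 'M[R]_(m, n) :=
  \matrix_(i, j) 'D_'e_i (fun y : 'rV[R]_m => F y 0 j) x.

Lemma smooth_on_jac m n (U : set 'rV[R]_m) (F : 'rV[R]_m -> 'rV[R]_n) :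
  open U -> smooth_on U F ->
  salg_mx (fun h : 'rV[R]_m -> R => smooth_on U h) (jac F).
Proof.
move=> oU SF i j; have := smooth_on_derive 'e_i ((smooth_on_mxP _ oU).1 SF 0 j).
by apply: eq_smooth_on => // x _; rewrite mxE.
Qed.

Lemma mulmx_norm_le m n q (A : 'M[R]_(m, n)) (B : 'M[R]_(n, q)) :
  `|A *m B| <= n%:R * (`|A| * `|B|).
Proof.
apply: mx_norm_le => [|i j]; first by rewrite !mulr_ge0.
rewrite mxE; apply: le_trans (ler_norm_sum _ _ _) _.
apply: (@le_trans _ _ (\sum_(k < n) `|A| * `|B|)).
  by apply: ler_sum => k _; rewrite normrM ler_pM ?mx_norm_coord.
by rewrite sumr_const card_ord mulr_natl.
Qed.

Lemma strict_jac m n (U : set 'rV[R]_m) (F : 'rV[R]_m -> 'rV[R]_n) p (e : R) :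
  open U -> U p -> Ck_on 1 U F -> 0 < e ->
  exists2 r, 0 < r & forall x x', `|x - p| < r -> `|x' - p| < r ->
    `|F x - F x' - (x - x') *m jac F p| <= e * `|x - x'|.
Proof.
move=> oU Up CF e0.
have m0 : 0 < (m.+1%:R : R) by rewrite ltr0n.
have H (j : 'I_n) : exists r : R, 0 < r /\ forall x x', `|x - p| < r ->
    `|x' - p| < r ->
    `|F x 0 j - F x' 0 j - \sum_i (x - x') 0 i * 'D_'e_i (fun y => F y 0 j) p|
      <= e / m.+1%:R * \sum_i `|(x - x') 0 i|.
  have [r r0 Hr] := strict_derivative oU Up ((Ck_on_mxP _ _ oU).1 CF 0 j)
    (divr_gt0 e0 m0).
  by exists r; split.
have [rj Hrj] := choice H.
have : \forall r \near (0 : R)^'+, forall j, r < rj j.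
  apply: (@filter_forall _ _ _ _ (at_right_proper_filter (0 : R))) => j.
  by apply: nbhs_right_lt; exact: (Hrj j).1.
move=> /(filterI (nbhs_right_gt 0)) /filter_ex [r [r0 rlt]].
exists r => // x x' xr x'r.
apply: mx_norm_le => [|i j]; first by rewrite mulr_ge0 // ltW.
rewrite ord1 !mxE.
have -> : \sum_k (x - x') 0 k * jac F p k j =
    \sum_i (x - x') 0 i * 'D_'e_i (fun y => F y 0 j) p.
  by apply: eq_bigr => k _; rewrite [jac F p k j]mxE.
apply: le_trans ((Hrj j).2 x x' _ _) _.
- exact: lt_trans xr (rlt j).
- exact: lt_trans x'r (rlt j).
apply: (@le_trans _ _ (e / m.+1%:R * (m%:R * `|x - x'|))).
  by apply: ler_wpM2l; [rewrite ltW // divr_gt0|exact: sum_norm_le].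
rewrite mulrA; apply: ler_wpM2r => //.
rewrite -mulrA ler_piMr ?ltW // mulrC ltr_pdivrMr // mul1r ltr_nat.
exact: ltnSn.
Qed.


Definition local_diffeo (F G : 'rV[R]_d -> 'rV[R]_d) (A O : set 'rV[R]_d) :=
  [/\ open A, open O,
      forall y, O y -> A (G y) /\ F (G y) = y,
      forall x, A x -> O (F x) -> G (F x) = x & smooth_on O G].

(** The Lipschitz bound on [G] turns the strict-derivative error of [F] at [G y] into an error that
    is small compared with [h]. *)
Lemma inverse_is_derive (A O : set 'rV[R]_d) (F G : 'rV[R]_d -> 'rV[R]_d)
    (L : R) y v : open A -> open O -> smooth_on A F ->
  (forall x, A x -> jac F x \in unitmx) ->
  (forall y, O y -> A (G y) /\ F (G y) = y) ->
  (forall y y', O y -> O y' -> `|G y - G y'| <= L * `|y - y'|) -> 0 < L ->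
  O y -> is_derive y v G (v *m invmx (jac F (G y))).
Proof.
move=> oA oO SF uJ FG GL L0 Oy.
set T := invmx _; pose C : R := d%:R * `|T| + 1.
have C0 : 0 < C by rewrite ltr_pwDr // mulr_ge0.
have TC (w : 'rV[R]_d) : `|w *m T| <= C * `|w|.
  apply: le_trans (mulmx_norm_le _ _) _.
  by rewrite [`|w| * _]mulrC mulrA ler_wpM2r // lerDl.
have [AGy FGy] := FG _ Oy.
have K0 : 0 < C * L * `|v| + 1 by rewrite ltr_pwDr // mulr_ge0 // mulr_ge0 // ltW.
suff H : (fun h : R => h^-1 *: (G (h *: v + y) - G y)) @ 0^' --> v *m T.
  by apply: DeriveDef; [apply/cvg_ex; exists (v *m T)|exact/cvg_lim].
apply/cvgrPdist_le => e e0.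
have [r r0 Hr] := strict_jac oA AGy (SF 1%N) (divr_gt0 e0 K0).
have [s s0 Hs] := (near_ballP (y : 'rV[R]_d) _).1
  (open_nbhs_nbhs (conj oO Oy)).
have [c c0 Hc] : exists2 c : R, 0 < c & forall h : R, `|h| < c ->
    `|h| * `|v| < s /\ L * (`|h| * `|v|) < r.
  pose m := Num.min s (r / L).
  have m0 : 0 < m by rewrite lt_min s0 divr_gt0.
  have v0 : 0 < `|v| + 1 by rewrite ltr_pwDr.
  exists (m / (`|v| + 1)); first by rewrite divr_gt0.
  move=> h; rewrite ltr_pdivlMr // => hm.
  have {}hm : `|h| * `|v| < m.
    by apply: le_lt_trans hm; rewrite ler_wpM2l // lerDl.
  move: hm; rewrite lt_min => /andP[hs]; rewrite ltr_pdivlMr //.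
  by rewrite [L * _]mulrC.
near=> h.
have h0 : h != 0 by near: h; exact: nbhs_dnbhs_neq.
have /Hc[hs hr] : `|h| < c by near: h; exact: dnbhs0_lt.
have Oh : O (h *: v + y) by apply: Hs; rewrite addrK normrZ.
have [Ax FGx] := FG _ Oh.
set x := G (h *: v + y) in Ax FGx *.
have xL : `|x - G y| <= L * (`|h| * `|v|).
  by apply: le_trans (GL _ _ Oh Oy) _; rewrite addrK normrZ.
have := Hr x (G y) (le_lt_trans xL hr); rewrite subrr normr0 => /(_ r0).
rewrite FGx FGy addrK => E.
have -> : v *m T - h^-1 *: (x - G y) =
    h^-1 *: ((h *: v - (x - G y) *m jac F (G y)) *m T).
  rewrite mulmxBl -[(x - G y) *m _ *m T]mulmxA mulmxV ?uJ // mulmx1.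
  have -> : (h *: v) *m T = h *: (v *m T) by rewrite scalemxAl.
  exact: scaler_subVr.
rewrite normrZ normfV ler_pdivrMl ?normr_gt0 //.
apply: le_trans (TC _) _.
apply: (@le_trans _ _ (C * (e / (C * L * `|v| + 1) * (L * (`|h| * `|v|))))).
  rewrite ler_pM2l //; apply: le_trans E _.
  by rewrite ler_pM2l // divr_gt0.
have -> : C * (e / (C * L * `|v| + 1) * (L * (`|h| * `|v|))) =
   (C * L * `|v|) / (C * L * `|v| + 1) * (`|h| * e) by ring.
rewrite ler_piMl // ?mulr_ge0 // ?ltW // ltr_pdivrMr // mul1r ltrDl //.
Unshelve. all: by end_near. Qed.

(** Bootstrapping: the derivative of [G] is expressed by [jac F] at [G y], so if [G] is of class C^k
    then so are its derivatives, and [G] is of class C^(k+1). *)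
Lemma inverse_smooth (A O : set 'rV[R]_d) (F G : 'rV[R]_d -> 'rV[R]_d) (L : R) :
  open A -> open O -> smooth_on A F ->
  (forall x, A x -> jac F x \in unitmx) ->
  (forall y, O y -> A (G y) /\ F (G y) = y) ->
  (forall y y', O y -> O y' -> `|G y - G y'| <= L * `|y - y'|) -> 0 < L ->
  smooth_on O G.
Proof.
move=> oA oO SF uJ FG GL L0.
have isD y v := @inverse_is_derive A O F G L y v oA oO SF uJ FG GL L0.
have cG y : O y -> {for y, continuous G}.
  move=> Oy; apply/continuous_ballP => e e0.
  have [s s0 Hs] := (near_ballP (y : 'rV[R]_d) _).1
    (open_nbhs_nbhs (conj oO Oy)).
  exists (Num.min s (e / L)); first by rewrite lt_min s0 divr_gt0.
  move=> y'; rewrite lt_min => /andP[/Hs Oy']; rewrite ltr_pdivlMr // => ye.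
  apply: le_lt_trans (GL _ _ Oy' Oy) _.
  by rewrite mulrC.
have algA := smooth_on_algebra oA.
elim=> [|k IH]; first by split.
split=> // v; split=> [y Oy|]; first by have [] := isD y v Oy.
apply: (@eq_Ck_on _ _ _ _ _ (fun y => v *m invmx (jac F (G y)))) => //.
  by move=> y Oy; have [_ ->] := isD y v Oy.
have SM : salg_mx (fun h : 'rV[R]_d -> R => smooth_on A h)
    (fun x => v *m invmx (jac F x)).
  apply: (salg_mxM algA); first exact: (salg_mxcst algA).
  by apply: (salg_mxV algA) => //; exact: smooth_on_jac.
apply/Ck_on_mxP => // i j.
apply: (Ck_on_comp oO oA _ IH (SM i j k)).
by move=> y /FG[].
Qed.

(** Solving [F x = y] means finding a fixed point of the simplified Newton map [Phi y]. Instead of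
    iterating, the displacement of [Phi y] is minimized on a compact ball. At the image of a
    minimizer the displacement is at most half as large, so the minimum is [0]. *)
Lemma inverse_function (U : set 'rV[R]_d) (F : 'rV[R]_d -> 'rV[R]_d) p :
  open U -> U p -> smooth_on U F -> jac F p \in unitmx ->
  exists G A O, [/\ local_diffeo F G A O, A p, O (F p) & A `<=` U].
Proof.
move=> oU Up SF uJ.
pose T := invmx (jac F p).
pose C : R := d%:R * `|T| + 1.
have C0 : 0 < C by rewrite ltr_pwDr // mulr_ge0.
have TC (v : 'rV[R]_d) : `|v *m T| <= C * `|v|.
  apply: le_trans (mulmx_norm_le _ _) _.
  by rewrite [`|v| * _]mulrC mulrA ler_wpM2r // lerDl.
(* As [C] bounds multiplication by [T], this precision makes [Phi y] a contraction of ratio 1/2. *)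
have e0 : 0 < C^-1 / 2 by rewrite divr_gt0 // invr_gt0.
have [r1 r10 Hr1] := strict_jac oU Up (SF 1%N) e0.
have nU : \forall x \near p, U x by exact: open_nbhs_nbhs (conj oU Up).
have alg := smooth_on_algebra oU.
have nJ : \forall x \near p, jac F x \in unitmx.
  have Sdet := salg_det alg (smooth_on_jac oU SF).
  have /(cvgr_neq0 (F := nbhs p)) : (fun x => \det (jac F x)) @ p --> \det (jac F p).
    exact: Ck_on_continuous (Sdet 0%N) Up.
  rewrite -unitfE -unitmxE => /(_ uJ); apply: filterS => x.
  by rewrite unitmxE unitfE.
have [r2 r20 Hr2] := (near_ballP (p : 'rV[R]_d) _).1 (filterI nU nJ).
pose r := Num.min r1 r2.
have r0 : 0 < r by rewrite lt_min r10.
pose A := [set x | `|x - p| < r].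
pose q := r / 2.
have q0 : 0 < q by rewrite divr_gt0.
have qr : q < r by rewrite ltr_pdivrMr // ltr_pMr // ltr1n.
(* With this radius [Phi y] maps the closed ball of radius [q] into itself: [q / 2] comes from the
   contraction and at most [q / 2] from the distance of [y] to [F p]. *)
pose O := [set y | `|y - F p| < q / C / 2].
pose Phi y x := x - (F x - y) *m T.
have PhiB y y' x x' : A x -> A x' ->
    `|Phi y x - Phi y' x'| <= `|x - x'| / 2 + C * `|y - y'|.
  move=> Ax Ax'.
  have -> : Phi y x - Phi y' x' =
      - ((F x - F x' - (x - x') *m jac F p) *m T) + (y - y') *m T.
    rewrite /Phi [(_ - _ *m jac F p) *m T]mulmxBl -mulmxA mulmxV // mulmx1.
    by rewrite !mulmxBl; apply/rowP => i; rewrite !mxE; ring.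
  apply: le_trans (ler_normD _ _) _; rewrite normrN lerD ?TC //.
  apply: le_trans (TC _) _.
  have H' : `|x - p| < r1 by apply: lt_le_trans Ax _; rewrite ge_min lexx.
  have H'' : `|x' - p| < r1 by apply: lt_le_trans Ax' _; rewrite ge_min lexx.
  have := Hr1 x x' H' H''; rewrite -(ler_pM2l C0) => /le_trans; apply.
  by rewrite !mulrA divff ?gt_eqF // mul1r mulrC.
have Finj x x' : A x -> A x' -> F x = F x' -> x = x'.
  move=> Ax Ax' FE; have := PhiB 0 0 x x' Ax Ax'.
  rewrite subrr normr0 mulr0 addr0 (_ : Phi 0 x - Phi 0 x' = x - x') => [H|]; last first.
    by rewrite /Phi FE; apply/rowP => i; rewrite !mxE; ring.
  apply/eqP; rewrite -subr_eq0 -normr_le0.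
  have : `|x - x'| <= `|x - x'| / 2 by exact: H.
  by lra.
have solve y : O y -> exists x, `|x - p| <= q /\ F x = y.
  move=> Oy; pose K := [set x : 'rV[R]_d | `|x - p| <= q].
  have KA x : K x -> A x by move=> Kx; exact: le_lt_trans Kx qr.
  have Kp : K p by rewrite /K /= subrr normr0 ltW.
  have cK : compact K.
    apply: bounded_closed_compact.
      exists (q + `|p|); split=> [|M qM x Kx]; first by rewrite num_real.
      rewrite -[x](subrK p); apply: le_trans (ler_normD _ _) _.
      by apply: le_trans (ltW qM); rewrite lerD2r.
    exact: closed_normB.
  have PhiK x : K x -> K (Phi y x).
    move=> Kx; rewrite /K /=.
    have -> : Phi y x - p = (Phi y x - Phi (F p) p).
      by rewrite /Phi subrr mul0mx subr0.
    apply: le_trans (PhiB y (F p) x p (KA _ Kx) (KA _ Kp)) _.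
    have : C * `|y - F p| <= q / 2.
      rewrite -ler_pdivlMl // mulrA [C^-1 * q]mulrC; exact: ltW.
    by move: Kx; rewrite /K /=; lra.
  have cF x : K x -> {for x, continuous F}.
    move=> Kx; apply: (@Ck_on_continuous _ _ _ 0) (SF 0%N) _.
    apply: (Hr2 x _).1; apply: lt_le_trans (KA _ Kx) _.
    by rewrite ge_min lexx orbT.
  have [||x /set_mem Kx xmin] := @EVT_min_rV R d (fun x => `|Phi y x - x|) K _ cK.
  - by exists p.
  - apply: continuous_in_subspaceT => x /set_mem Kx.
    apply: (@continuous_at_normB _ 'rV[R]_d); last exact: cvg_id.
    rewrite /Phi; apply/(@continuous_ballP _ 'rV[R]_d) => e e_gt0.
    have C10 : 0 < 1 + C by exact: addr_gt0.
    have eC := divr_gt0 e_gt0 C10.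
    have [s s0 Hs] := (continuous_ballP _ _).1 (cF x Kx) _ eC.
    exists (Num.min s (e / (1 + C))) => [|z]; first by rewrite lt_min s0.
    rewrite lt_min => /andP[/Hs Fz xz].
    have -> : z - (F z - y) *m T - (x - (F x - y) *m T) = (z - x) - (F z - F x) *m T.
      by rewrite !mulmxBl; apply/rowP => i; rewrite !mxE; ring.
    apply: le_lt_trans (ler_normB _ _) _.
    apply: le_lt_trans (lerD (lexx _) (TC _)) _.
    have -> : e = e / (1 + C) + C * (e / (1 + C)) by field; rewrite gt_eqF.
    by apply: ltrD => //; rewrite ltr_pM2l.
  exists x; split=> //.
  have /mem_set/xmin H1 := PhiK _ Kx.
  have H2 := PhiB y y _ _ (KA _ (PhiK _ Kx)) (KA _ Kx).
  rewrite subrr normr0 mulr0 addr0 in H2.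
  have {H1 H2} : `|Phi y x - x| <= 0.
    have H := le_trans H1 H2.
    have : `|Phi y x - x| <= `|Phi y x - x| / 2 by exact: H.
    by lra.
  rewrite normr_le0 /Phi addrC addKr oppr_eq0 => /eqP FyT.
  have : (F x - y) *m T *m jac F p = 0 by rewrite FyT mul0mx.
  by rewrite -mulmxA mulVmx // mulmx1 => /eqP; rewrite subr_eq0 => /eqP.
have /choice[G HG] : forall y, exists x, O y -> `|x - p| <= q /\ F x = y.
  move=> y; have [/solve[x Hx]|nO] := pselect (O y); first by exists x.
  by exists p.
have oA : open A by exact: open_normB.
have oO : open O by exact: open_normB.
have AU x : A x -> U x /\ jac F x \in unitmx.
  by move=> Ax; apply: Hr2; apply: lt_le_trans Ax _; rewrite ge_min lexx orbT.
have FG y : O y -> A (G y) /\ F (G y) = y.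
  by move=> /HG[Gq FGy]; split=> //; exact: le_lt_trans Gq qr.
have GL y y' : O y -> O y' -> `|G y - G y'| <= 2 * C * `|y - y'|.
  move=> Oy Oy'; have [Ay Ey] := FG _ Oy; have [Ay' Ey'] := FG _ Oy'.
  have := PhiB y y' _ _ Ay Ay'.
  rewrite /Phi Ey Ey' !subrr !mul0mx !subr0 => H.
  have : `|G y - G y'| <= `|G y - G y'| / 2 + C * `|y - y'| by exact: H.
  by lra.
exists G, A, O; split.
- split=> //.
  + move=> x Ax OFx; have [AG EG] := FG _ OFx.
    exact: Finj AG Ax EG.
  + apply: (inverse_smooth oA oO _ _ FG GL) => //.
    * by apply: smooth_on_sub SF => x /AU[].
    * by move=> x /AU[].
    * by rewrite mulr_gt0.
- by rewrite /A /= subrr normr0.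
- by rewrite /O /= subrr normr0 !divr_gt0.
- by move=> x /AU[].
Qed.

End InverseFunction.


(** * Immersed manifolds and their tubular neighbourhoods *)

Section Jacobian.
Context {R : realType}.

Lemma diff_of_approx_vec (V W : normedModType R) (f : V -> W) (p : V)
    (L : {linear V -> W}) : continuous L ->
  (forall e : R, 0 < e ->
     \forall h \near (0 : V), `|f (h + p) - f p - L h| <= e * `|h|) ->
  differentiable f p /\ 'd f p = L :> (V -> W).
Proof.
move=> Lc H; have fE : f \o shift p = cst (f p) + L +o_ (0 : V) id.
  apply/eqaddoP => e e0; apply: filterS (H e e0) => h.
  suff -> : (f \o shift p - (cst (f p) + L)) h = f (h + p) - f p - L h by [].
  by rewrite !fctE /= opprD addrA.
have dE := diff_unique Lc fE.
by split=> //; apply/diff_locallyP; rewrite dE; split.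
Qed.

Lemma mulmxr_continuous m n (A : 'M[R]_(m, n)) :
  continuous (fun v : 'rV[R]_m => v *m A).
Proof.
move=> x; apply/(@continuous_ballP _ 'rV[R]_m) => e e0.
have C0 : 0 < m%:R * `|A| + 1 by rewrite ltr_pwDr // mulr_ge0.
exists (e / (m%:R * `|A| + 1)) => [|y]; first exact: divr_gt0.
rewrite ltr_pdivlMr // -mulmxBl => xy; apply: le_lt_trans xy.
apply: le_trans (mulmx_norm_le _ _) _.
by rewrite mulrCA ler_wpM2l // lerDl.
Qed.

Lemma jacobianE m n (U : set 'rV[R]_m) (F : 'rV[R]_m -> 'rV[R]_n) p :
  open U -> U p -> Ck_on 1 U F -> differentiable F p /\ 'J F p = jac F p.
Proof.
move=> oU Up CF.
have [] := @diff_of_approx_vec 'rV[R]_m 'rV[R]_n F p (mulmxr (jac F p)).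
- exact: mulmxr_continuous.
- move=> e e0; have [r r0 Hr] := strict_jac oU Up CF e0.
  apply: (near_ballP (0 : 'rV[R]_m) _).2; exists r => // h; rewrite subr0 => hr.
  have := Hr (h + p) p; rewrite addrK subrr normr0 => /(_ hr r0).
  exact.
move=> dF dE; split=> //; apply/row_matrixP => i.
by rewrite /jacobian !rowE mul_rV_lin1 /= dE.
Qed.

Lemma near_eq_jac m n (F G : 'rV[R]_m -> 'rV[R]_n) (p : 'rV[R]_m) :
  (\forall x \near p, F x = G x) -> jac F p = jac G p.
Proof.
move=> FG; apply/matrixP => i j; rewrite !mxE; apply: near_eq_derive.
by apply: filterS FG => x ->.
Qed.

Lemma jac_comp m n q (U : set 'rV[R]_m) (O : set 'rV[R]_n)
    (F : 'rV[R]_m -> 'rV[R]_n) (G : 'rV[R]_n -> 'rV[R]_q) p :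
  open U -> open O -> U p -> O (F p) -> Ck_on 1 U F -> Ck_on 1 O G ->
  jac (fun x => G (F x)) p = jac F p *m jac G (F p).
Proof.
move=> oU oO Up OFp CF CG; apply/matrixP => i j; rewrite !mxE.
have dF : derivable F p 'e_i by have [_ /(_ 'e_i)[+ _]] := CF; exact.
have [_ ->] := is_derive_comp oO OFp ((Ck_on_mxP _ _ oO).1 CG 0 j) dF.
by apply: eq_bigr => k _; rewrite !mxE.
Qed.

Lemma jac_id m (p : 'rV[R]_m) : jac (fun x => x) p = 1%:M.
Proof.
apply/matrixP => i j; rewrite !mxE.
have Cid : Ck_on 1 setT (fun x : 'rV[R]_m => x) by exact: smooth_on_id.
have := derive_mx (@derivable_id _ 'rV[R]_m p 'e_i).
rewrite derive_id => /matrixP/(_ 0 j); rewrite !mxE => <-.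
by rewrite eqxx /= eq_sym.
Qed.

Lemma gram_unit m n (A : 'M[R]_(m, n)) : row_free A -> A *m A^T \in unitmx.
Proof.
move=> fA; rewrite -row_free_unit -kermx_eq0; apply/rowV0P => v.
rewrite sub_kermx mulmxA => /eqP vAA.
have : (v *m A) *m (v *m A)^T = 0.
  by rewrite trmx_mul mulmxA vAA mul0mx.
move=> /matrixP/(_ 0 0); rewrite !mxE => /eqP.
rewrite psumr_eq0 => [/allP vA0|i _]; last by rewrite !mxE -expr2 sqr_ge0.
have {}vA0 : v *m A = 0.
  apply/rowP => i; have := vA0 i (mem_index_enum _).
  by rewrite /= [(v *m A)^T _ _]mxE mulf_eq0 orbb => /eqP ->; rewrite mxE.
by apply/eqP; rewrite -(mulmx_free_eq0 _ fA) vA0.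
Qed.

Lemma invmxM n (A B : 'M[R]_n) : A \in unitmx -> B \in unitmx ->
  invmx (A *m B) = invmx B *m invmx A.
Proof.
move=> uA uB; have uAB : A *m B \in unitmx by rewrite unitmx_mul uA.
rewrite -[RHS]mul1mx -(mulVmx uAB) -mulmxA -[invmx (A *m B) in LHS]mulmx1.
by congr (_ *m _); rewrite mulmxA -(mulmxA A) mulmxV // mulmx1 mulmxV.
Qed.

End Jacobian.

Section SmoothMaps.
Context {R : realType} {d : nat} (M : smooth_space R d).
Implicit Types (i j : chart_index M) (x : M).

Definition smoothM (h : M -> R) : Prop :=
  forall i, smooth_on (chart i @` dom i) (h \o chart_inv i).

Lemma smoothM_algebra : smooth_algebra setT smoothM.
Proof.
have alg i := smooth_on_algebra (@open_cod _ _ M i); split.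
- by move=> f g fg Sf i; apply: (salg_eq (alg i)) (Sf i) => y _; exact: fg.
- by move=> c i; exact: (salg_cst (alg i)).
- by move=> f g Sf Sg i; exact: (salgD (alg i)) (Sf i) (Sg i).
- by move=> f g Sf Sg i; exact: (salgM (alg i)) (Sf i) (Sg i).
- by move=> f f0 Sf i; apply: (salgV (alg i)) (Sf i) => y _; exact: f0.
- move=> A g f sg Af Sf i; apply: (salg_comp1 (alg i)) sg _ (Sf i) => y _.
  exact: Af.
Qed.

Lemma chart_in i x : dom i x -> (chart i @` dom i) (chart i x).
Proof. by move=> dx; exists x. Qed.

Lemma near_overlap i j x : dom i x -> dom j x ->
  \forall y \near (chart i x : 'rV[R]_d), [/\ (chart i @` dom i) y,
    dom i (chart_inv i y) & dom j (chart_inv i y)].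
Proof.
move=> dix djx.
have n1 : \forall y \near (chart i x : 'rV[R]_d), (chart i @` dom i) y.
  by apply: open_nbhs_nbhs; split; [exact: open_cod|exact: chart_in].
have n2 : \forall y \near (chart i x : 'rV[R]_d), dom j (chart_inv i y).
  apply: (@chart_inv_cont _ _ M i _ (chart_in dix)).
  rewrite chartK //; apply: open_nbhs_nbhs; split=> //; exact: open_dom.
apply: filterS2 n1 n2 => y [z dz <-]; by rewrite chartK // => djz; split=> //; exists z.
Qed.

Lemma open_overlap i j : open (chart i @` (dom i `&` @dom _ _ M j)).
Proof.
rewrite openE => _ [x [dix djx] <-] /=.
apply: filterS (near_overlap dix djx) => y [[z dz <-]].
by rewrite chartK // => _ djz; exists z.
Qed.

Lemma coord_changeE i j x : dom i x -> dom j x ->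
  coord_change i j x = jac (chart j \o chart_inv i) (chart i x).
Proof.
move=> dix djx.
have U : (chart i @` (dom i `&` dom j)) (chart i x) by exists x.
exact: (jacobianE (@open_overlap i j) U (@transition_smooth _ _ M i j 1%N)).2.
Qed.

Lemma jac_chart_change e (g : M -> 'rV[R]_e) i j x (O : set 'rV[R]_d) :
  dom i x -> dom j x -> open O -> O (chart j x) ->
  Ck_on 1 O (g \o chart_inv j) ->
  jac (g \o chart_inv i) (chart i x) =
  coord_change i j x *m jac (g \o chart_inv j) (chart j x).
Proof.
move=> dix djx oO Ox Cg; rewrite coord_changeE //.
have E : (chart j \o chart_inv i) (chart i x) = chart j x by rewrite /= chartK.
have U : (chart i @` (dom i `&` dom j)) (chart i x) by exists x.
have Oc : O ((chart j \o chart_inv i) (chart i x)) by rewrite E.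
rewrite -E -(jac_comp (@open_overlap i j) oO U Oc (@transition_smooth _ _ M i j 1%N) Cg).
apply: near_eq_jac; apply: filterS (near_overlap dix djx) => y [_ diy djy] /=.
by rewrite chartK.
Qed.

Lemma coord_changeK i j x : dom i x -> dom j x ->
  coord_change i j x *m coord_change j i x = 1%:M.
Proof.
move=> dix djx; rewrite [coord_change j i x]coord_changeE //.
have U : (chart j @` (dom j `&` dom i)) (chart j x) by exists x.
have := jac_chart_change (g := chart i) dix djx (@open_overlap j i) U
  (@transition_smooth _ _ M j i 1%N).
rewrite coord_changeE // => <-; rewrite -(jac_id (chart i x)); apply: near_eq_jac.
by apply: filterS (near_overlap dix dix) => _ [[z dz <-] _ _] /=; rewrite chartK.
Qed.

Definition smoothM_row e (g : M -> 'rV[R]_e) : Prop := salg_mx smoothM g.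

Lemma smoothM_row_on e (g : M -> 'rV[R]_e) i : smoothM_row g ->
  smooth_on (chart i @` dom i) (g \o chart_inv i).
Proof.
by move=> Sg; apply/smooth_on_mxP; [exact: open_cod|move=> k l; exact: Sg].
Qed.

Lemma smoothM_jac e (g : M -> 'rV[R]_e) i : smoothM_row g ->
  salg_mx (fun h : 'rV[R]_d -> R => smooth_on (chart i @` dom i) h)
    (jac (g \o chart_inv i)).
Proof. by move=> Sg; apply: smooth_on_jac; [exact: open_cod|exact: smoothM_row_on]. Qed.

Lemma smoothM_jac_change e (g : M -> 'rV[R]_e) i j x : smoothM_row g ->
  dom i x -> dom j x ->
  jac (g \o chart_inv i) (chart i x) =
  coord_change i j x *m jac (g \o chart_inv j) (chart j x).
Proof.
move=> Sg dix djx.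
exact: jac_chart_change dix djx (@open_cod _ _ M j) (chart_in djx)
  (smoothM_row_on j Sg 1%N).
Qed.

Lemma smoothM_continuous (h : M -> R) : smoothM h -> continuous h.
Proof.
move=> Sh x; have dx := dom_pref x.
have c1 := Ck_on_continuous (Sh (pref x) 0%N) (chart_in dx).
have : {for x, continuous ((h \o chart_inv (pref x)) \o chart (pref x))}.
  apply: (@cvg_comp _ _ _ (chart (pref x)) (h \o chart_inv (pref x)) _ _ _
    (chart_cont dx)); exact: c1.
move=> H; rewrite /continuous_at; have E : h x = ((h \o chart_inv (pref x)) \o chart (pref x)) x.
  by rewrite /= chartK.
rewrite E; apply: cvg_trans H; apply: near_eq_cvg.
have : \forall y \near x, dom (pref x) y.
  by apply: open_nbhs_nbhs; split=> //; exact: open_dom.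
by apply: filterS => y dy; rewrite /= chartK.
Qed.

End SmoothMaps.


(** * Derivatives along an immersed manifold, in ambient coordinates *)

Section Immersion.
Context {R : realType} {d N : nat} {M : smooth_space R d}.
Implicit Types (h : M -> R) (x : M).

Definition dpart x (l : 'I_d) h : R :=
  'D_'e_l (h \o chart_inv (pref x)) (chart (pref x) x).

Definition tmx e (g : M -> 'rV[R]_e) x : 'M[R]_(d, e) :=
  jac (g \o chart_inv (pref x)) (chart (pref x) x).

Lemma tmxE e (g : M -> 'rV[R]_e) x l j : tmx g x l j = dpart x l (fun y => g y 0 j).
Proof. by rewrite mxE. Qed.

Definition immersion (f : M -> 'rV[R]_N) : Prop :=
  smoothM_row f /\ forall x, row_free (tmx f x).

Variable f : M -> 'rV[R]_N.

(** The Moore-Penrose inverse of the tangent map. It depends on the chart [pref x], but [tproj], the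
    orthogonal projection onto the tangent space, does not. *)
Definition pinv x : 'M[R]_(N, d) := (tmx f x)^T *m invmx (tmx f x *m (tmx f x)^T).

Definition tproj x : 'M[R]_N := pinv x *m tmx f x.

(* The derivative along the tangential part of the [k]-th basis vector of the
   ambient space. *)
Definition der (k : 'I_N) h x : R := \sum_l pinv x k l * dpart x l h.

Hypothesis imm : immersion f.

Lemma tmx_pinv x : tmx f x *m pinv x = 1%:M.
Proof. by rewrite mulmxA mulmxV // gram_unit //; have [_] := imm. Qed.

Lemma tmx_tproj x : tmx f x *m tproj x = tmx f x.
Proof. by rewrite mulmxA tmx_pinv mul1mx. Qed.

Lemma tproj_idem x : tproj x *m tproj x = tproj x.
Proof. by rewrite -mulmxA tmx_tproj. Qed.

Lemma tproj_pinv x : tproj x *m pinv x = pinv x.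
Proof. by rewrite -mulmxA tmx_pinv mulmx1. Qed.

Lemma tr_tproj x : (tproj x)^T = tproj x.
Proof. by rewrite /tproj /pinv !trmx_mul trmx_inv trmx_mul !trmxK mulmxA. Qed.

Lemma der_matrix e (g : M -> 'rV[R]_e) x :
  \matrix_(k, j) der k (fun y => g y 0 j) x = pinv x *m tmx g x.
Proof.
by apply/matrixP => k j; rewrite !mxE; apply: eq_bigr => l _; rewrite tmxE.
Qed.

Lemma der_coord k j x : der k (fun y => f y 0 j) x = tproj x k j.
Proof. by have /matrixP/(_ k j) := der_matrix f x; rewrite mxE. Qed.

Lemma smoothM_row1 h : smoothM h -> smoothM_row (fun x => (h x)%:M : 'rV[R]_1).
Proof.
move=> Sh i j; apply: (salg_eq (smoothM_algebra M)) Sh => x _.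
by rewrite !ord1 mxE eqxx mulr1n.
Qed.

Lemma dpart_row1 h x l : dpart x l h = tmx (fun y => (h y)%:M : 'rV[R]_1) x l 0.
Proof.
rewrite tmxE; congr ('D_'e_l _ _); apply/funext => y /=.
by rewrite mxE eqxx mulr1n.
Qed.

(** The chart [pref x] may jump with [x], so smoothness has to be checked in a fixed chart [i]. The
    change of charts cancels between the pseudo-inverse and the partial derivatives. *)
Lemma der_chartE k h i x : smoothM h -> dom i x ->
  der k h x = \sum_l
    ((jac (f \o chart_inv i) (chart i x))^T *m
      invmx (jac (f \o chart_inv i) (chart i x) *m
             (jac (f \o chart_inv i) (chart i x))^T)) k l *
    'D_'e_l (h \o chart_inv i) (chart i x).
Proof.
move=> Sh dix; have [Sf rf] := imm.
have dpx := dom_pref x.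
rewrite (smoothM_jac_change Sf dix dpx) -/(tmx f x).
have Ch : \col_l 'D_'e_l (h \o chart_inv i) (chart i x) =
    coord_change i (pref x) x *m \col_l dpart x l h.
  have := smoothM_jac_change (smoothM_row1 Sh) dix dpx.
  move=> /matrixP E; apply/matrixP => l j; rewrite ord1 mxE.
  have := E l 0; rewrite mxE => E'.
  transitivity ('D_'e_l (fun y => (((fun x0 => (h x0)%:M : 'rV[R]_1) \o chart_inv i) y) 0 0) (chart i x)).
    by congr ('D_'e_l _ _); apply/funext => y /=; rewrite mxE eqxx mulr1n.
  rewrite [LHS]E' [LHS]mxE [RHS]mxE; apply: eq_bigr => l' _; congr (_ * _).
  by rewrite [RHS]mxE dpart_row1.
transitivity ((pinv x *m \col_l dpart x l h) k 0).
  by rewrite [RHS]mxE; apply: eq_bigr => l _; rewrite [X in _ = _ * X]mxE.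
set C := coord_change i (pref x) x in Ch *; set A := tmx f x.
have [uC _] := mulmx1_unit (coord_changeK dix dpx); rewrite -/C in uC.
transitivity (((C *m A)^T *m invmx (C *m A *m (C *m A)^T) *m
    \col_l 'D_'e_l (h \o chart_inv i) (chart i x)) k 0); last first.
  by rewrite mxE; apply: eq_bigr => l _; rewrite [X in _ * X]mxE.
congr (fun_of_matrix _ k 0).
have uG : A *m A^T \in unitmx by apply: gram_unit; exact: rf.
rewrite Ch trmx_mul.
have -> : C *m A *m (A^T *m C^T) = C *m (A *m A^T) *m C^T by rewrite !mulmxA.
have -> : invmx (C *m (A *m A^T) *m C^T) =
    invmx C^T *m invmx (A *m A^T) *m invmx C.
  by rewrite !invmxM ?unitmx_mul ?uC ?uG ?unitmx_tr // !mulmxA.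
by rewrite !mulmxA mulmxK ?unitmx_tr // -(mulmxA _ (invmx C)) mulVmx // mulmx1.
Qed.

Lemma smoothM_der k h : smoothM h -> smoothM (der k h).
Proof.
move=> Sh i; have oi := @open_cod _ _ M i; have alg := smooth_on_algebra oi.
have [Sf rf] := imm.
have SJ := smoothM_jac i Sf.
have SP : salg_mx (fun g : 'rV[R]_d -> R => smooth_on (chart i @` dom i) g)
    (fun y => (jac (f \o chart_inv i) y)^T *m
      invmx (jac (f \o chart_inv i) y *m (jac (f \o chart_inv i) y)^T)).
  apply: (salg_mxM alg); first exact: (salg_mxT alg).
  apply: (salg_mxV alg); last by apply: (salg_mxM alg) => //; exact: (salg_mxT alg).
  move=> _ [x dx <-]; apply: gram_unit.
  rewrite (smoothM_jac_change Sf dx (dom_pref x)) -row_leq_rank mxrankMfree ?rf //.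
  by have /mulmx1_unit[uC _] := coord_changeK dx (dom_pref x); rewrite mxrank_unit.
have SS : smooth_on (chart i @` dom i) (fun y => \sum_l
    ((jac (f \o chart_inv i) y)^T *m invmx (jac (f \o chart_inv i) y *m
             (jac (f \o chart_inv i) y)^T)) k l *
    'D_'e_l (h \o chart_inv i) y).
  apply: (salg_sum alg) => l _; apply: (salgM alg); first exact: SP.
  exact: smooth_on_derive.
apply: (salg_eq alg) SS => _ [x dx <-] /=.
by rewrite [in RHS]chartK // (der_chartE k Sh dx).
Qed.

Lemma dpart_derivable h x l : smoothM h ->
  derivable (h \o chart_inv (pref x)) (chart (pref x) x) 'e_l.
Proof.
by move=> Sh; apply: smooth_on_derivable (Sh (pref x)) _; exists x => //; exact: dom_pref.
Qed.

Lemma derD k g h x : smoothM g -> smoothM h ->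
  der k (fun y => g y + h y) x = der k g x + der k h x.
Proof.
move=> Sg Sh; rewrite /der -big_split /=; apply: eq_bigr => l _.
by rewrite -mulrDr; congr (_ * _); apply: deriveD; exact: dpart_derivable.
Qed.

Lemma derM k g h x : smoothM g -> smoothM h ->
  der k (fun y => g y * h y) x = g x * der k h x + h x * der k g x.
Proof.
move=> Sg Sh; rewrite /der !mulr_sumr -big_split /=; apply: eq_bigr => l _.
rewrite [in RHS]mulrCA [X in _ = _ + X]mulrCA -mulrDr; congr (_ * _).
have := deriveM (dpart_derivable (x := x) (l := l) Sg) (dpart_derivable (x := x) (l := l) Sh).
rewrite /= chartK; last exact: dom_pref.
by move=> E; rewrite /dpart -[RHS]E.
Qed.

Lemma der_cst k (c : R) x : der k (fun=> c) x = 0.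
Proof.
rewrite /der big1 // => l _; rewrite (_ : dpart _ _ _ = 0) ?mulr0 //.
exact: derive_cst.
Qed.

Lemma der_comp1 k (g : R -> R) (a : R) h x : smoothM h -> is_derive (h x) 1 g a ->
  der k (fun y => g (h y)) x = a * der k h x.
Proof.
move=> Sh dg; rewrite /der mulr_sumr; apply: eq_bigr => l _.
rewrite mulrCA; congr (_ * _).
have E : (h \o chart_inv (pref x)) (chart (pref x) x) = h x.
  by rewrite /= chartK //; exact: dom_pref.
have [D Da] := dg.
have dg' : differentiable g ((h \o chart_inv (pref x)) (chart (pref x) x)).
  by rewrite E; apply/derivable1_diffP.
have [_ E2] := is_derive_diff_comp dg' (dpart_derivable (x := x) (l := l) Sh).
rewrite /dpart [LHS]E2 E -Da -derive1E (deriv1E D) /=.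
by rewrite mulrC.
Qed.

End Immersion.


Section ContinuousAlgebra.
Context {R : realType} {X : topologicalType}.

Lemma continuous_algebra : smooth_algebra setT (fun h : X -> R => continuous h).
Proof.
split.
- by move=> f g fg cf; rewrite (_ : g = f) //; apply/funext => x; rewrite fg.
- by move=> c x; exact: cvg_cst.
- by move=> f g cf cg x; apply: cvgD; [exact: cf|exact: cg].
- by move=> f g cf cg x; apply: cvgM; [exact: cf|exact: cg].
- by move=> f f0 cf x; apply: cvgV; [exact: f0|exact: cf].
- move=> A g f [G <- dG] Af cf x.
  apply: (@cvg_comp _ _ _ f (G 0%N) _ _ _ (cf x)).
  have [D _] := dG 0%N _ (Af x I).
  have : {for f x, continuous (G 0%N)}.
    by apply: differentiable_continuous; exact/derivable1_diffP.
  exact.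
Qed.

Lemma continuous_mx m n (A : X -> 'M[R]_(m, n)) :
  salg_mx (fun h : X -> R => continuous h) A -> continuous A.
Proof. by move=> cA x; apply: cvg_mxP => i j; exact: cA. Qed.

Lemma salg_mx_continuous m n (A : X -> 'M[R]_(m, n)) :
  continuous A -> salg_mx (fun h : X -> R => continuous h) A.
Proof. by move=> cA i j x; exact: cvg_mx_coord (cA x). Qed.

End ContinuousAlgebra.

Section ScalarDerivatives.
Context {R : realType} {V : normedModType R}.

Lemma derive_mul_zero (w q : V -> R) z v : derivable w z v -> derivable q z v ->
  w z = 0 -> derivable (fun x => w x * q x) z v /\
  'D_v (fun x => w x * q x) z = 'D_v w z * q z.
Proof.
move=> dw dq wz; split; first exact: derivableM.
have := deriveM dw dq; rewrite wz scale0r add0r => E.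
by rewrite [LHS]E /GRing.scale /= mulrC.
Qed.

Lemma derive_add_sum n (g : V -> R) (h : 'I_n -> V -> R) z v : derivable g z v ->
  (forall k, derivable (h k) z v) ->
  'D_v (fun x => g x + \sum_k h k x) z = 'D_v g z + \sum_k 'D_v (h k) z.
Proof.
move=> dg dh.
have -> : (fun x => g x + \sum_k h k x) = g + \sum_(k < n) h k.
  by apply/funext => x; rewrite fctE fct_sumE.
by rewrite deriveD ?derive_sum //; exact: derivable_sum.
Qed.

Lemma normrB_lt1 (a b : V) : `|a - b| < 1 -> `|a| <= `|b| + 1.
Proof.
move=> ab; rewrite -{1}(subrK b a) addrC.
by apply: le_trans (ler_normD _ _) _; rewrite lerD2l ltW.
Qed.

End ScalarDerivatives.

Section NearUnit.
Context {R : realType} {T : topologicalType}.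

Lemma near_unitmx n (A : T -> 'M[R]_n) (y : T) :
  {for y, continuous (fun x => \det (A x))} -> A y \in unitmx ->
  \forall x \near y, A x \in unitmx.
Proof.
move=> cA uA; have : \forall x \near y, \det (A x) != 0.
  by move/(cvgr_neq0 (F := nbhs y)): cA; apply; rewrite -unitfE -unitmxE.
by apply: filterS => x; rewrite unitmxE unitfE.
Qed.

End NearUnit.

Section SmoothRow.
Context {R : realType} {m : nat}.

Lemma smooth_on_coord (U : set 'rV[R]_m) (k : 'I_m) :
  open U -> smooth_on U (fun z : 'rV[R]_m => z 0 k).
Proof.
by move=> oU; apply: ((smooth_on_mxP _ oU).1 _ 0 k); exact: smooth_on_id.
Qed.

Lemma derive_coord (v z : 'rV[R]_m) (k : 'I_m) :
  'D_v (fun z : 'rV[R]_m => z 0 k) z = v 0 k.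
Proof.
have := derive_mx (@derivable_id _ 'rV[R]_m z v).
by rewrite derive_id => /matrixP/(_ 0 k); rewrite !mxE => <-.
Qed.

Lemma lsubmx_continuous n1 n2 : continuous (fun z : 'rV[R]_(n1 + n2) => lsubmx z).
Proof.
apply: continuous_mx => k j; 
  rewrite (_ : (fun z : 'rV[R]_(n1 + n2) => lsubmx z k j) =
    fun z : 'rV[R]_(n1 + n2) => z k (lshift n2 j)).
  by move=> z; exact: coord_continuous.
by apply/funext => z; rewrite mxE.
Qed.

End SmoothRow.

(** * Tubular neighbourhoods near one point *)

Section TubeLocal.
Context {R : realType} {d c : nat} {M : smooth_space R d}.
Variable f : M -> 'rV[R]_(d + c).
Hypothesis imm : immersion f.
Implicit Types (x p : M) (v z : 'rV[R]_(d + c)).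

Definition normal x v : Prop := v *m tproj f x = 0.

Lemma smoothM_tproj : salg_mx (@smoothM _ _ M) (tproj f).
Proof.
move=> k j; apply: (salg_eq (smoothM_algebra M) (f := der f k (fun y => f y 0 j))).
  by move=> x _; rewrite der_coord.
by apply: smoothM_der => //; exact: imm.1.
Qed.

Lemma rank_tproj x : \rank (tproj f x) = d.
Proof.
have rA : \rank (tmx f x) = d by exact/eqP/(imm.2 x).
apply/eqP; rewrite eqn_leq; apply/andP; split.
  by rewrite -[X in (_ <= X)%N]rA /tproj; exact: mxrankM_maxr.
rewrite -[X in (X <= _)%N]rA -{1}(tmx_tproj imm x); exact: mxrankM_maxr.
Qed.

Lemma normal_frame_at p :
  exists V0 : 'M[R]_(c, d + c), row_free V0 /\ V0 *m tproj f p = 0.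
Proof.
have rk : \rank (kermx (tproj f p)) = c.
  by rewrite mxrank_ker rank_tproj addKn.
have : exists V0 : 'M[R]_(\rank (kermx (tproj f p)), d + c),
    row_free V0 /\ V0 *m tproj f p = 0.
  exists (row_base (kermx (tproj f p))); split; first exact: row_base_free.
  by apply/sub_kermxP; rewrite eq_row_base.
by rewrite rk.
Qed.

Lemma tangent_normal_unit m1 m2 (A : 'M[R]_(m1, m1 + m2)) (V : 'M[R]_(m2, m1 + m2)) :
  row_free A -> row_free V -> V *m A^T = 0 -> col_mx A V \in unitmx.
Proof.
move=> fA fV VA; set X := col_mx A V.
suff : X *m X^T \in unitmx by rewrite unitmx_mul => /andP[].
rewrite /X tr_col_mx mul_col_row VA.
have -> : A *m V^T = 0 by rewrite -[A]trmxK -trmx_mul VA trmx0.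
by rewrite unitmxE det_ublock unitrM -!unitmxE !gram_unit.
Qed.

Variables (p : M) (V0 : 'M[R]_(c, d + c)).
Hypotheses (fV0 : row_free V0) (V0P : V0 *m tproj f p = 0).
Let i := pref p.
Let U : set 'rV[R]_(d + c) := [set z | (chart i @` dom i) (lsubmx z)].
Let alg (O : set 'rV[R]_(d + c)) := @smooth_on_algebra R 'rV[R]_(d + c) O.

(** Normal vectors at [x] are parametrized by projecting the fixed frame [V0] of the normal space at
    [p], which needs no smooth choice of normal frames. *)
Definition tube_map z : 'rV[R]_(d + c) :=
  let x := chart_inv i (lsubmx z) in f x + rsubmx z *m (V0 *m (1%:M - tproj f x)).

Let z0 : 'rV[R]_(d + c) := row_mx (chart i p) 0.

Lemma open_tube_dom : open U.
Proof.
apply: (@open_comp _ _ (fun z : 'rV[R]_(d + c) => lsubmx z) (chart i @` dom i)).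
  by move=> z _; exact: lsubmx_continuous.
exact: open_cod.
Qed.

Lemma smooth_lsub (h : M -> R) : smoothM h ->
  smooth_on U (fun z => h (chart_inv i (lsubmx z))).
Proof.
move=> Sh; apply: (smooth_on_comp (O := chart i @` dom i)
  (f := fun z : 'rV[R]_(d + c) => lsubmx z) (g := h \o chart_inv i)).
- exact: open_tube_dom.
- exact: open_cod.
- by [].
- apply/smooth_on_mxP => [|k j]; first exact: open_tube_dom.
  apply: (salg_eq (alg open_tube_dom)) (smooth_on_coord (lshift c j) open_tube_dom).
  by move=> z _; rewrite mxE ord1.
- exact: Sh.
Qed.

Let Q x := V0 *m (1%:M - tproj f x).

Lemma smoothM_Q : salg_mx (@smoothM _ _ M) Q.
Proof.
have algM := smoothM_algebra M.
apply: (salg_mxM algM); first exact: (salg_mxcst algM).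
by apply: (salg_mxB algM); [exact: (salg_mxcst algM)|exact: smoothM_tproj].
Qed.

Lemma smooth_tube_map : smooth_on U tube_map.
Proof.
have oU := open_tube_dom; apply/smooth_on_mxE => //.
apply: (salg_mxD (alg oU)).
  by move=> k j; exact: (smooth_lsub (imm.1 k j)).
apply: (salg_mxM (alg oU)).
  move=> k j; apply: (salg_eq (alg oU)) (smooth_on_coord (rshift d j) oU).
  by move=> z _; rewrite mxE ord1.
move=> k j; exact: (smooth_lsub (smoothM_Q k j)).
Qed.

Lemma derive_lsubmx_l (g : 'rV[R]_d -> R) (l : 'I_d) z :
  'D_'e_(lshift c l) (fun z : 'rV[R]_(d + c) => g (lsubmx z)) z = 'D_'e_l g (lsubmx z).
Proof.
rewrite -(derive_line (fun z : 'rV[R]_(d + c) => g (lsubmx z))) -(derive_line g).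
have -> : (fun t : R => g (lsubmx (t *: 'e_(lshift c l) + z))) =
    (fun t : R => g (t *: 'e_l + lsubmx z)); last by [].
apply/funext => t; congr g; apply/rowP => j.
by rewrite !mxE eqxx /= (inj_eq (@lshift_inj _ _)).
Qed.

Lemma derive_lsubmx_r (g : 'rV[R]_d -> R) (l : 'I_c) z :
  'D_'e_(rshift d l) (fun z : 'rV[R]_(d + c) => g (lsubmx z)) z = 0.
Proof.
rewrite -(derive_line (fun z : 'rV[R]_(d + c) => g (lsubmx z))).
rewrite (_ : (fun t : R => g (lsubmx (t *: 'e_(rshift d l) + z))) = cst (g (lsubmx z))); first exact: derive_cst.
apply/funext => t /=; congr g; apply/rowP => j.
by rewrite !mxE eqxx /= eq_lrshift mulr0 add0r.
Qed.

Lemma jac_tube_map : jac tube_map z0 = col_mx (tmx f p) V0.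
Proof.
have dp : dom i p by exact: dom_pref.
have lz0 : lsubmx z0 = chart i p by rewrite row_mxKl.
have rz0 k : z0 0 (rshift d k) = 0 by rewrite row_mxEr mxE.
have Uz0 : U z0 by rewrite /U /= lz0; exists p.
have V0E : V0 *m (1%:M - tproj f p) = V0 by rewrite mulmxBr mulmx1 V0P subr0.
apply/matrixP => l j; rewrite mxE.
pose F1 z := f (chart_inv i (lsubmx z)) 0 j.
pose F2 (k : 'I_c) z := z 0 (rshift d k) * Q (chart_inv i (lsubmx z)) k j.
have S1 : smooth_on U F1 by apply: (smooth_lsub (imm.1 0 j)).
have SQ k : smooth_on U (fun z => Q (chart_inv i (lsubmx z)) k j).
  exact: (smooth_lsub (smoothM_Q k j)).
have Sw k : smooth_on U (fun z => z 0 (rshift d k)).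
  exact: smooth_on_coord open_tube_dom.
have -> : (fun y => tube_map y 0 j) = (fun z => F1 z + \sum_(k < c) F2 k z).
  apply/funext => z; rewrite /tube_map mxE /F1; congr (_ + _).
  by rewrite mxE; apply: eq_bigr => k _; rewrite /F2 mxE.
have dF1 := smooth_on_derivable (v := 'e_l) S1 Uz0.
have dF2 k := derive_mul_zero (smooth_on_derivable (v := 'e_l) (Sw k) Uz0)
  (smooth_on_derivable (v := 'e_l) (SQ k) Uz0) (rz0 k).
rewrite (derive_add_sum dF1 (fun k => (dF2 k).1)).
have D2 k : 'D_'e_l (F2 k) z0 = ('e_l : 'rV[R]_(d + c)) 0 (rshift d k) * V0 k j.
  by rewrite (dF2 k).2 lz0 chartK // derive_coord /Q V0E.
under eq_bigr do rewrite D2.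
have [k lk|k lk] := fintype.splitP l.
  have -> : l = lshift c k by exact: val_inj.
  rewrite col_mxEu big1 ?addr0 => [|k' _]; last by rewrite mxE eqxx /= eq_rlshift mul0r.
  by rewrite /F1 (derive_lsubmx_l (fun y => f (chart_inv i y) 0 j)) lz0 tmxE.
have -> : l = rshift d k by exact: val_inj.
rewrite col_mxEd /F1 (derive_lsubmx_r (fun y => f (chart_inv i y) 0 j)) add0r.
rewrite (bigD1 k) //= big1 ?addr0 => [|k' k'k]; first by rewrite mxE !eqxx mul1r.
by rewrite mxE eqxx /= (inj_eq (@rshift_inj _ _)) (negPf k'k) mul0r.
Qed.

Let y0 : 'rV[R]_d := chart i p.
Let Jc (y : 'rV[R]_d) := jac (f \o chart_inv i) y.
Let X (y : 'rV[R]_d) : 'M[R]_(d + c) := col_mx (Jc y) (Q (chart_inv i y)).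
Let cod : set 'rV[R]_d := chart i @` dom i.

Lemma Q_tproj x : Q x *m tproj f x = 0.
Proof. by rewrite /Q -mulmxA mulmxBl mul1mx tproj_idem // subrr mulmx0. Qed.

Lemma Jc_tproj x : dom i x -> Jc (chart i x) *m tproj f x = Jc (chart i x).
Proof.
move=> dx; rewrite /Jc (smoothM_jac_change imm.1 dx (dom_pref x)).
by rewrite -/(tmx f x) -mulmxA tmx_tproj.
Qed.

Lemma V0_tmx0 : V0 *m (tmx f p)^T = 0.
Proof. by rewrite -(tmx_tproj imm) trmx_mul tr_tproj mulmxA V0P mul0mx. Qed.

Lemma jac_tube_unit : jac tube_map z0 \in unitmx.
Proof.
rewrite jac_tube_map; apply: tangent_normal_unit => //; first exact: imm.2.
exact: V0_tmx0.
Qed.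

(** The bound on the inverse frames makes the admissible size of normal vectors uniform near [p]. *)
Lemma near_frame_inv : exists r C : R, [/\ 0 < r, 0 <= C & forall y,
  `|y - y0| < r -> X y \in unitmx /\ `|invmx (X y)| <= C].
Proof.
have oc : open cod by exact: open_cod.
have algc := smooth_on_algebra oc.
have SX : salg_mx (fun h : 'rV[R]_d -> R => smooth_on cod h) X.
  apply: (salg_col_mx algc); first exact: smoothM_jac imm.1.
  by move=> k j; exact: (smoothM_Q k j i).
have cp : cod y0 by exists p => //; exact: dom_pref.
have uX0 : X y0 \in unitmx.
  have := jac_tube_unit; rewrite jac_tube_map /X /y0 chartK; last exact: dom_pref.
  by rewrite /Q mulmxBr mulmx1 V0P subr0.
pose D := [set y | cod y /\ X y \in unitmx].
have oD : open D.
  rewrite openE => y [cy uy] /=.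
  have n1 : \forall y' \near y, cod y' by exact: open_nbhs_nbhs (conj oc cy).
  have n2 : \forall y' \near y, X y' \in unitmx.
    apply: (@near_unitmx R 'rV[R]_d _ X y _ uy).
    exact: Ck_on_continuous (salg_det algc SX 0%N) cy.
  exact: filterS2 n1 n2.
have SXD : salg_mx (fun h : 'rV[R]_d -> R => smooth_on D h) X.
  by move=> k j; apply: smooth_on_sub (SX k j) => y [].
have SI := salg_mxV (smooth_on_algebra oD) (fun y Dy => Dy.2) SXD.
have cI : {for y0, continuous (fun y => invmx (X y))}.
  apply: (@Ck_on_continuous _ 'rV[R]_d _ 0 D); last by split.
  exact: (smooth_on_mxE _ oD).2 SI 0%N.
have [r1 r10 H1] := (near_ballP (y0 : 'rV[R]_d) _).1
  (open_nbhs_nbhs (conj oD (conj cp uX0 : D y0))).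
have [r2 r20 H2] := (continuous_ballP _ _).1 cI _ ltr01.
exists (Num.min r1 r2), (`|invmx (X y0)| + 1); split.
- by rewrite lt_min r10.
- by rewrite addr_ge0.
- move=> y; rewrite lt_min => /andP[/H1[_ uy] /H2 h]; split=> //.
  exact: normrB_lt1.
Qed.

(** A normal vector [v] at [x] is expanded in the frame [X]. Its tangential part vanishes and its
    normal coordinates are bounded by a multiple of the norm of [v], which gives a preimage close to
    [z0]. *)
Lemma tube_preimage (B : set 'rV[R]_(d + c)) : nbhs z0 B ->
  exists W e, [/\ nbhs p W, 0 < e & forall x v, W x -> normal x v -> `|v| < e ->
    dom i x /\ exists z, [/\ B z, lsubmx z = chart i x & tube_map z = f x + v]].
Proof.
move=> /(near_ballP (z0 : 'rV[R]_(d + c)) B)[r r0 Hr].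
have [r1 [C [r10 C0 HC]]] := near_frame_inv.
have K0 : 0 < (d + c)%:R * C + 1 by rewrite ltr_pwDr // mulr_ge0.
have n1 : \forall x \near p, dom i x.
  by apply: open_nbhs_nbhs; split; [exact: open_dom|exact: dom_pref].
have n2 : \forall x \near p, `|chart i x - y0| < Num.min r r1.
  have /(cvgrPdist_lt (F := nbhs p)) := @chart_cont _ _ M i p (dom_pref p).
  move=> /(_ (Num.min r r1)); rewrite lt_min r0 r10 => /(_ isT).
  by apply: filterS => x; rewrite distrC.
exists [set x | dom i x /\ `|chart i x - y0| < Num.min r r1].
exists (r / ((d + c)%:R * C + 1)); split=> //; first exact: filterS2 n1 n2.
  by rewrite divr_gt0.
move=> x v [dx]; rewrite lt_min => /andP[xr xr1] nv; rewrite ltr_pdivlMr // => ve.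
split=> //; have [uX bX] := HC _ xr1.
pose u := v *m invmx (X (chart i x)).
have uv : v = lsubmx u *m Jc (chart i x) + rsubmx u *m Q x.
  rewrite -{1}(mulmxKV uX v) -/u -{1}(hsubmxK u) mul_row_col.
  by rewrite chartK.
have u1 : lsubmx u *m Jc (chart i x) = 0.
  move: nv; rewrite /normal {1}uv mulmxDl -(mulmxA (lsubmx u)) -(mulmxA (rsubmx u)) Jc_tproj // Q_tproj.
  by rewrite mulmx0 addr0.
exists (row_mx (chart i x) (rsubmx u)); split.
- apply: Hr; apply: mx_norm_lt => // k j; rewrite ord1 mxE [X in _ + X]mxE.
  have [l|l] := splitP j => jl.
    have -> : j = lshift c l by exact: val_inj.
    rewrite /z0 !row_mxEl; apply: le_lt_trans xr.
    by have := mx_norm_coord (chart i x - y0) 0 l; rewrite !mxE.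
  have -> : j = rshift d l by exact: val_inj.
  rewrite /z0 !row_mxEr [X in _ - X]mxE subr0 mxE.
  apply: le_lt_trans (mx_norm_coord _ _ _) _.
  apply: le_lt_trans ve; apply: le_trans (mulmx_norm_le _ _) _.
  rewrite mulrCA; apply: ler_wpM2l => //.
  by apply: (le_trans (ler_wpM2l _ bX)) => //; rewrite lerDl.
- by rewrite row_mxKl.
- by rewrite /tube_map row_mxKl row_mxKr chartK // uv u1 add0r.

Qed.

(** A local inverse of [tube_map] gives both the uniqueness of the foot point and a smooth
    foot-point map, read in the chart at [p]. *)
Lemma tube_local : exists W e, [/\ nbhs p W, 0 < e,
  forall x x' v v', W x -> W x' -> normal x v -> normal x' v' ->
    `|v| < e -> `|v'| < e -> f x + v = f x' + v' -> x = x' &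
  forall x v, W x -> normal x v -> `|v| < e ->
    exists O (Y : 'rV[R]_(d + c) -> 'rV[R]_d),
    [/\ open O, O (f x + v), smooth_on O Y, chart_inv i (Y (f x + v)) = x &
      forall z, O z -> (chart i @` dom i) (Y z) /\
        normal (chart_inv i (Y z)) (z - f (chart_inv i (Y z)))]].
Proof.
have Uz0 : U z0 by exists p; rewrite ?row_mxKl //; exact: dom_pref.
have [G [A [B [[hA hB FG GFK SG] Az0 Bz0 AU]]]] :=
  inverse_function open_tube_dom Uz0 smooth_tube_map jac_tube_unit.
have nB : nbhs z0 [set z | A z /\ B (tube_map z)].
  have n1 : \forall z \near z0, A z by exact: open_nbhs_nbhs (conj hA Az0).
  have n2 : \forall z \near z0, B (tube_map z).
    apply: (Ck_on_continuous (smooth_tube_map 0%N) Uz0).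
    exact: open_nbhs_nbhs (conj hB Bz0).
  exact: filterS2 n1 n2.
have [W [e [nW e0 HW]]] := tube_preimage nB.
exists W, e; split=> //.
  move=> x x' v v' Wx Wx' nv nv' ve ve' E.
  have [dx [z [[Az Oz] zx zE]]] := HW x v Wx nv ve.
  have [dx' [z' [[Az' Oz'] zx' zE']]] := HW x' v' Wx' nv' ve'.
  have zz' : z = z' by rewrite -(GFK z Az Oz) -(GFK z' Az' Oz') zE zE' E.
  by rewrite -(chartK dx) -(chartK dx') -zx -zx' zz'.
move=> x v Wx nv ve; have [dx [z [[Az Oz] zx zE]]] := HW x v Wx nv ve.
exists B, (fun z => lsubmx (G z)); split=> //.
- by rewrite -zE.
- apply/smooth_on_mxP => // k j.
  have := (smooth_on_mxP _ hB).1 SG k (lshift c j).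
  by apply: eq_smooth_on => // w _; rewrite mxE.
- by rewrite -zE (GFK z Az Oz) zx chartK.
- move=> w Ow; have [AG EG] := FG w Ow; split; first exact: AU.
  rewrite /normal -{1}EG /tube_map addrAC subrr add0r -mulmxA.
  by rewrite -/(Q _) Q_tproj mulmx0.
Qed.

End TubeLocal.


(** * Global tubular neighbourhoods and extension of functions *)

Section Tube.
Context {R : realType} {d c : nat} {M : smooth_space R d}.
Variable f : M -> 'rV[R]_(d + c).
Hypotheses (imm : immersion f) (injf : injective f) (cM : compact [set: M]).
Implicit Types (x p : M) (v z : 'rV[R]_(d + c)).

Lemma smoothM_row_continuous e (g : M -> 'rV[R]_e) : smoothM_row g -> continuous g.
Proof.
by move=> Sg; apply: continuous_mx => i j; apply: smoothM_continuous; exact: Sg.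
Qed.

Definition local_retraction x z0 (O : set 'rV[R]_(d + c))
    (r : 'rV[R]_(d + c) -> M) : Prop :=
  [/\ open O, O z0, r z0 = x,
      forall z, O z -> normal f (r z) (z - f (r z)) &
      forall h, smoothM h -> smooth_on O (h \o r)].

Lemma tube_local_uniq p : exists W e, [/\ nbhs p W, 0 < e &
  forall x x' v v', W x -> W x' -> normal f x v -> normal f x' v' ->
    `|v| < e -> `|v'| < e -> f x + v = f x' + v' -> x = x'].
Proof.
have [V0 [fV VP]] := normal_frame_at imm p.
by have [W [e [nW e0 H _]]] := tube_local imm fV VP; exists W, e.
Qed.

Lemma tube_local_retraction p : exists W e, [/\ nbhs p W, 0 < e &
  forall x v, W x -> normal f x v -> `|v| < e ->
    exists O r, local_retraction x (f x + v) O r].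
Proof.
have [V0 [fV VP]] := normal_frame_at imm p.
have [W [e [nW e0 _ H]]] := tube_local imm fV VP; exists W, e; split=> //.
move=> x v Wx nv ve; have [B [Y [oO Oz SY Yx HY]]] := H x v Wx nv ve.
exists B, (fun z => chart_inv (pref p) (Y z)); split=> //.
  by move=> z /HY[].
move=> h Sh; apply: (smooth_on_comp oO (@open_cod _ _ M (pref p)) _ SY (Sh (pref p))).
by move=> z /HY[].
Qed.

(** Compactness of [M * M] gives one radius for all pairs of foot points: near the diagonal by local
    uniqueness, elsewhere because the images of the two points stay apart. *)
Lemma tube_exists : exists e : R, [/\ 0 < e,
  forall x x' v v', normal f x v -> normal f x' v' ->
    `|v| < e -> `|v'| < e -> f x + v = f x' + v' -> x = x' &
  forall x v, normal f x v -> `|v| < e ->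
    exists O r, local_retraction x (f x + v) O r].
Proof.
have cf := smoothM_row_continuous imm.1.
pose F : set_system R := (0 : R)^'+.
have FF : ProperFilter F by exact: at_right_proper_filter.
have cMM : compact ([set: M] `*` [set: M]) by exact: compact_setX.
have H1 := (compact_near_coveringP _).1 cMM R F (fun e w =>
  forall v v', normal f w.1 v -> normal f w.2 v' ->
    `|v| < e -> `|v'| < e -> f w.1 + v = f w.2 + v' -> w.1 = w.2) FF.
have H2 := (compact_near_coveringP _).1 cM R F (fun e x =>
  forall v, normal f x v -> `|v| < e ->
    exists O r, local_retraction x (f x + v) O r) FF.
have {}H1 : \forall e \near F, forall x x' v v', normal f x v -> normal f x' v' ->
    `|v| < e -> `|v'| < e -> f x + v = f x' + v' -> x = x'.
  apply: (@filterS _ F FF) (H1 _) => [e He x x' v v'|]; first exact: (He (x, x')).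
  move=> [p p'] _ /=; have [->|pp'] := pselect (p = p').
    have [W [e [nW e0 HW]]] := tube_local_uniq p'.
    exists (W `*` W, [set t | t < e]) => /=.
      by split; [exists (W, W)|exact: nbhs_right_lt].
    move=> [[x x'] t] [/= [Wx Wx'] te] v v' nv nv' vt vt'.
    by apply: HW => //; exact: lt_trans te.
  (* Four errors below [q] add up: the displacements of the two foot points and the two normal
     vectors. *)
  pose q := `|f p - f p'| / 4.
  have q0 : 0 < q.
    by rewrite divr_gt0 // normr_gt0 subr_eq0; apply/eqP => /injf.
  have nW y : nbhs y [set x | `|f y - f x| < q].
    by have /cvgrPdist_lt /(_ q q0) := cf y.
  exists ([set x | `|f p - f x| < q] `*` [set x | `|f p' - f x| < q], [set t | t < q]).
    by split; [exists ([set x | `|f p - f x| < q], [set x | `|f p' - f x| < q]);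
      [split; [exact: (nW p)|exact: (nW p')]|by []]|exact: nbhs_right_lt].
  move=> [[x x'] t] [/= [Wx Wx'] tq] v v' nv nv' vt vt' E; exfalso.
  have : `|f p - f p'| < q + q + q + q.
    have -> : f p - f p' = (f p - f x) - (f p' - f x') + (v' - v).
      have -> : v' = f x + v - f x' by rewrite E addrC addKr.
      by apply/rowP => j; rewrite !mxE; ring.
    have vq : `|v| < q by exact: lt_trans tq.
    have vq' : `|v'| < q by exact: lt_trans tq.
    rewrite -(addrA (q + q)); apply: le_lt_trans (ler_normD _ _) _; apply: ltrD.
      by apply: le_lt_trans (ler_normB _ _) _; apply: ltrD.
    by apply: le_lt_trans (ler_normB _ _) _; apply: ltrD.
  by have -> : q + q + q + q = `|f p - f p'|; [rewrite /q; field|rewrite ltxx].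
have {}H2 : \forall e \near F, forall x v, normal f x v -> `|v| < e ->
    exists O r, local_retraction x (f x + v) O r.
  apply: (@filterS _ F FF) (H2 _) => [e He x v|]; first exact: (He x).
  move=> p _; have [W [e [nW e0 HW]]] := tube_local_retraction p.
  exists (W, [set t | t < e]) => /=; first by split=> //; exact: nbhs_right_lt.
  move=> [x t] [/= Wx te] v nv vt; apply: HW => //; exact: lt_trans te.
have H0 : \forall e \near F, 0 < e by exact: nbhs_right_gt.
have [e [e0 [h1 h2]]] := filter_ex (filterI H0 (filterI H1 H2)).
by exists e; split.
Qed.

Definition near_pt (e : R) z x : Prop := normal f x (z - f x) /\ `|z - f x| < e.

Definition tube_set e : set 'rV[R]_(d + c) := [set z | exists x, near_pt e z x].

(** This is [h] composed with the retraction of the tube, the foot point being picked by choice. Off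
    the tube [0] is a mere default. *)
Definition tube_val e (h : M -> R) z : R :=
  if pselect (exists x, near_pt e z x) is left H then h (projT1 (cid H)) else 0.

Section TubeVal.
Variable e : R.
Hypotheses (e0 : 0 < e)
  (uniq : forall x x' v v', normal f x v -> normal f x' v' ->
    `|v| < e -> `|v'| < e -> f x + v = f x' + v' -> x = x')
  (retr : forall x v, normal f x v -> `|v| < e ->
    exists O r, local_retraction x (f x + v) O r).

Lemma near_pt_uniq z x x' : near_pt e z x -> near_pt e z x' -> x = x'.
Proof.
by move=> [n1 l1] [n2 l2]; apply: uniq n1 n2 l1 l2 _; rewrite !subrKC.
Qed.

Lemma tube_valE h z x : near_pt e z x -> tube_val e h z = h x.
Proof.
move=> zx; rewrite /tube_val; case: pselect => [H|[]]; last by exists x.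
by congr h; exact: near_pt_uniq (projT2 (cid H)) zx.
Qed.

Lemma near_pt_normal x v : normal f x v -> `|v| < e -> near_pt e (f x + v) x.
Proof. by move=> nv ve; rewrite /near_pt addrAC subrr add0r. Qed.

Lemma near_pt_self x : near_pt e (f x) x.
Proof. by rewrite /near_pt subrr normr0; split=> //; rewrite /normal mul0mx. Qed.

Lemma tube_retraction z0 : tube_set e z0 -> exists O r,
  [/\ open O, O z0, O `<=` tube_set e,
   forall z, O z -> near_pt e z (r z) &
   forall h, smoothM h -> smooth_on O (h \o r)].
Proof.
move=> [x [nx lx]]; have [B [r [oO]]] := retr nx lx.
rewrite subrKC => Oz0 rx nr Sr.
have cg : {for z0, continuous (fun z => z - f (r z))}.
  apply: (@Ck_on_continuous _ 'rV[R]_(d + c) _ 0 B) => //.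
  apply/Ck_on_mxP => // i j.
  have alg := @smooth_on_algebra R 'rV[R]_(d + c) _ oO.
  have := salgB alg (smooth_on_coord j oO) (Sr _ (imm.1 0 j)) 0%N.
  by apply: eq_Ck_on => // z _; rewrite !mxE ord1.
have e1 : 0 < e - `|z0 - f x| by rewrite subr_gt0.
have [s s0 Hs] := (continuous_ballP _ _).1 cg _ e1.
have [t t0 Ht] := (near_ballP (z0 : 'rV[R]_(d + c)) _).1 (open_nbhs_nbhs (conj oO Oz0)).
have near z : `|z - z0| < Num.min s t -> B z /\ near_pt e z (r z).
  rewrite lt_min => /andP[/Hs H /Ht Oz]; split=> //; split; first exact: nr.
  rewrite rx in H.
  rewrite -[z - f (r z)](subrK (z0 - f x)).
  by apply: le_lt_trans (ler_normD _ _) _; rewrite -ltrBrDr.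
exists [set z | `|z - z0| < Num.min s t], r; split.
- exact: open_normB.
- by rewrite /= subrr normr0 lt_min t0 s0.
- by move=> z /near[_ ?]; exists (r z).
- by move=> z /near[].
- by move=> h /Sr; apply: smooth_on_sub => z /near[].
Qed.

Lemma open_tube_set : open (tube_set e).
Proof.
rewrite openE => z /tube_retraction[B [r [oO Oz OT _ _]]] /=.
by apply: filterS OT _; exact: open_nbhs_nbhs (conj oO Oz).
Qed.

Lemma smooth_tube_val h : smoothM h -> smooth_on (tube_set e) (tube_val e h).
Proof.
move=> Sh; apply: smooth_on_local => z /tube_retraction[B [r [oO Oz OT Or Sr]]].
exists B => //; apply: eq_smooth_on (Sr h Sh) => // w /Or rw /=.
by rewrite (tube_valE _ rw).
Qed.

Definition tube_dist2 z : R := \sum_j (z 0 j - tube_val e (fun x => f x 0 j) z) ^+ 2.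

Lemma smooth_tube_dist2 : smooth_on (tube_set e) tube_dist2.
Proof.
have oT := open_tube_set; have alg := @smooth_on_algebra R 'rV[R]_(d + c) _ oT.
apply: (salg_sum alg) => j _; apply: (salgX alg); apply: (salgB alg).
  exact: smooth_on_coord.
by apply: smooth_tube_val; exact: imm.1.
Qed.

Lemma tube_dist2E z x : near_pt e z x -> tube_dist2 z = \sum_j (z - f x) 0 j ^+ 2.
Proof.
by move=> zx; apply: eq_bigr => j _; rewrite (tube_valE _ zx) !mxE.
Qed.

Let delta := (e / 2) ^+ 2.

Lemma closed_ball0 (t : R) : closed [set v : 'rV[R]_(d + c) | `|v| <= t].
Proof.
by have := @closed_normB R 'rV[R]_(d + c) 0 t; under eq_set do rewrite subr0.
Qed.

Let Kset : set (M * 'rV[R]_(d + c)) :=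
  [set w | [/\ normal f w.1 w.2, `|w.2| <= e / 2 &
    \sum_j w.2 0 j ^+ 2 <= delta]].

Lemma compact_Kset : compact Kset.
Proof.
apply: (@subclosed_compact _ _ ([set: M] `*` [set v : 'rV[R]_(d + c) | `|v| <= e / 2])).
- have calg := @continuous_algebra R (M * 'rV[R]_(d + c))%type.
  have csnd j : continuous (fun w : M * 'rV[R]_(d + c) => w.2 0 j).
    move=> w; apply: (@cvg_comp _ _ _ snd (fun v : 'rV[R]_(d + c) => v 0 j) _ _ _ cvg_snd).
    exact: coord_continuous.
  have cP j : continuous (fun w : M * 'rV[R]_(d + c) => (w.2 *m tproj f w.1) 0 j).
    have S : salg_mx (fun h : M * 'rV[R]_(d + c) -> R => continuous h)
       (fun w => w.2 *m tproj f w.1).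
      apply: (salg_mxM calg) => k l; first by rewrite ord1; exact: csnd.
      move=> w; apply: (@cvg_comp _ _ _ fst (fun x => tproj f x k l) _ _ _ cvg_fst).
      exact: (smoothM_continuous (smoothM_tproj imm k l)).
    exact: S.
  pose A1 := [set w : M * 'rV[R]_(d + c) | forall j, (w.2 *m tproj f w.1) 0 j = 0].
  pose A2 := [set w : M * 'rV[R]_(d + c) | `|w.2| <= e / 2].
  pose A3 := [set w : M * 'rV[R]_(d + c) | \sum_j (w.2 0 j : R) ^+ 2 <= delta].
  have -> : Kset = A1 `&` (A2 `&` A3).
    apply/seteqP; split=> w.
      by move=> [n l s]; split=> // j /=; rewrite n mxE.
    by move=> [n [l s]]; split=> //; apply/rowP => j; rewrite [RHS]mxE; exact: n.
  apply: closedI; last apply: closedI.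
  + rewrite (_ : A1 = \bigcap_(j in [set: 'I_(d + c)])
        [set w | (w.2 *m tproj f w.1) 0 j = 0]); last first.
      by apply/seteqP; split=> w H j; [move=> _; exact: H|exact: (H j I)].
    apply: closed_bigI => j _.
    apply: (@closed_comp _ _ (fun w : M * 'rV[R]_(d + c) => (w.2 *m tproj f w.1) 0 j) [set t | t = 0]).
      by move=> w _; exact: cP.
    exact: closed_eq.
  + apply: (@closed_comp _ _ (fun w : M * 'rV[R]_(d + c) => w.2) [set v : 'rV[R]_(d + c) | `|v| <= e / 2]).
      by move=> w _; exact: cvg_snd.
    exact: closed_ball0.
  + apply: (@closed_comp _ _ (fun w : M * 'rV[R]_(d + c) => \sum_j (w.2 0 j : R) ^+ 2) [set t | t <= delta]).
      move=> w _; apply: (salg_sum calg) => j _; apply: (salgX calg); exact: csnd.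
    exact: closed_le.
- apply: compact_setX => //; apply: bounded_closed_compact.
    by exists (e / 2); split=> [|t et v /le_trans]; [exact: num_real|apply; exact: ltW].
  exact: closed_ball0.
- by move=> w [].
Qed.

(** The tube and the complement of [K] are open and cover the space. On the latter the cutoff
    [tube_cut] is [0], so its products with functions smooth on the tube are smooth across the
    boundary. *)
Lemma closed_half_tube : exists K : set 'rV[R]_(d + c), [/\ closed K,
  K `<=` tube_set e & forall z x, near_pt e z x -> ~ K z -> delta < tube_dist2 z].
Proof.
exists ((fun w => f w.1 + w.2) @` Kset); split.
- apply: compact_closed; first exact: norm_hausdorff.
  apply: continuous_compact; last exact: compact_Kset.
  apply: continuous_subspaceT => w.
  apply: (@cvgD _ 'rV[R]_(d + c)); last exact: cvg_snd.
  apply: (@cvg_comp _ _ _ fst f _ _ _ cvg_fst).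
  exact: smoothM_row_continuous imm.1 _.
- move=> _ [[x v] [/= nv le _] <-]; exists x; apply: near_pt_normal => //.
  by apply: le_lt_trans le _; rewrite ltr_pdivrMr // ltr_pMr // ltr1n.
move=> z x zx nK; rewrite (tube_dist2E zx) ltNge; apply/negP => le.
apply: nK; exists (x, z - f x) => /=; last by rewrite subrKC.
split=> //=; first exact: zx.1.
apply: mx_norm_le => [|i j]; first by rewrite divr_ge0 // ltW.
rewrite ord1 -(@ler_pXn2r _ 2) ?nnegrE //; last by rewrite divr_ge0 // ltW.
rewrite -/delta real_normK ?num_real //.
by apply: le_trans le; rewrite (bigD1 j) //= lerDl sumr_ge0 // => k _; exact: sqr_ge0.
Qed.

Definition tube_cut z : R :=
  if pselect (tube_set e z) then flat_exp 1 (delta - tube_dist2 z) else 0.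

Lemma tube_cut_self x : tube_cut (f x) = flat_exp 1 delta.
Proof.
rewrite /tube_cut; case: pselect => [H|[]]; last by exists x; exact: near_pt_self.
rewrite (tube_dist2E (near_pt_self x)) subrr.
by rewrite big1 ?subr0 // => j _; rewrite mxE expr0n.
Qed.

Lemma tube_cut_out z : ~ tube_set e z -> tube_cut z = 0.
Proof. by move=> nT; rewrite /tube_cut; case: pselect. Qed.

Lemma smooth_tube_cutM u : smooth_on (tube_set e) u ->
  smooth_on setT (fun z => tube_cut z * u z).
Proof.
move=> Su; have [K [cK KT HK]] := closed_half_tube; have oT := open_tube_set.
have alg := @smooth_on_algebra R 'rV[R]_(d + c) _ oT.
apply: smooth_on_local => z _; have [Tz|nTz] := pselect (tube_set e z).
  exists (tube_set e) => //.
  have Sd : smooth_on (tube_set e) (fun z => flat_exp 1 (delta - tube_dist2 z)).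
    apply: (salg_comp1 alg (smooth_flat_exp 1)) => //.
    by apply: (salgB alg); [exact: (salg_cst alg)|exact: smooth_tube_dist2].
  apply: (salg_eq alg) (salgM alg Sd Su) => w Tw; rewrite /tube_cut.
  by case: pselect.
have zero w : ~ K w -> tube_cut w * u w = 0.
  move=> nKw; rewrite /tube_cut; case: pselect => [Tw|nTw]; last by rewrite mul0r.
  have [x xw] := Tw.
  by rewrite flat_exp_eq0 ?mul0r // subr_le0 ltW // (HK _ _ xw nKw).
exists (~` K); first by move=> /KT.
apply: (@eq_smooth_on _ 'rV[R]_(d + c) R (~` K) (cst 0)).
- exact: closed_openC.
- by move=> w /zero ->.
- by move=> k; exact: Ck_on_cst.
Qed.

End TubeVal.

Lemma smooth_extension (h : M -> R) : smoothM h ->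
  exists2 H : 'rV[R]_(d + c) -> R, smooth_on setT H & forall x, H (f x) = h x.
Proof.
move=> Sh; have [e [e0 uniq retr]] := tube_exists.
(* The cutoff takes this constant value on the image of [f]. Dividing by it beforehand replaces a
   cutoff that would be 1 there. *)
pose c0 : R := flat_exp 1 ((e / 2) ^+ 2).
have c00 : c0 != 0 by rewrite gt_eqF // flat_exp1_gt0 exprn_gt0 // divr_gt0.
have Sh' : smoothM (fun x => h x / c0).
  exact: (salgM (smoothM_algebra M)) Sh (salg_cst (smoothM_algebra M) _).
exists (fun z => tube_cut e z * tube_val e (fun x => h x / c0) z).
  by apply: smooth_tube_cutM => //; exact: smooth_tube_val.
move=> x; rewrite tube_cut_self // (tube_valE uniq _ (near_pt_self e0 x)).
by rewrite mulrC divfK.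
Qed.

End Tube.


(** * Normal planes and complex structures *)

Section Frames.
Context {R : realType}.

Definition dotr n (u v : 'rV[R]_n) : R := (u *m v^T) 0 0.

Lemma dotrE n (u v : 'rV[R]_n) : dotr u v = \sum_i u 0 i * v 0 i.
Proof. by rewrite /dotr mxE; apply: eq_bigr => i _; rewrite !mxE. Qed.

Lemma dotrC n (u v : 'rV[R]_n) : dotr u v = dotr v u.
Proof. by rewrite !dotrE; apply: eq_bigr => i _; rewrite mulrC. Qed.

Lemma dotrDl n (u v w : 'rV[R]_n) : dotr (u + v) w = dotr u w + dotr v w.
Proof. by rewrite /dotr mulmxDl mxE. Qed.

Lemma dotrDr n (u v w : 'rV[R]_n) : dotr w (u + v) = dotr w u + dotr w v.
Proof. by rewrite /dotr linearD mulmxDr mxE. Qed.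

Lemma dotrZl n a (u v : 'rV[R]_n) : dotr (a *: u) v = a * dotr u v.
Proof. by rewrite /dotr -scalemxAl mxE. Qed.

Lemma dotrZr n a (u v : 'rV[R]_n) : dotr u (a *: v) = a * dotr u v.
Proof. by rewrite dotrC dotrZl dotrC. Qed.

Lemma dotrNl n (u v : 'rV[R]_n) : dotr (- u) v = - dotr u v.
Proof. by rewrite -scaleN1r dotrZl mulN1r. Qed.

Lemma dotrNr n (u v : 'rV[R]_n) : dotr u (- v) = - dotr u v.
Proof. by rewrite dotrC dotrNl dotrC. Qed.

Lemma dotr_mull n m (u : 'rV[R]_n) (v : 'rV[R]_m) A :
  dotr (u *m A) v = dotr u (v *m A^T).
Proof. by rewrite /dotr trmx_mul trmxK mulmxA. Qed.

Lemma dotr_ge0 n (u : 'rV[R]_n) : 0 <= dotr u u.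
Proof. by rewrite dotrE sumr_ge0 // => i _; rewrite -expr2 sqr_ge0. Qed.

Lemma dotr_eq0 n (u : 'rV[R]_n) : (dotr u u == 0) = (u == 0).
Proof.
apply/eqP/eqP => [|->]; last by rewrite /dotr mul0mx mxE.
rewrite dotrE => /eqP; rewrite psumr_eq0 => [/allP H|i _]; last by rewrite -expr2 sqr_ge0.
apply/rowP => i; have := H i (mem_index_enum _).
by rewrite /= mulf_eq0 orbb => /eqP->; rewrite mxE.
Qed.

Lemma dotr_gt0 n (u : 'rV[R]_n) : (0 < dotr u u) = (u != 0).
Proof. by rewrite lt_neqAle dotr_ge0 andbT eq_sym dotr_eq0. Qed.

Lemma mul_row_dotr n (u v : 'rV[R]_n) : u *m v^T = (dotr u v)%:M.
Proof. by apply/matrixP => i j; rewrite !ord1 [RHS]mxE eqxx mulr1n. Qed.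

Definition orthonormal2 n (xi eta : 'rV[R]_n) : Prop :=
  [/\ dotr xi xi = 1, dotr eta eta = 1 & dotr xi eta = 0].

Lemma gram_schmidt2 n (V0 : 'M[R]_(1 + 1, n)) : row_free V0 ->
  exists xi eta, orthonormal2 xi eta /\
    exists B : 'M[R]_(1 + 1), col_mx xi eta = B *m V0.
Proof.
move=> fV; pose u := usubmx V0; pose w := dsubmx V0.
have V0E : V0 = col_mx u w by rewrite vsubmxK.
have free2 a b : a *: u + b *: w = 0 -> a = 0 /\ b = 0.
  move=> E; have : row_mx a%:M b%:M *m V0 = 0 :> 'rV[R]_n.
    by rewrite V0E (mul_row_col a%:M) !mul_scalar_mx.
  move/eqP; rewrite mulmx_free_eq0 // => /eqP/rowP H.
  split; [have := H (lshift 1 0)|have := H (rshift 1 0)].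
    by rewrite row_mxEl !mxE eqxx mulr1n.
  by rewrite (row_mxEr (a%:M : 'rV[R]_1)) !mxE eqxx mulr1n.
have u0 : u != 0.
  apply/eqP => u0; have [] := free2 1 0; last by move/eqP; rewrite oner_eq0.
  by rewrite u0 scaler0 scale0r addr0.
pose p := Num.sqrt (dotr u u).
have p0 : p != 0 by rewrite sqrtr_eq0 -ltNge dotr_gt0.
have pp : p ^+ 2 = dotr u u by rewrite sqr_sqrtr ?dotr_ge0.
pose t := dotr w u / dotr u u.
pose w1 := w - t *: u.
have w10 : w1 != 0.
  apply/eqP => w10; have [] := free2 (- t) 1; last by move=> _ /eqP; rewrite oner_eq0.
  by rewrite scale1r scaleNr addrC.
pose q := Num.sqrt (dotr w1 w1).
have q0 : q != 0 by rewrite sqrtr_eq0 -ltNge dotr_gt0.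
have qq : q ^+ 2 = dotr w1 w1 by rewrite sqr_sqrtr ?dotr_ge0.
have uw1 : dotr u w1 = 0.
  rewrite /w1 dotrDr dotrNr dotrZr dotrC /t divfK ?subrr //.
  by rewrite gt_eqF // dotr_gt0.
exists (p^-1 *: u), (q^-1 *: w1); split.
  split; rewrite dotrZl dotrZr.
  - by rewrite -pp; field.
  - by rewrite -qq; field.
  - by rewrite uw1 !mulr0.
exists (col_mx (row_mx p^-1%:M 0) (row_mx (- (q^-1 * t))%:M q^-1%:M)).
rewrite V0E (mul_col_mx (row_mx p^-1%:M 0)) !(mul_row_col _%:M).
rewrite !mul_scalar_mx mul0mx addr0 /w1 scalerBr scalerA scaleNr.
by rewrite [X in col_mx _ X]addrC.
Qed.

Lemma col_mx2_0l n1 n (A : 'M[R]_(n1, n)) (xi eta : 'rV[R]_n) :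
  col_mx xi eta *m A^T = 0 -> xi *m A^T = 0 /\ eta *m A^T = 0.
Proof. by rewrite mul_col_mx -(col_mx0 _ 1 1) => /eq_col_mx. Qed.

Context {d : nat}.
Implicit Types (A : 'M[R]_(d, d + (1 + 1))) (xi eta : 'rV[R]_(d + (1 + 1))).

(** The Hodge dual of the rows of [A]: the 2-form obtained by completing them to a determinant.
    Divided by the volume of the rows it is, up to sign, the rotation of the normal plane. No normal
    frame is chosen, so it is smooth in [A]. *)
Definition vol_rot A : 'M[R]_(d + (1 + 1)) :=
  \matrix_(k, l) \det (col_mx A (col_mx 'e_k 'e_l : 'M[R]_(1 + 1, d + (1 + 1)))).

Definition gram_det A : R := \det (A *m A^T).

Definition nrot A : 'M[R]_(d + (1 + 1)) := (Num.sqrt (gram_det A))^-1 *: vol_rot A.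

Definition wedge n (xi eta : 'rV[R]_n) : 'M[R]_n := xi^T *m eta - eta^T *m xi.

Lemma det_mx2 (B : 'M[R]_(1 + 1)) : let l := lshift 1 0 in let r := rshift 1 0 in
  \det B = B l l * B r r - B l r * B r l.
Proof.
move=> l r; rewrite (expand_det_row B l) big_split_ord !big_ord1 /cofactor.
rewrite !det_mx11 !mxE.
have e1 (k : 'I_(1 + 1).-1) : lift l k = r by apply: val_inj; case: k => [[|//]].
have e2 (k : 'I_(1 + 1).-1) : lift r k = l by apply: val_inj; case: k => [[|//]].
by rewrite !e1 !e2 /= expr0 mul1r expr1 mulN1r mulrN.
Qed.

Lemma det2 (a b c e : R) :
  \det (block_mx a%:M b%:M c%:M e%:M : 'M[R]_(1 + 1)) = a * e - b * c.
Proof.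
rewrite det_mx2 !(block_mxEul, block_mxEur, block_mxEdl, block_mxEdr).
by rewrite !mxE !eqxx !mulr1n.
Qed.

Lemma orthonormal2_mx n (xi eta : 'rV[R]_n) : orthonormal2 xi eta ->
  col_mx xi eta *m (col_mx xi eta)^T = 1%:M.
Proof.
move=> [xx ee xe]; rewrite tr_col_mx mul_col_row !mul_row_dotr xx ee xe dotrC xe.
by rewrite !raddf0 -scalar_mx_block.
Qed.

Lemma normal_frame A : row_free A ->
  exists xi eta, orthonormal2 xi eta /\ col_mx xi eta *m A^T = 0.
Proof.
move=> fA.
have rk : \rank (kermx A^T) = (1 + 1)%N.
  by rewrite mxrank_ker mxrank_tr (eqP fA) addKn.
have : exists V0 : 'M[R]_(\rank (kermx A^T), d + (1 + 1)),
    row_free V0 /\ V0 *m A^T = 0.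
  exists (row_base (kermx A^T)); split; first exact: row_base_free.
  by apply/sub_kermxP; rewrite eq_row_base.
rewrite rk => -[V0 [fV VA]].
have [xi [eta [on [B E]]]] := gram_schmidt2 fV.
by exists xi, eta; split=> //; rewrite E -mulmxA VA mulmx0.
Qed.

Section WithFrame.
Variables (A : 'M[R]_(d, d + (1 + 1))) (xi eta : 'rV[R]_(d + (1 + 1))).
Hypotheses (fA : row_free A) (on : orthonormal2 xi eta)
  (VA : col_mx xi eta *m A^T = 0).

(** Multiplying by the transpose of the second matrix gives a block triangular product, because the
    frame is orthogonal to the rows of [A]. *)
Lemma det_col_frame (W : 'M[R]_(1 + 1, d + (1 + 1))) :
  \det (col_mx A W) * \det (col_mx A (col_mx xi eta)) =
  gram_det A * \det (W *m (col_mx xi eta)^T).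
Proof.
have AV : A *m (col_mx xi eta)^T = 0 by rewrite -[A]trmxK -trmx_mul VA trmx0.
rewrite -[\det (col_mx A (col_mx xi eta))]det_tr -det_mulmx.
by rewrite (tr_col_mx A) mul_col_row AV det_lblock.
Qed.

Lemma det_col_frame_sqr : \det (col_mx A (col_mx xi eta)) ^+ 2 = gram_det A.
Proof. by rewrite expr2 det_col_frame orthonormal2_mx // det1 mulr1. Qed.

End WithFrame.

Lemma gram_det_gt0 A : row_free A -> 0 < gram_det A.
Proof.
move=> fA; have [xi [eta [on VA]]] := normal_frame fA.
have D2 := det_col_frame_sqr on VA.
rewrite lt_neqAle -D2 sqr_ge0 andbT D2 eq_sym.
by have := gram_unit fA; rewrite unitmxE unitfE.
Qed.

Lemma vol_rotE A xi eta : row_free A -> orthonormal2 xi eta ->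
  col_mx xi eta *m A^T = 0 ->
  exists k, vol_rot A = k *: wedge xi eta /\ k ^+ 2 = gram_det A.
Proof.
move=> fA on VA; set V := col_mx xi eta.
have key W := det_col_frame VA W.
have D2 := det_col_frame_sqr on VA.
have g0 := gram_det_gt0 fA.
have D0 : \det (col_mx A V) != 0 by rewrite -sqrf_eq0 D2 gt_eqF.
exists (gram_det A / \det (col_mx A V)); split; last first.
  by rewrite expr_div_n D2 expr2 mulfK // gt_eqF.
apply/matrixP => k l; rewrite !mxE.
set W : 'M[R]_(1 + 1, d + (1 + 1)) := col_mx 'e_k 'e_l.
have -> : \det (col_mx A W) = gram_det A * \det (W *m V^T) / \det (col_mx A V).
  by rewrite -key -/V mulfK.
have -> : W *m V^T = block_mx (xi 0 k)%:M (eta 0 k)%:M (xi 0 l)%:M (eta 0 l)%:M.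
  rewrite /W /V tr_col_mx mul_col_row -!rowE.
  by congr block_mx; apply/matrixP => i j; rewrite !ord1 !mxE eqxx mulr1n.
by rewrite det2 !big_ord1 !mxE; ring.
Qed.

Lemma nrotE A xi eta : row_free A -> orthonormal2 xi eta ->
  col_mx xi eta *m A^T = 0 ->
  exists k, nrot A = k *: wedge xi eta /\ k ^+ 2 = 1.
Proof.
move=> fA on VA; have [k [E k2]] := vol_rotE fA on VA.
have g0 := gram_det_gt0 fA.
exists ((Num.sqrt (gram_det A))^-1 * k); split; first by rewrite /nrot E scalerA.
by rewrite exprMn exprVn sqr_sqrtr ?ltW // k2 mulVf // gt_eqF.
Qed.

Lemma vol_rotM (C : 'M[R]_d) A : vol_rot (C *m A) = \det C *: vol_rot A.
Proof.
apply/matrixP => k l; rewrite !mxE.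
set W : 'M[R]_(1 + 1, d + (1 + 1)) := col_mx _ _.
have -> : col_mx (C *m A) W = block_mx C 0 0 1%:M *m col_mx A W.
  by rewrite mul_block_col !mul0mx addr0 add0r mul1mx.
by rewrite det_mulmx det_ublock det1 mulr1.
Qed.

(** Hence the rotation feels a change of charts only through its orientation sign. *)
Lemma nrotM (C : 'M[R]_d) A : row_free A ->
  nrot (C *m A) = Num.sg (\det C) *: nrot A.
Proof.
move=> fA; rewrite /nrot vol_rotM scalerA /gram_det.
have -> : \det (C *m A *m (C *m A)^T) = \det C ^+ 2 * \det (A *m A^T).
  by rewrite trmx_mul mulmxA -(mulmxA C) !det_mulmx det_tr; ring.
rewrite sqrtrM ?sqr_ge0 // sqrtr_sqr scalerA; congr (_ *: _).
have s0 : Num.sqrt (\det (A *m A^T)) != 0.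
  by rewrite sqrtr_eq0 -ltNge; exact: gram_det_gt0.
move: (Num.sqrt _) s0 => s s0.
have [->|C0] := eqVneq (\det C) 0; first by rewrite mulr0 sgr0 mul0r.
have n0 : `|\det C| != 0 by rewrite normr_eq0.
rewrite {2}(numEsg (\det C)); field.
by rewrite n0 s0.
Qed.

(* [K] is the rotation by a right angle of the normal plane, [xi |-> eta]. *)
Lemma normal_rotation A (K : 'M[R]_(d + (1 + 1))) : row_free A ->
  (exists2 s, s ^+ 2 = 1 & K = s *: nrot A) ->
  exists xi eta, [/\ orthonormal2 xi eta, col_mx xi eta *m A^T = 0 & K = wedge xi eta].
Proof.
move=> fA [s s2 ->]; have [xi [eta [on VA]]] := normal_frame fA.
have [k [-> k2]] := nrotE fA on VA.
rewrite scalerA; have c2 : (s * k) ^+ 2 = 1 by rewrite exprMn s2 k2 mulr1.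
move: (s * k) c2 => {}c /eqP; rewrite sqrf_eq1 => /orP[] /eqP->.
  by exists xi, eta; rewrite scale1r.
exists eta, xi; case: on => xx ee xe; split.
- by split=> //; rewrite dotrC.
- have [h1 h2] := col_mx2_0l VA.
  by rewrite mul_col_mx h1 h2 col_mx0.
- by rewrite scaleN1r /wedge opprB.
Qed.

Lemma proj_frame A xi eta (P : 'M[R]_(d + (1 + 1))) : row_free A ->
  orthonormal2 xi eta -> col_mx xi eta *m A^T = 0 ->
  A *m P = A -> col_mx xi eta *m P = 0 ->
  1%:M - P = xi^T *m xi + eta^T *m eta.
Proof.
move=> fA on VA AP VP; set V := col_mx xi eta in on VA VP *.
have -> : xi^T *m xi + eta^T *m eta = V^T *m V by rewrite /V tr_col_mx mul_row_col.
have uX : col_mx A V \in unitmx.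
  apply: tangent_normal_unit => //.
  rewrite -row_leq_rank; have := mxrankM_maxl V V^T.
  by rewrite orthonormal2_mx // mxrank1.
apply: (can_inj (mulKmx uX)); rewrite !(mul_col_mx A V).
have AV : A *m V^T = 0 by rewrite -[A]trmxK -trmx_mul VA trmx0.
rewrite !mulmxBr !mulmx1 AP VP subrr subr0 !mulmxA AV mul0mx.
by rewrite orthonormal2_mx // mul1mx.
Qed.

End Frames.

(** * Complex ranks and complex frames *)

Section ComplexRank.
Context {R : realType} {m : nat}.
Local Notation J := (standard_J R m).

Lemma standard_J_sqr : J *m J = - 1%:M.
Proof.
rewrite /standard_J mulmx_block !mul0mx !mulmx0 mul1mx mulmx1 !(add0r, addr0).
by rewrite (scalar_mx_block m m) opp_block_mx !oppr0.
Qed.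

Lemma standard_J_tr : J^T = - J.
Proof.
by rewrite /standard_J tr_block_mx opp_block_mx linearN /= !trmx0 trmx1 !oppr0 opprK.
Qed.

Lemma standard_J_unit : J \in unitmx.
Proof.
have : J *m (- J) = 1%:M by rewrite mulmxN standard_J_sqr opprK.
by case/mulmx1_unit.
Qed.

Definition of_complex k (Z : 'M[R[i]]_(k, m)) : 'M[R]_(k, m + m) :=
  row_mx (map_mx (@complex.Re R) Z) (map_mx (@complex.Im R) Z).

Lemma to_complexK k (A : 'M[R]_(k, m + m)) : of_complex (to_complex A) = A.
Proof.
rewrite -[RHS]hsubmxK /of_complex; congr row_mx; apply/matrixP => i j; by rewrite !mxE.
Qed.

Lemma mulmx_JE k (A : 'M[R]_(k, m + m)) : A *m J = row_mx (- rsubmx A) (lsubmx A).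
Proof.
rewrite -{1}(hsubmxK A) /standard_J mul_row_block !mulmx0 !mulmx1 add0r addr0.
by rewrite mulmxN mulmx1.
Qed.

Lemma of_complexM k l (C : 'M[R[i]]_(k, l)) (Z : 'M[R[i]]_(l, m)) :
  of_complex (C *m Z) = map_mx (@complex.Re R) C *m of_complex Z +
                        map_mx (@complex.Im R) C *m (of_complex Z *m J).
Proof.
rewrite mulmx_JE /of_complex row_mxKl row_mxKr !mul_mx_row add_row_mx.
congr row_mx; apply/matrixP => i j; rewrite !mxE raddf_sum -big_split /=;
  apply: eq_bigr => h _; rewrite !mxE; case: (C i h) => a b; case: (Z h j) => x y /=.
  by rewrite mulrN.
by [].
Qed.

Lemma of_complex_eq0 k (Z : 'M[R[i]]_(k, m)) : (of_complex Z == 0) = (Z == 0).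
Proof.
apply/eqP/eqP => [|->]; last first.
  rewrite /of_complex -(row_mx0 _ k m m); congr row_mx;
  by apply/matrixP => i j; rewrite !mxE.
rewrite /of_complex -(row_mx0 _ k m m) => /eq_row_mx[/matrixP h1 /matrixP h2].
apply/matrixP => i j; have := h1 i j; have := h2 i j; rewrite !mxE.
by case: (Z i j) => a b /= -> ->.
Qed.

(** A complex basis [Z0] of the span, read as real rows [X0], forms with [X0 *m J] a real basis of
    the row space of [A]. Stability under [J] is what puts [X0] back inside that row space. *)
Lemma complex_dim_stable k (A : 'M[R]_(k, m + m)) :
  (A *m J <= A)%MS -> \rank A = (2 * complex_dim A)%N.
Proof.
move=> AJ; rewrite /complex_dim; set Z := to_complex A.
set r := \rank Z; pose Z0 := row_base Z; pose X0 := of_complex Z0.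
have /submxP[C ZC] : (Z <= Z0)%MS by rewrite eq_row_base.
have /submxP[C' ZC'] : (Z0 <= Z)%MS by rewrite eq_row_base.
pose Y := col_mx X0 (X0 *m J).
have AZ : of_complex Z = A by exact: to_complexK.
have AY : (A <= Y)%MS.
  have -> : A = map_mx (@complex.Re R) C *m X0 + map_mx (@complex.Im R) C *m (X0 *m J).
    by rewrite -of_complexM -ZC.
  rewrite /Y -addsmxE.
  by apply: addmx_sub; rewrite (submx_trans (submxMl _ _)) // ?addsmxSl ?addsmxSr.
have X0A : (X0 <= A)%MS.
  have -> : X0 = map_mx (@complex.Re R) C' *m A + map_mx (@complex.Im R) C' *m (A *m J).
    by rewrite -AZ -of_complexM -ZC'.
  rewrite addmx_sub ?submxMl //.
  by rewrite (submx_trans (submxMl _ _)).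
have YA : (Y <= A)%MS.
  by rewrite /Y col_mx_sub X0A (submx_trans (submxMr J X0A)).
have -> : \rank A = \rank Y.
  by apply/eqP; rewrite eqn_leq !mxrankS.
suff /eqP -> : row_free Y by rewrite addnn mul2n.
apply/inj_row_free => u.
rewrite -(hsubmxK u) /Y mul_row_col => uY.
pose w : 'rV[R[i]]_r := \row_j Complex (lsubmx u 0 j) (rsubmx u 0 j).
have w0 : w = 0.
  have /row_freeP[D Z0D] : row_free Z0 by exact: row_base_free.
  have : w *m Z0 = 0.
    apply/eqP; rewrite -of_complex_eq0 of_complexM -/X0; apply/eqP.
    rewrite -[RHS]uY; congr +%R; congr (_ *m _); apply/rowP => j; by rewrite !mxE.
  by move/(congr1 (mulmx^~ D)); rewrite /= -mulmxA Z0D mulmx1 mul0mx.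
rewrite -(row_mx0 _ 1 r r); congr row_mx; apply/rowP => j;
  by move/rowP/(_ j): w0; rewrite !mxE => -[].
Qed.

(** Rows are added one at a time, keeping [X] and [X *m K] jointly independent. A standard basis
    vector v outside their span Y can be added: if a v + b v K lies in Y, applying a - b K shows
    that (a^2 + b^2) v does too. *)
Lemma complex_frame_ex (K : 'M[R]_(m + m)) : K *m K = - 1%:M ->
  exists2 L, L \in unitmx & L *m K = J *m L.
Proof.
move=> K2.
have step k : (k <= m)%N -> exists X : 'M[R]_(k, m + m), row_free (col_mx X (X *m K)).
  elim: k => [|k IH] km.
    by exists 0; rewrite /row_free eqn_leq rank_leq_row.
  have [X fX] := IH (ltnW km); pose Y := col_mx X (X *m K).
  have YK : (Y *m K <= Y)%MS.
    rewrite /Y mul_col_mx col_mx_sub -mulmxA K2 mulmxN mulmx1 eqmx_opp.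
    by rewrite -!addsmxE addsmxSr addsmxSl.
  have [i vi] : exists i, ~~ (row i (1%:M : 'M[R]_(m + m)) <= Y)%MS.
    apply/row_subPn; apply/negP => /mxrankS; rewrite mxrank1 leqNgt.
    by rewrite (eqP fX); lia.
  set v := row i _ in vi.
  rewrite -addn1; exists (col_mx X v).
  apply/inj_row_free => u.
  rewrite -(hsubmxK u) -(hsubmxK (lsubmx u)) -(hsubmxK (rsubmx u)).
  set u1 := lsubmx (lsubmx u); set u2 := lsubmx (rsubmx u).
  rewrite [rsubmx (lsubmx u)]mx11_scalar [rsubmx (rsubmx u)]mx11_scalar.
  move: (_ 0 0) (_ 0 0) => b a.
  rewrite mul_col_mx !mul_row_col !mul_scalar_mx => E.
  have vY : ((a *: v + b *: (v *m K))%R <= Y)%MS.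
    have -> : a *: v + b *: (v *m K) = - (u1 *m X + u2 *m (X *m K)).
      by apply/eqP; rewrite -addr_eq0 addrC addrACA E.
    rewrite eqmx_opp -mul_row_col; exact: submxMl.
  have : (((a ^+ 2 + b ^+ 2) *: v)%R <= Y)%MS.
    have -> : (a ^+ 2 + b ^+ 2) *: v =
        a *: (a *: v + b *: (v *m K)) - b *: ((a *: v + b *: (v *m K)) *m K).
      rewrite mulmxDl -!scalemxAl -mulmxA K2 mulmxN mulmx1 !scalerDr !scalerA.
      rewrite !scalerN opprD opprK scalerDl !expr2 (mulrC b a).
      by rewrite -!addrA; congr (_ + _); rewrite addrA subrr add0r.
    rewrite addmx_sub ?scalemx_sub // eqmx_opp scalemx_sub //.
    exact: submx_trans (submxMr K vY) YK.
  have [ab|ab vY'] := eqVneq (a ^+ 2 + b ^+ 2) 0; last first.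
    by rewrite eqmx_scale // (negPf vi) in vY'.
  have [a0 b0] : a = 0 /\ b = 0 by split; nra.
  move: E; rewrite a0 b0 !scale0r !addr0 -mul_row_col => E.
  have u0 : row_mx u1 u2 = 0.
    have /row_freeP[D YD] := fX.
    by rewrite -[LHS]mulmx1 -YD mulmxA -/Y E mul0mx.
  move: u0; rewrite -(row_mx0 _ 1 k k) => /eq_row_mx[-> ->].
  by rewrite -scalemx1 scale0r !row_mx0.
have [X fX] := step m (leqnn m).
exists (col_mx X (X *m K)); first by rewrite -row_free_unit.
rewrite /standard_J mul_block_col !mul0mx mul1mx mulNmx mul1mx add0r addr0.
by rewrite mul_col_mx -mulmxA K2 mulmxN mulmx1.
Qed.

End ComplexRank.

Section CRRank.
Context {R : realType} {n : nat}.
Local Notation J := (standard_J R n.+1).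

(** The intersection is stable under [J], so its real dimension is twice [complex_dim]. The
    dimension formula then matches the value [n - 1] with a sum of dimension 2n + 2. *)
Lemma CR_rankP (T : 'M[R]_(2 * n, n.+1 + n.+1)) : (0 < n)%N -> row_free T ->
  (complex_dim (T :&: T *m J)%MS == (n - 1)%N) = row_full (T + T *m J)%MS.
Proof.
move=> n0 fT.
have JJ k (B : 'M[R]_(k, n.+1 + n.+1)) : B *m J *m J = - B.
  by rewrite -mulmxA standard_J_sqr mulmxN mulmx1.
have stab : ((T :&: T *m J)%MS *m J <= T :&: T *m J)%MS.
  rewrite sub_capmx; apply/andP; split.
    by apply: submx_trans (submxMr J (capmxSr _ _)) _; rewrite JJ eqmx_opp.
  exact: submxMr J (capmxSl _ _).
have := mxrank_sum_cap T (T *m J).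
have rJ : \rank (T *m J) = (2 * n)%N.
  by rewrite mxrankMfree ?row_free_unit ?standard_J_unit //; exact/eqP.
rewrite rJ (complex_dim_stable stab) (eqP fT) /row_full => E.
set cd := complex_dim _ in E *; move: (\rank _) E => s E.
apply/eqP/eqP; lia.
Qed.

End CRRank.

(** * From CR regular to pseudo-holomorphic embeddings *)

Section Embedding.
Context {R : realType} {d N : nat} {M : smooth_space R d}.
Implicit Types f : M -> euclid R N.

Lemma tangent_map_tmx f x : smoothM_row (f : M -> 'rV[R]_N) ->
  tangent_map f x = tmx (f : M -> 'rV[R]_N) x.
Proof.
move=> Sf; have xi : (chart (pref x) @` dom (pref x)) (chart (pref x) x).
  by exists x => //; exact: dom_pref.
by have [_] := jacobianE (@open_cod _ _ M (pref x)) xi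
  (smoothM_row_on (pref x) Sf 1%N).
Qed.

Lemma smooth_mapP f : smooth_map f <-> smoothM_row (f : M -> 'rV[R]_N).
Proof.
split=> [[_ Sf] k j i|Sf].
  have := (smooth_on_mxE ((f : M -> 'rV[R]_N) \o chart_inv i)
    (@open_cod _ _ M i)).1 _ k j; apply.
  by have := Sf i tt; rewrite preimage_setT setIT.
split; first exact: smoothM_row_continuous Sf.
move=> i j; rewrite preimage_setT setIT; exact: smoothM_row_on.
Qed.

(** A continuous injection of a compact space into a Hausdorff one is closed, which gives the
    homeomorphism clause. *)
Lemma embeddingP f : compact [set: M] ->
  smooth_embedding f <-> immersion (f : M -> 'rV[R]_N) /\ injective f.
Proof.
move=> cM; split=> [[/smooth_mapP Sf inj rf _]|[[Sf rf] inj]].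
  by split=> //; split=> // x; rewrite -tangent_map_tmx.
split=> //; first exact/smooth_mapP.
  by move=> x; rewrite tangent_map_tmx.
move=> A oA; exists (~` (f @` ~` A)).
  rewrite openC; apply: (@compact_closed 'rV[R]_N); first exact: norm_hausdorff.
  apply: (@continuous_compact M 'rV[R]_N).
    by apply: continuous_subspaceT; exact: (smoothM_row_continuous Sf).
  by apply: subclosed_compact (@subsetT _ _) => //; rewrite closedC.
apply/seteqP; split=> x /=; first by move=> Ax [y nAy /inj E]; rewrite E in nAy.
by move=> H; apply: contrapT => nAx; apply: H; exists x.
Qed.

End Embedding.

Lemma coord_change_unit {R : realType} {d : nat} {M : smooth_space R d} (i j : chart_index M) x :
  dom i x -> dom j x -> coord_change i j x \in unitmx.
Proof. by move=> di dj; have [uC _] := mulmx1_unit (coord_changeK di dj); exact: uC. Qed.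

Lemma jac_row_free {R : realType} {d N : nat} {M : smooth_space R d}
    (f : M -> 'rV[R]_N) i x : immersion f -> dom i x ->
  row_free (jac (f \o chart_inv i) (chart i x)).
Proof.
move=> [Sf rf] dx; rewrite (smoothM_jac_change Sf dx (dom_pref x)).
rewrite /row_free mxrankMfree; last exact: rf.
by rewrite mxrank_unit //; exact: (coord_change_unit dx (dom_pref x)).
Qed.

Section PulledBackEndomorphism.
Context {R : realType} {d N : nat} {M : smooth_space R d}.
Variable f : M -> 'rV[R]_N.
Hypothesis imm : immersion f.

Lemma smooth_local_endo (B : M -> 'M[R]_N) i : salg_mx (@smoothM _ _ M) B ->
  smooth_on (chart i @` dom i)
    (local_endo (fun x => tmx f x *m B x *m pinv f x) i).
Proof.
move=> SB; have oi := @open_cod _ _ M i; have alg := smooth_on_algebra oi.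
have [Sf rf] := imm; have SJ := smoothM_jac i Sf.
apply/(smooth_on_mxE _ oi).
have unitC x : dom i x -> coord_change i (pref x) x \in unitmx.
  by move=> dx; exact: (coord_change_unit dx (dom_pref x)).
apply: (@salg_mxeq _ _ _ _ alg _ _ (fun y => jac (f \o chart_inv i) y *m
  B (chart_inv i y) *m ((jac (f \o chart_inv i) y)^T *m
      invmx (jac (f \o chart_inv i) y *m (jac (f \o chart_inv i) y)^T)))).
  move=> _ [x dx <-]; rewrite /local_endo chartK //.
  have uC := unitC x dx; have uG := gram_unit (rf x).
  rewrite (smoothM_jac_change Sf dx (dom_pref x)) -/(tmx f x) /pinv.
  set C := coord_change _ _ _ in uC *; set A := tmx f x in uG *.
  have -> : coord_change (pref x) i x = invmx C.
    by rewrite -[RHS]mulmx1 -(coord_changeK dx (dom_pref x)) mulKmx.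
  rewrite trmx_mul; have -> : C *m A *m (A^T *m C^T) = C *m (A *m A^T *m C^T).
    by rewrite !mulmxA.
  rewrite (invmxM uC) ?unitmx_mul ?uG ?unitmx_tr // (invmxM uG) ?unitmx_tr //.
  by rewrite !mulmxA mulmxK ?unitmx_tr.
apply: (salg_mxM alg); last first.
  apply: (salg_mxM alg); first exact: (salg_mxT alg).
  apply: (salg_mxV alg); last by apply: (salg_mxM alg) => //; exact: (salg_mxT alg).
  by move=> _ [x dx <-]; apply: gram_unit; exact: jac_row_free.
apply: (salg_mxM alg) => // k l; exact: SB.
Qed.

End PulledBackEndomorphism.

Section EuclidAcs.
Context {R : realType} {N : nat}.

Lemma coord_change_euclid (i j : chart_index (euclid R N)) x : coord_change i j x = 1%:M.
Proof.
have [_ E] := @jacobianE _ _ _ setT (fun x : 'rV[R]_N => x) x openT I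
  (@smooth_on_id R 'rV[R]_N setT 1%N).
by rewrite -[RHS](jac_id (x : 'rV[R]_N)) -E.
Qed.

Lemma acs_euclid_smooth (B : 'rV[R]_N -> 'M[R]_N) i :
  smooth_on setT B ->
  smooth_on (chart i @` dom i) (local_endo (M := euclid R N) B i).
Proof.
rewrite /= image_id => SB; apply: eq_smooth_on SB; first exact: openT.
by move=> y _; rewrite /local_endo !coord_change_euclid mul1mx mulmx1.
Qed.

Lemma smooth_acs_euclid (JN : almost_complex (euclid R N)) :
  smooth_on setT (acs JN : 'rV[R]_N -> 'M[R]_N).
Proof.
have := acs_smooth JN tt; rewrite /= image_id; apply: eq_smooth_on; first exact: openT.
by move=> y _; rewrite /local_endo !coord_change_euclid mul1mx mulmx1.
Qed.

End EuclidAcs.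

Section NormalRotation.
Context {R : realType} {d : nat} {M : smooth_space R d}.
Variables (f : M -> 'rV[R]_(d + (1 + 1))) (o : orientation M).
Hypothesis imm : immersion f.

(** The sign and [nrot] may both jump with the chart [pref x]; the jumps cancel
    ([normal_rot_chart]), and in a fixed chart the remaining sign is locally constant. *)
Definition normal_rot x : 'M[R]_(d + (1 + 1)) :=
  (-1) ^+ positive_frame o x *: nrot (tmx f x).

Lemma normal_rot_frame x : exists xi eta,
  [/\ orthonormal2 xi eta, col_mx xi eta *m (tmx f x)^T = 0 &
      normal_rot x = wedge xi eta].
Proof.
apply: normal_rotation; first by have [_] := imm.
by exists ((-1) ^+ positive_frame o x) => //; rewrite sqrr_sign.
Qed.

Lemma normal_rot_chart i x : dom i x -> normal_rot x =
  (-1) ^+ frame_sign (positive_frame o) i x *: nrot (jac (f \o chart_inv i) (chart i x)).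
Proof.
have [Sf rf] := imm; move=> dx; rewrite (smoothM_jac_change Sf dx (dom_pref x)).
rewrite -/(tmx f x) (nrotM _ (rf x)) scalerA /normal_rot /frame_sign signr_addb -mulrA.
set c := \det _; have c0 : c != 0.
  rewrite -unitfE -unitmxE; exact: (coord_change_unit dx (dom_pref x)).
have -> : (-1) ^+ (c < 0)%R * Num.sg c = 1 by rewrite -neqr0_sign // -expr2 sqrr_sign.
by rewrite mulr1.
Qed.

Lemma smooth_nrot_chart i : salg_mx
  (fun h : 'rV[R]_d -> R => smooth_on (chart i @` dom i) h)
  (fun y => nrot (jac (f \o chart_inv i) y)).
Proof.
have oi := @open_cod _ _ M i; have alg := smooth_on_algebra oi.
have [Sf rf] := imm; have SJ := smoothM_jac i Sf.
have g0 y : (chart i @` dom i) y -> 0 < gram_det (jac (f \o chart_inv i) y).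
  by move=> [x dx <-]; apply: gram_det_gt0; exact: jac_row_free.
rewrite /nrot; apply: (salg_mxZ alg).
  apply: (salgV alg) => [y /g0 gy|]; first by rewrite gt_eqF // sqrtr_gt0.
  apply: (salg_comp1 alg smooth_sqrt) => //; apply: (salg_det alg).
  by apply: (salg_mxM alg) => //; exact: (salg_mxT alg).
move=> k l; apply: (salg_eq alg (f := fun y => \det (col_mx (jac (f \o chart_inv i) y)
  (col_mx 'e_k 'e_l : 'M[R]_(1 + 1, d + (1 + 1)))))) => [y _|]; first by rewrite mxE.
by apply: (salg_det alg); apply: (salg_col_mx alg) => //; exact: (salg_mxcst alg).
Qed.

Lemma smooth_normal_rot : salg_mx (@smoothM _ _ M) normal_rot.
Proof.
move=> k l i; have oi := @open_cod _ _ M i.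
apply: smooth_on_local => _ [x dx <-].
set b := frame_sign (positive_frame o) i x.
have H2 := @chart_inv_cont _ _ M i (chart i x) (chart_in dx) _.
have := orientation_cont o dx; rewrite -{1}(chartK dx) => /H2 H3.
have {H3} : \forall y \near (chart i x : 'rV[R]_d),
  frame_sign (positive_frame o) i (chart_inv i y) = b by exact: H3.
move=> /(near_ballP (chart i x : 'rV[R]_d))[r r0 H3].
pose B : set 'rV[R]_d := [set y | `|y - chart i x| < r].
have oB : open B by exact: open_normB.
pose U := (chart i @` dom i) `&` B.
have oU : open U by exact: openI.
have UB y : U y -> (chart i @` dom i) y /\ frame_sign (positive_frame o) i (chart_inv i y) = b.
  by move=> [Uy By]; split; [exact: Uy|exact: H3].
have Ux : U (chart i x) by split; [exact: chart_in|rewrite /B /= subrr normr0].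
exists U => //.
have S := smooth_on_sub (U' := U) (fun y Uy => (UB y Uy).1) (smooth_nrot_chart i k l).
have eqU (y : 'rV[R]_d) : U y -> (-1) ^+ b * nrot (jac (f \o chart_inv i) y) k l =
    normal_rot (chart_inv i y) k l.
  move=> Uy; have [[z dz zy] E] := UB y Uy; rewrite -zy (chartK dz) in E *.
  by rewrite (normal_rot_chart dz) E [RHS]mxE.
exact: (@salg_eq _ _ _ _ (smooth_on_algebra oU) _ _ eqU
  (salgM (smooth_on_algebra oU) (salg_cst (smooth_on_algebra oU) ((-1) ^+ b)) S)).
Qed.

End NormalRotation.

(** * Conjugation of a complex structure by a skew matrix *)

Section SkewAlgebra.
Context {R : realType} {N : nat}.
Implicit Types (S K J : 'M[R]_N) (u xi eta : 'rV[R]_N).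

Lemma skew_dotr S u : S^T = - S -> dotr (u *m S) u = 0.
Proof.
move=> ST; have : dotr (u *m S) u = - dotr (u *m S) u.
  by rewrite {1}dotr_mull ST mulmxN dotrNr dotrC.
by move=> E; lra.
Qed.

Lemma skew_unit S : S^T = - S -> 1%:M + S \in unitmx.
Proof.
move=> ST; rewrite -row_free_unit; apply/inj_row_free => u E.
apply/eqP; rewrite -dotr_eq0; have : dotr (u *m (1%:M + S)) u = 0.
  by rewrite E /dotr mul0mx mxE.
by rewrite mulmxDr mulmx1 dotrDl skew_dotr // addr0 => ->.
Qed.

Lemma mul_wedge u xi eta : u *m wedge xi eta = dotr u xi *: eta - dotr u eta *: xi.
Proof.
by rewrite /wedge mulmxBr !mulmxA !mul_row_dotr !mul_scalar_mx.
Qed.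

Lemma tr_wedge xi eta : (wedge xi eta)^T = - wedge xi eta.
Proof.
by rewrite /wedge linearB /= !trmx_mul !trmxK opprB.
Qed.

(* For [K = wedge xi eta] this is the inner product of [xi *m J] and [eta], and
   conjugating [J] by [1 + cr_skew J K] gives a structure sending [xi] to [eta]. *)
Definition cr_angle J K : R := - (2^-1 * \tr (K *m J)).

Definition cr_skew J K : 'M[R]_N := (1 + cr_angle J K)^-1 *: (J *m K - K *m J).

Definition conj_by S J : 'M[R]_N := (1%:M + S) *m J *m invmx (1%:M + S).

Lemma conj_by_sqr S J : 1%:M + S \in unitmx -> J *m J = - 1%:M ->
  conj_by S J *m conj_by S J = - 1%:M.
Proof.
move=> uS J2; rewrite /conj_by !mulmxA mulmxKV // -(mulmxA _ J J) J2.
by rewrite mulmxN mulmx1 mulNmx mulmxV.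
Qed.

Variables (J : 'M[R]_N).
Hypotheses (J2 : J *m J = - 1%:M) (JT : J^T = - J).

Lemma dotrJ u v : dotr (u *m J) v = - dotr (v *m J) u.
Proof. by rewrite dotr_mull JT mulmxN dotrNr dotrC. Qed.

Lemma dotrJJ u v : dotr (u *m J) (v *m J) = dotr u v.
Proof. by rewrite dotr_mull JT -mulmxA mulmxN J2 opprK mulmx1. Qed.

Lemma cr_angle_wedge xi eta : cr_angle J (wedge xi eta) = dotr (xi *m J) eta.
Proof.
rewrite /cr_angle /wedge mulmxBl linearB /= -!mulmxA mxtrace_mulC.
rewrite [X in _ - X]mxtrace_mulC !mul_row_dotr !mxtrace_scalar !mulr1n.
by rewrite (dotrJ eta); lra.
Qed.

Lemma cr_skew_tr K : K^T = - K -> (cr_skew J K)^T = - cr_skew J K.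
Proof.
move=> KT; rewrite /cr_skew linearZ linearB /= !trmx_mul KT JT.
by rewrite !mulmxN !mulNmx !opprK -scalerN opprB.
Qed.

Lemma cr_skew_anti K : cr_skew J K *m J = - (J *m cr_skew J K).
Proof.
rewrite /cr_skew -scalemxAl -scalemxAr mulmxBl mulmxBr -scalerN; congr (_ *: _).
rewrite -(mulmxA K J J) J2 (mulmxA J J K) J2 mulmxN mulmx1 mulNmx mul1mx (mulmxA J K J).
by rewrite opprB !opprK addrC.
Qed.

Section Frame.
Variables (xi eta : 'rV[R]_N).
Hypothesis on : orthonormal2 xi eta.
Let K := wedge xi eta.
Let th := cr_angle J K.
Let S := cr_skew J K.

(** Up to the factor [1 + th], [xi *m (1 + S)] is xi - eta J and [eta *m (1 + S)] is eta + xi J, and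
    [J] takes the first to the second. *)
Lemma cr_skew_frame : 1 + th != 0 -> xi *m conj_by S J = eta.
Proof.
have [xx ee xe] := on; move=> th0; have thE := cr_angle_wedge xi eta.
have uS : 1%:M + S \in unitmx by apply: skew_unit; apply: cr_skew_tr; exact: tr_wedge.
have xiJxi : dotr (xi *m J) xi = 0 by exact: skew_dotr.
have JJ w : w *m J *m J = - w by rewrite -mulmxA J2 mulmxN mulmx1.
have ex : dotr eta xi = 0 by rewrite dotrC.
have et : dotr (xi *m J) eta = th by rewrite -thE.
have ett : dotr (eta *m J) xi = - th by rewrite dotrJ et.
have etJ : dotr (eta *m J) eta = 0 by exact: skew_dotr.
have SE w : w *m S = (1 + th)^-1 *: (w *m J *m K - w *m K *m J).
  by rewrite /S /cr_skew -/th -scalemxAr mulmxBr !mulmxA.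
clearbody th.
have E : xi *m (1%:M + S) *m J = eta *m (1%:M + S).
  apply: (scalerI th0); rewrite !mulmxDr !mulmx1 !SE !mulmxDl -scalemxAl !scalerDr.
  rewrite !scalerA mulfV // !scale1r /K !mul_wedge xx ee xe ex xiJxi et ett etJ.
  rewrite !(scale0r, scale1r, subr0, sub0r, mulNmx, opprK) mulmxBl mulNmx -scalemxAl.
  rewrite !JJ !opprK scaleNr !scalerDl !scale1r.
  by rewrite addrA addrK [RHS]addrA addrK addrC.
by rewrite /conj_by !mulmxA E mulmxK.
Qed.

End Frame.

(** Anticommutation means that moving [J] across [1 + S] turns it into its transpose [1 - S]. This
    makes the transposed conjugate the opposite of the conjugate. *)
Lemma conj_skew_tr S : S^T = - S -> S *m J = - (J *m S) ->
  (conj_by S J)^T = - conj_by S J.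
Proof.
move=> ST SJ; have uS := skew_unit ST.
have uS' : 1%:M - S \in unitmx by rewrite -unitmx_tr linearB /= trmx1 ST opprK.
rewrite /conj_by !trmx_mul trmx_inv linearD /= trmx1 ST JT.
have JS : (1%:M + S) *m J = J *m (1%:M - S).
  by rewrite mulmxDl mulmxBr mul1mx mulmx1 SJ.
have JS' : (1%:M - S) *m J = J *m (1%:M + S).
  by rewrite mulmxBl mulmxDr mul1mx mulmx1 SJ opprK.
rewrite mulNmx mulmxN; congr (- _).
apply: (can_inj (mulKmx uS')); rewrite mulKVmx //.
apply: (can_inj (mulmxK uS)); rewrite !mulmxA mulmxKV //.
have -> : (1%:M - S) *m (1%:M + S) = (1%:M + S) *m (1%:M - S).
  by rewrite !mulmxDl !mulmxDr !mul1mx !mulmx1 !mulmxN mulNmx !addrA addrNK addrK.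
by rewrite -JS -[RHS]mulmxA JS' mulmxA.
Qed.

(** The value -1 is the equality case of the Cauchy-Schwarz inequality and forces [xi *m J = - eta].
    The normal plane would then be complex, and [xi] orthogonal to the rows of [A] and of
    [A *m J]. *)
Lemma cr_angle_neqN1 d (A : 'M[R]_(d, N)) xi eta : orthonormal2 xi eta ->
  col_mx xi eta *m A^T = 0 -> row_full (A + A *m J)%MS ->
  1 + cr_angle J (wedge xi eta) != 0.
Proof.
move=> [xx ee xe] /col_mx2_0l[xA eA] full; rewrite cr_angle_wedge.
apply/eqP => th.
have eE : xi *m J = - eta.
  apply/eqP; rewrite -addr_eq0 -dotr_eq0 !dotrDl !dotrDr dotrJJ xx ee.
  by rewrite (dotrC eta); apply/eqP; lra.
have x0 : xi != 0 by rewrite -dotr_gt0 xx ltr01.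
suff : (1%:M <= kermx xi^T)%MS.
  rewrite sub_kermx mul1mx => /eqP /(congr1 trmx).
  by rewrite trmxK trmx0; move/eqP: x0.
apply: (submx_trans (submx_full _ full)); rewrite addsmx_sub !sub_kermx.
have AT w : w *m A^T = 0 -> A *m w^T = 0.
  by move=> E; rewrite -[LHS]trmxK trmx_mul trmxK E trmx0.
rewrite AT // eqxx /= -mulmxA -[J]trmxK -trmx_mul JT mulmxN eE opprK AT //.
Qed.

End SkewAlgebra.

Lemma pullback_sqr {R : realType} m n (A : 'M[R]_(m, n)) (B : 'M[R]_n) (Q : 'M[R]_(n, m)) :
  A *m Q = 1%:M -> A *m B *m (Q *m A) = A *m B -> B *m B = - 1%:M ->
  (A *m B *m Q) *m (A *m B *m Q) = - 1%:M.
Proof.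
move=> AQ ABA B2; rewrite !mulmxA -(mulmxA (A *m B) Q A) ABA -(mulmxA A B B) B2.
by rewrite mulmxN mulmx1 mulNmx AQ.
Qed.

Section Forward.
Context {R : realType} {d : nat} {M : smooth_space R d}.
Local Notation N := (d + (1 + 1))%N.
Variables (J : 'M[R]_N) (o : orientation M).
Hypotheses (cM : compact [set: M]) (J2 : J *m J = - 1%:M) (JT : J^T = - J).

Lemma smooth_matrix_extension (f : M -> 'rV[R]_N) m n (B : M -> 'M[R]_(m, n)) :
  immersion f -> injective f -> salg_mx (@smoothM _ _ M) B ->
  exists2 C : 'rV[R]_N -> 'M[R]_(m, n),
    salg_mx (fun h : 'rV[R]_N -> R => smooth_on setT h) C & forall x, C (f x) = B x.
Proof.
move=> imm inj SB.
have H i j := smooth_extension imm inj cM (SB i j).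
pose C z := \matrix_(i, j) s2val (cid2 (H i j)) z.
exists C => [i j|x]; last by apply/matrixP => i j; rewrite mxE; case: cid2 => ? ? /=.
rewrite (_ : (fun x => _) = s2val (cid2 (H i j))); first by case: cid2.
by apply/funext => x; rewrite mxE.
Qed.

Lemma pseudo_holomorphic_of_CR (f : M -> euclid R N) : smooth_embedding f ->
  (forall x, row_full (tangent_map f x + tangent_map f x *m J)%MS) ->
  exists (JM : almost_complex M) (Jhat : almost_complex (euclid R N)),
    pseudo_holomorphic_embedding JM Jhat f.
Proof.
move=> emb full; have [imm inj] := (embeddingP f cM).1 emb.
have [Sf rf] := imm; have tmE x := tangent_map_tmx x Sf.
have alg := smoothM_algebra M.
pose K := normal_rot f o; have SK := smooth_normal_rot o imm.
have KT x : (K x)^T = - K x.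
  by have [xi [eta [_ _ E]]] := normal_rot_frame o imm x; rewrite /K E tr_wedge.
have th0 x : 1 + cr_angle J (K x) != 0.
  have [xi [eta [on VA E]]] := normal_rot_frame o imm x.
  rewrite /K E; apply: cr_angle_neqN1 on VA _ => //.
  by rewrite -(tmE x); exact: full.
pose S x := cr_skew J (K x).
have SS : salg_mx (@smoothM _ _ M) S.
  rewrite /S /cr_skew; apply: (salg_mxZ alg).
    apply: (salgV alg) => [x _|]; first exact: th0.
    apply: (salgD alg); first exact: (salg_cst alg).
    apply: (salgN alg); apply: (salgM alg); first exact: (salg_cst alg).
    apply: (salg_mxtrace alg); apply: (salg_mxM alg) => //; exact: (salg_mxcst alg).
  by apply: (salg_mxB alg); apply: (salg_mxM alg) => //; exact: (salg_mxcst alg).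
have [C SC CE] := smooth_matrix_extension imm inj SS.
have algN := smooth_on_algebra (@openT 'rV[R]_N).
(* Keeping the skew part of the extension makes [1%:M + T y] invertible at every point of the
   ambient space, although anticommutation with [J] is known on the image of [f] only. *)
pose T y := 2^-1 *: (C y - (C y)^T).
have TT y : (T y)^T = - T y.
  by rewrite /T linearZ linearB /= trmxK -scalerN opprB.
have TE x : T (f x) = S x.
  rewrite /T CE (cr_skew_tr JT (KT x)) opprK -/(S x) scalerDr -scalerDl.
  by rewrite (_ : 2^-1 + 2^-1 = 1 :> R) ?scale1r //; lra.
have uT y := skew_unit (TT y).
have ST : salg_mx (fun h : 'rV[R]_N -> R => smooth_on setT h) T.
  apply: (salg_mxZ algN); first exact: (salg_cst algN).
  by apply: (salg_mxB algN) => //; exact: (salg_mxT algN).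
have S1T : salg_mx (fun h : 'rV[R]_N -> R => smooth_on setT h) (fun y => 1%:M + T y).
  by apply: (salg_mxD algN) => //; exact: (salg_mxcst algN).
pose JN y := conj_by (T y) J.
have SJN : salg_mx (fun h : 'rV[R]_N -> R => smooth_on setT h) JN.
  apply: (salg_mxM algN); last by apply: (salg_mxV algN) => // y _; exact: uT.
  apply: (salg_mxM algN) => //; exact: (salg_mxcst algN).
pose Jhat := @AlmostComplex R N (euclid R N) JN (fun y => conj_by_sqr (uT y) J2)
  (fun i => acs_euclid_smooth i ((smooth_on_mxE JN openT).2 SJN)).
have JNf : salg_mx (@smoothM _ _ M) (fun x => JN (f x)).
  apply: (salg_mxeq alg (A := fun x => conj_by (S x) J)) => [x _|].
    by rewrite /JN TE.
  have S1 : salg_mx (@smoothM _ _ M) (fun y => 1%:M + S y).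
    by apply: (salg_mxD alg) => //; exact: (salg_mxcst alg).
  apply: (salg_mxM alg); last first.
    by apply: (salg_mxV alg) => // x _; rewrite -TE; exact: uT.
  apply: (salg_mxM alg) => //; exact: (salg_mxcst alg).
(* [JN (f x)] preserves the normal plane, sending [xi] to [eta] and [eta] to [- xi]. Being skew, it
   preserves the orthogonal complement, which is the tangent space. *)
have tangent x : tmx f x *m JN (f x) *m tproj f x = tmx f x *m JN (f x).
  have [xi [eta [on VA E]]] := normal_rot_frame o imm x.
  have VP : col_mx xi eta *m tproj f x = 0 by rewrite /tproj /pinv !mulmxA VA !mul0mx.
  have PE := proj_frame (rf x) on VA (tmx_tproj imm x) VP.
  have xJ : xi *m JN (f x) = eta.
    rewrite /JN TE /S /K E; apply: cr_skew_frame => //.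
    by have := th0 x; rewrite /K E.
  have eJ : eta *m JN (f x) = - xi.
    by rewrite -xJ -mulmxA (conj_by_sqr (uT _) J2) mulmxN mulmx1.
  have JNT : (JN (f x))^T = - JN (f x).
    by apply: (conj_skew_tr JT (TT _)); rewrite TE; exact: cr_skew_anti.
  have [xA eA] := col_mx2_0l VA.
  move: (JN (f x)) xJ eJ JNT => Jx xJ eJ JNT.
  have AT (w : 'rV[R]_N) : w *m (tmx f x)^T = 0 -> tmx f x *m w^T = 0.
    by move=> F; rewrite -[LHS]trmxK trmx_mul trmxK F trmx0.
  have AJ (w : 'rV[R]_N) : tmx f x *m Jx *m w^T = - (tmx f x *m (w *m Jx)^T).
    by rewrite trmx_mul JNT mulNmx mulmxN opprK mulmxA.
  apply/eqP; rewrite eq_sym -subr_eq0 -[X in X - _]mulmx1 -mulmxBr PE mulmxDr !mulmxA !AJ.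
  by rewrite xJ eJ linearN /= mulmxN opprK (AT _ eA) (AT _ xA) oppr0 !mul0mx addr0 eqxx.
have JM2 x : (tmx f x *m JN (f x) *m pinv f x) *m (tmx f x *m JN (f x) *m pinv f x) = - 1%:M.
  exact: (pullback_sqr (tmx_pinv imm x) (tangent x) (conj_by_sqr (uT _) J2)).
pose JM := @AlmostComplex R d M _ JM2 (fun i => smooth_local_endo imm i JNf).
exists JM, Jhat; split=> // x.
by rewrite tmE /= -mulmxA -/(tproj f x) tangent.
Qed.

End Forward.

(** * Normal vector fields *)

Section NearIdentity.
Context {R : realType}.

Lemma dotr_mx n (X : 'M[R]_n) (v : 'rV[R]_n) :
  dotr (v *m X) v = \sum_i \sum_j v 0 j * X j i * v 0 i.
Proof.
by rewrite dotrE; apply: eq_bigr => i _; rewrite mxE mulr_suml.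
Qed.

(** Each term of the quadratic form of [X] is at most half of |X| (v_j^2 + v_i^2) in absolute value;
    these bounds add up to n |X| |v|^2, less than |v|^2. *)
Lemma near_id_pos n (X : 'M[R]_n) (v : 'rV[R]_n) : `|X| * n%:R < 1 -> v != 0 ->
  0 < dotr (v *m (1%:M + X)) v.
Proof.
move=> Xn v0; have v2 : 0 < dotr v v by rewrite dotr_gt0.
rewrite mulmxDr mulmx1 dotrDl.
suff : - (`|X| * n%:R * dotr v v) <= dotr (v *m X) v by nra.
rewrite dotr_mx lerNl -sumrN.
have le i j : - (v 0 j * X j i * v 0 i) <= `|X| * (v 0 j ^+ 2 + v 0 i ^+ 2) / 2.
  apply: le_trans (ler_norm _) _; rewrite normrN !normrM.
  have := mx_norm_coord X j i; have := normr_ge0 (X j i).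
  have := real_normK (num_real (v 0 i)); have := real_normK (num_real (v 0 j)).
  move: `|v 0 i| `|v 0 j| `|X j i| `|X| (normr_ge0 (v 0 i)) (normr_ge0 (v 0 j)).
  move=> a b c C a0 b0 <- <- c0 cC.
  have : 0 <= C * (a - b) ^+ 2 by rewrite mulr_ge0 ?sqr_ge0 // (le_trans c0).
  have : c * (a * b) <= C * (a * b) by rewrite ler_wpM2r ?mulr_ge0.
  nra.
apply: (@le_trans _ _ (\sum_i \sum_j `|X| * (v 0 j ^+ 2 + v 0 i ^+ 2) / 2)).
  by apply: ler_sum => i _; rewrite -sumrN; apply: ler_sum => j _; exact: le.
have -> : dotr v v = \sum_i v 0 i ^+ 2 by rewrite dotrE; apply: eq_bigr => i _.
set s := \sum_i v 0 i ^+ 2.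
have E i : \sum_j `|X| * (v 0 j ^+ 2 + v 0 i ^+ 2) / 2 =
    `|X| / 2 * s + `|X| / 2 * n%:R * v 0 i ^+ 2.
  under eq_bigr => j _ do rewrite mulrAC mulrDr.
  rewrite big_split /= -mulr_sumr -/s sumr_const card_ord -mulr_natr; ring.
under eq_bigr => i _ do rewrite E.
rewrite big_split /= sumr_const card_ord -mulr_sumr -/s -mulr_natr.
by rewrite le_eqVlt; apply/orP; left; apply/eqP; field.
Qed.

Lemma near_id_unit n (X : 'M[R]_n) : `|X| * n%:R < 1 -> 1%:M + X \in unitmx.
Proof.
move=> Xn; rewrite -row_free_unit; apply/inj_row_free => v E.
apply/eqP; apply: contraT => v0; have := near_id_pos Xn v0.
by rewrite E /dotr mul0mx mxE ltxx.
Qed.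

End NearIdentity.

Lemma smoothM_comp {R : realType} {d e : nat} {M : smooth_space R d}
    (g : M -> 'rV[R]_e) (O : set 'rV[R]_e) (G : 'rV[R]_e -> R) : open O ->
  (forall x, O (g x)) -> smoothM_row g -> smooth_on O G -> smoothM (fun x => G (g x)).
Proof.
move=> oO Og Sg SG i.
apply: (smooth_on_comp (f := g \o chart_inv i) (@open_cod _ _ M i) oO) => //.
  by move=> y _; exact: Og.
exact: smoothM_row_on.
Qed.

Lemma continuous_pair (X Y Z : topologicalType) (f : X -> Y) (g : X -> Z) :
  continuous f -> continuous g -> continuous (fun x => (f x, g x)).
Proof. by move=> cf cg x; apply: cvg_pair; [exact: cf|exact: cg]. Qed.

(** * Transport of sections along paths of projections *)

Section Transport.
Context {R : realType} {d : nat} {M : smooth_space R d}.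
Hypothesis cM : compact [set: M].

Lemma uniform_steps m n (F : M -> R -> 'M[R]_(m, n)) (e : R) :
  continuous (fun w : M * R => F w.1 w.2) -> 0 < e ->
  exists K : nat, (0 < K)%N /\ forall x k, (k < K)%N ->
    `|F x (k.+1%:R / K%:R) - F x (k%:R / K%:R)| < e.
Proof.
move=> cF e0.
have cX : compact ([set: M] `*` `[0 : R, 1]).
  by apply: compact_setX => //; exact: segment_compact.
pose P (t : R) (w : M * R) := `|F w.1 (w.2 + t) - F w.1 w.2| < e.
have near0 : \forall t \near (0 : R), forall w, ([set: M] `*` `[0 : R, 1]) w -> P t w.
  apply: ((compact_near_coveringP _).1 cX R (nbhs (0 : R)) P) => -[x t] _.
  have c1 : {for ((x, t), 0 : R), continuous
      (fun w : (M * R) * R => F w.1.1 (w.1.2 + w.2) - F w.1.1 w.1.2)}.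
    apply: continuousB.
      apply: (@continuous_comp _ _ _ (fun w : (M * R) * R => (w.1.1, w.1.2 + w.2))
        (fun w : M * R => F w.1 w.2)); last exact: cF.
      apply: continuous_pair => w; first exact: continuous_comp cvg_fst cvg_fst.
      by apply: cvgD; [exact: (continuous_comp cvg_fst cvg_snd)|exact: cvg_snd].
    apply: (@continuous_comp _ _ _ (fun w : (M * R) * R => w.1)
        (fun w : M * R => F w.1 w.2)); last exact: cF.
    exact: cvg_fst.
  have := @cvgr_distC_lt _ _ _ _ _ _ _ c1 e e0; rewrite /= addr0 subrr => H.
  have {}H := H (nbhs_filter _).
  apply: (@filterS _ _ (nbhs_filter ((x, t), 0 : R)) _ _ _ H) => w /=.
  by rewrite subr0.
have [r r0 H] := (near_ballP _ _).1 near0.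
have [K Kr] : exists K : nat, (0 < K)%N /\ K%:R^-1 < r.
  exists (Num.truncn r^-1).+1; split => //.
  by rewrite invf_plt ?posrE ?ltr0n // truncnS_gt.
exists K; split; first by case: Kr.
move=> x k kK; case: Kr => K0 Kr.
have KR : 0 < K%:R :> R by rewrite ltr0n.
have := H K%:R^-1 _ (x, k%:R / K%:R); rewrite /P /= subr0 gtr0_norm ?invr_gt0 //.
move=> /(_ Kr); have -> : k.+1%:R / K%:R = k%:R / K%:R + K%:R^-1 :> R.
  by rewrite -natr1 mulrDl mul1r.
apply; split => //=; rewrite in_itv /= divr_ge0 ?ler0n //=.
by rewrite ler_pdivrMr // mul1r ler_nat ltnW.
Qed.

(** The section is pushed into each fibre by the next projection. If w is fixed by a projection F_k,
    then w F_(k+1) = w (1 + F_(k+1) - F_k), which is nonzero when consecutive projections are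
    close. *)
Lemma transport m (F : M -> R -> 'M[R]_m) (w : M -> 'rV[R]_m) :
  continuous (fun w : M * R => F w.1 w.2) ->
  (forall t, salg_mx (@smoothM _ _ M) (F ^~ t)) ->
  (forall x t, F x t *m F x t = F x t) ->
  smoothM_row w -> (forall x, w x *m F x 0 = w x) -> (forall x, w x != 0) ->
  exists w', [/\ smoothM_row w', forall x, w' x *m F x 1 = w' x & forall x, w' x != 0].
Proof.
move=> cF SF F2 Sw wF w0; have alg := smoothM_algebra M.
have e0 : 0 < (m.+1%:R)^-1 :> R by rewrite invr_gt0 ltr0n.
have [K [K0 H]] := uniform_steps cF e0.
have step k : (k <= K)%N -> exists w', [/\ smoothM_row w',
    forall x, w' x *m F x (k%:R / K%:R) = w' x & forall x, w' x != 0].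
  elim: k => [_|k IH kK]; first by exists w; split=> // x; rewrite mul0r.
  have [w' [Sw' w'F w'0]] := IH (ltnW kK).
  exists (fun x => w' x *m F x (k.+1%:R / K%:R)); split.
  - by apply: (salg_mxM alg) => //; exact: SF.
  - by move=> x; rewrite -mulmxA F2.
  - move=> x; apply/eqP => E.
    set X := F x (k.+1%:R / K%:R) - F x (k%:R / K%:R).
    have := @near_id_pos _ _ X (w' x) _ (w'0 x).
    rewrite /X mulmxDr mulmx1 mulmxBr E w'F sub0r subrr /dotr mul0mx mxE ltxx.
    move=> H'; suff /H' : `|X| * m%:R < 1 by [].
    have := H x k kK; rewrite -/X => Xl.
    apply: (@le_lt_trans _ _ (m.+1%:R^-1 * m%:R)); first by rewrite ler_wpM2r ?ler0n // ltW.
    by rewrite mulrC ltr_pdivrMr ?ltr0n // mul1r ltr_nat.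
have [w' [Sw' w'F w'0]] := step K (leqnn K).
exists w'; split=> // x; move: (w'F x); rewrite divff ?pnatr_eq0 -?lt0n //.
Qed.

End Transport.

(** * A nonvanishing normal field *)

Section NormalField.
Context {R : realType}.

(* With [Q] the projection onto a normal plane and [Y] the matrix of a normal
   vector [v] and of its rotation, these are projections of rank 2 onto
   [Q] at [v = 0] and onto a fixed plane at [a = 0]. *)
Lemma blowup_idem n (a q : R) (Q : 'M[R]_n) (Y : 'M[R]_(n, 1 + 1)) :
  a ^+ 2 + q != 0 -> Q *m Q = Q -> Q *m Y = Y -> Y^T *m Q = Y^T ->
  Y *m Y^T = q *: Q -> Y^T *m Y = q *: 1%:M ->
  let D := a ^+ 2 + q in
  let F := block_mx (a ^+ 2 / D *: Q) (a / D *: Y) (a / D *: Y^T) ((q / D) *: 1%:M) in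
  F *m F = F.
Proof.
move=> D0 Q2 QY YQ YY YTY D F; rewrite /F mulmx_block.
rewrite -!scalemxAl -!scalemxAr !scalerA Q2 QY YQ YY YTY !mulmx1 !mul1mx !scalerA.
by rewrite -!scalerDl; congr block_mx; congr (_ *: _); rewrite /D; field.
Qed.

Lemma idem_section n (F : 'M[R]_n) : F *m F = F -> F != 0 ->
  exists2 w : 'rV[R]_n, w != 0 & w *m F = w.
Proof.
move=> F2 F0; have [i ri] : exists i, row i F != 0.
  apply/existsP; apply: contraR F0; rewrite negb_exists => /forallP H.
  by apply/eqP/row_matrixP => i; rewrite row0; have := H i; rewrite negbK => /eqP.
by exists (row i F) => //; rewrite -row_mul F2.
Qed.

Context {d : nat} {M : smooth_space R d}.
Local Notation N := (d + (1 + 1))%N.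
Variables (f : M -> 'rV[R]_N) (o : orientation M).
Hypotheses (cM : compact [set: M]) (imm : immersion f) (inj : injective f).
Let P := tproj f.
Let K := normal_rot f o.
Let alg := smoothM_algebra M.

Lemma normal_rot_tr x : (K x)^T = - K x.
Proof. by have [xi [eta [_ _ E]]] := normal_rot_frame o imm x; rewrite /K E tr_wedge. Qed.

Lemma normal_rot_proj x : P x *m K x = 0 /\ K x *m P x = 0.
Proof.
have [xi [eta [on VA E]]] := normal_rot_frame o imm x.
have [xA eA] := col_mx2_0l VA.
have KP : K x *m P x = 0.
  by rewrite /K E /wedge /P /tproj /pinv mulmxBl !mulmxA -!(mulmxA _ _ (_^T)) xA eA
    !(mulmx0, mul0mx) subr0.
split=> //; rewrite -[LHS]trmxK trmx_mul normal_rot_tr tr_tproj mulNmx KP.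
by rewrite oppr0 trmx0.
Qed.

Lemma normal_rot_sqr x : K x *m K x = - (1%:M - P x).
Proof.
have [xi [eta [on VA E]]] := normal_rot_frame o imm x.
have [rf] := imm.2 x; have [xx ee xe] := on.
have VP : col_mx xi eta *m P x = 0 by rewrite /P /tproj /pinv !mulmxA VA !mul0mx.
rewrite (proj_frame (imm.2 x) on VA (tmx_tproj imm x) VP) /K E.
rewrite {1}/wedge mulmxBl -!mulmxA !mul_wedge xx ee xe dotrC xe.
by rewrite !scale0r !scale1r subr0 sub0r mulmxN opprD.
Qed.

Lemma normal_span x (v : 'rV[R]_N) : normal f x v ->
  v^T *m v + (v *m K x)^T *m (v *m K x) = dotr v v *: (1%:M - P x).
Proof.
move=> vP; have [xi [eta [on VA E]]] := normal_rot_frame o imm x.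
have [xx ee xe] := on.
have VP : col_mx xi eta *m P x = 0 by rewrite /P /tproj /pinv !mulmxA VA !mul0mx.
have PE := proj_frame (imm.2 x) on VA (tmx_tproj imm x) VP.
have vE : v = dotr v xi *: xi + dotr v eta *: eta.
  rewrite -[LHS]mulmx1 -[1%:M](subrK (P x)) mulmxDr vP addr0 PE mulmxDr !mulmxA.
  by rewrite !mul_row_dotr !mul_scalar_mx.
have vKE : v *m K x = dotr v xi *: eta - dotr v eta *: xi by rewrite /K E mul_wedge.
rewrite vKE PE; set a := dotr v xi in vE *; set b := dotr v eta in vE *.
have -> : dotr v v = a ^+ 2 + b ^+ 2.
  by rewrite {2}vE dotrDr !dotrZr -/a -/b !expr2.
rewrite vE; clearbody a b; clear.
by apply/matrixP => i j; rewrite !mxE !big_ord1 !mxE; ring.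
Qed.

(** Wherever the offset v of a point of the tube from the image is nonzero, v and its rotation
    identify the normal plane with R^2. So the normal planes, pulled back to the tube, can be glued
    to a constant plane outside it, as projections [F] of R^(N+2) over the whole ambient space.
    Scaling by t contracts the image of [f] to the origin, where the fibre no longer depends on
    x. *)
Lemma normal_field_exists : exists n : M -> 'rV[R]_N,
  [/\ smoothM_row n, forall x, n x *m P x = 0 & forall x, n x != 0].
Proof.
have [e [e0 uniq retr]] := tube_exists imm inj cM.
have [Sf rf] := imm; have SP := smoothM_tproj imm; have SK := smooth_normal_rot o imm.
have oT := open_tube_set imm retr.
have algT := smooth_on_algebra oT.
pose tv m1 m2 (B : M -> 'M[R]_(m1, m2)) z : 'M[R]_(m1, m2) :=
  \matrix_(i, j) tube_val f e (fun x => B x i j) z.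
have Stv m1 m2 (B : M -> 'M[R]_(m1, m2)) : salg_mx (@smoothM _ _ M) B ->
    salg_mx (fun h : 'rV[R]_N -> R => smooth_on (tube_set f e) h) (tv _ _ B).
  move=> SB i j; apply: (salg_eq algT (f := tube_val f e (fun x => B x i j))).
    by move=> z _; rewrite mxE.
  exact: (smooth_tube_val imm uniq retr (SB i j)).
have tvE m1 m2 (B : M -> 'M[R]_(m1, m2)) z x : near_pt f e z x -> tv _ _ B z = B x.
  by move=> zx; apply/matrixP => i j; rewrite mxE (tube_valE uniq _ zx).
pose a z := tube_cut f e z.
pose v z := z - tv _ _ f z; pose q z := dotr (v z) (v z); pose D z := a z ^+ 2 + q z.
pose Q z := 1%:M - tv _ _ P z; pose Y z := row_mx (v z)^T (v z *m tv _ _ K z)^T.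
(* Since q / D = 1 - a^2 / D, the projections of [blowup_idem] differ from the constant one by a
   multiple of the cutoff [a]. In this form [F] is smooth across the boundary of the tube. *)
pose G z := block_mx (a z / D z *: Q z) ((D z)^-1 *: Y z) ((D z)^-1 *: (Y z)^T)
  ((- (a z / D z)) *: (1%:M : 'M[R]_(1 + 1))).
pose F z : 'M[R]_(N + (1 + 1)) := block_mx 0 0 0 1%:M + a z *: G z.
have D0 z : tube_set f e z -> D z != 0.
  move=> [x zx]; rewrite /D /q; apply/eqP => E.
  have /eqP : dotr (v z) (v z) = 0.
    by have := sqr_ge0 (a z); have := dotr_ge0 (v z); lra.
  rewrite dotr_eq0 /v (tvE _ _ _ _ _ zx) subr_eq0 => /eqP zE.
  move: E; rewrite /v (tvE _ _ _ _ _ zx) zE subrr /dotr mul0mx mxE addr0 => /eqP.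
  rewrite sqrf_eq0 /a (tube_cut_self e0 uniq) gt_eqF // flat_exp1_gt0.
  by rewrite exprn_gt0 // divr_gt0.
have Sa : smooth_on setT a.
  have := smooth_tube_cutM imm cM e0 uniq retr (salg_cst algT 1).
  by apply: (salg_eq (smooth_on_algebra openT)) => z _; rewrite mulr1.
have SaT := smooth_on_sub (@subsetT _ (tube_set f e)) Sa.
have Sv : salg_mx (fun h : 'rV[R]_N -> R => smooth_on (tube_set f e) h) v.
  by apply: (salg_mxB algT); [move=> i j; rewrite ord1; exact: smooth_on_coord|exact: Stv].
have Sq : smooth_on (tube_set f e) q.
  by apply: (salg_mxM algT Sv); exact: (salg_mxT algT).
have SD : smooth_on (tube_set f e) D.
  by apply: (salgD algT) => //; exact: (salgX algT).
have SDV : smooth_on (tube_set f e) (fun z => (D z)^-1) by exact: (salgV algT D0).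
have SaD : smooth_on (tube_set f e) (fun z => a z / D z) by exact: (salgM algT).
have SY : salg_mx (fun h : 'rV[R]_N -> R => smooth_on (tube_set f e) h) Y.
  apply: (salg_row_mx algT); apply: (salg_mxT algT) => //.
  by apply: (salg_mxM algT) => //; exact: Stv.
have SG : salg_mx (fun h : 'rV[R]_N -> R => smooth_on (tube_set f e) h) G.
  apply: (salg_block_mx algT); apply: (salg_mxZ algT) => //.
  - by apply: (salg_mxB algT); [exact: (salg_mxcst algT)|exact: Stv].
  - exact: (salg_mxT algT).
  - exact: (salgN algT).
  - exact: (salg_mxcst algT).
have SF : salg_mx (fun h : 'rV[R]_N -> R => smooth_on setT h) F.
  have algS := smooth_on_algebra (@openT 'rV[R]_N).
  apply: (salg_mxD algS); first exact: (salg_mxcst algS).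
  move=> i j; apply: (salg_eq algS (f := fun z => a z * G z i j)).
    by move=> z _; rewrite [RHS]mxE.
  exact: (smooth_tube_cutM imm cM e0 uniq retr).
have FE z x : near_pt f e z x -> F z = block_mx (a z ^+ 2 / D z *: Q z)
    (a z / D z *: Y z) (a z / D z *: (Y z)^T) ((q z / D z) *: 1%:M).
  move=> zx; have Dz : D z != 0 by apply: D0; exists x.
  rewrite /F /G scale_block_mx add_block_mx !scalerA !add0r !mulrA -expr2.
  congr block_mx; rewrite -[X in X + _]scale1r -scalerDl; congr (_ *: _).
  by move: Dz; rewrite /D => Dz; field.
have nP z x : near_pt f e z x -> [/\ normal f x (v z), Q z = 1%:M - P x &
    tv _ _ K z = K x].
  by move=> zx; rewrite /v /Q !(tvE _ _ _ _ _ zx); split=> //; case: zx.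
have [P2 PT] : (forall x, P x *m P x = P x) /\ (forall x, (P x)^T = P x).
  by split=> x; [exact: tproj_idem|exact: tr_tproj].
have F2 z : F z *m F z = F z.
  have [[x zx]|out] := pselect (tube_set f e z); last first.
    rewrite /F /a (tube_cut_out out) scale0r addr0 mulmx_block.
    by rewrite !(mul0mx, mulmx0) !addr0 mul1mx add0r.
  rewrite (FE z x zx); have [vn QE KE] := nP z x zx.
  have PvT : P x *m (v z)^T = 0 by rewrite -[P x]PT -trmx_mul vn trmx0.
  have [PK KP] := normal_rot_proj x.
  have PvK : P x *m (v z *m K x)^T = 0 by rewrite -[P x]PT -trmx_mul -mulmxA KP mulmx0 trmx0.
  have QY : Q z *m Y z = Y z.
    by rewrite QE mulmxBl mul1mx /Y KE mul_mx_row PvT PvK row_mx0 subr0.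
  apply: blowup_idem => //; first by apply: D0; exists x.
  - rewrite QE mulmxBl mul1mx mulmxBr mulmx1 P2 subrr subr0 //.
  - have QT : (Q z)^T = Q z by rewrite QE linearB /= trmx1 PT.
    by rewrite -{1}QT -trmx_mul QY.
  - by rewrite /Y KE tr_row_mx !trmxK mul_row_col normal_span // QE.
  - rewrite /Y KE tr_row_mx !trmxK mul_col_row !mul_row_dotr.
    have vvK : dotr (v z) (v z *m K x) = 0.
      by rewrite dotrC; apply: skew_dotr; exact: normal_rot_tr.
    have vKvK : dotr (v z *m K x) (v z *m K x) = q z.
      rewrite dotr_mull normal_rot_tr mulmxN -mulmxA normal_rot_sqr mulmxN opprK.
      by rewrite mulmxBr mulmx1 vn subr0.
    rewrite dotrC in vvK; rewrite vvK dotrC vvK vKvK -/(q z) raddf0.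
    by rewrite -scalar_mx_block scalemx1.
have F0 z : F z != 0.
  apply/eqP => Fz; have [[x zx]|out] := pselect (tube_set f e z); last first.
    move: Fz; rewrite /F /a (tube_cut_out out) scale0r addr0 => /(congr1 drsubmx).
    rewrite block_mxKdr => /matrixP/(_ 0 0)/eqP; rewrite !mxE eqxx mulr1n.
    by rewrite oner_eq0.
  have Dz := D0 z (ex_intro _ x zx); have [vn QE KE] := nP z x zx.
  move: Fz; rewrite (FE z x zx) -(block_mx0 _ N (1 + 1) N (1 + 1)).
  move=> /eq_block_mx[UL _ _ DR].
  have q0 : q z = 0.
    move/matrixP/(_ 0 0)/eqP: DR; rewrite !mxE eqxx mulr1n mulr1 mulf_eq0 invr_eq0.
    by rewrite (negPf Dz) orbF => /eqP.
  move: UL => /eqP; rewrite scaler_eq0 mulf_eq0 invr_eq0 (negPf Dz) orbF.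
  have -> : (a z ^+ 2 == 0) = false.
    by apply/negbTE; apply: contra Dz => /eqP az; rewrite /D az q0 addr0.
  rewrite /= QE subr_eq0 => /eqP P1; have := rank_tproj imm x.
  by rewrite -/(P x) -P1 mxrank1 => /eqP; rewrite -{2}[d]addn0 eqn_add2l.
pose FF x t := F (t *: f x).
have Ft t : salg_mx (@smoothM _ _ M) (FF^~ t).
  move=> i j; apply: (@smoothM_comp _ _ _ _ (fun x => t *: f x) setT (fun z => F z i j)) => //.
    exact: openT.
  by apply: (salg_mxZ alg) => //; exact: (salg_cst alg).
have cFF : continuous (fun w : M * R => FF w.1 w.2).
  have cF : continuous F.
    by apply: continuous_mx => i j z; exact: (Ck_on_continuous (SF i j 0%N) I).
  move=> w; apply: (@continuous_comp _ _ _ (fun w : M * R => w.2 *: f w.1) F); last exact: cF.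
  apply: cvgZ; first exact: cvg_snd.
  by apply: (@continuous_comp _ _ _ fst f); [exact: cvg_fst|exact: smoothM_row_continuous Sf _].
have [w0 w00 w0F] := idem_section (F2 0) (F0 0).
have w0FF x : w0 *m FF x 0 = w0 by rewrite /FF scale0r.
have [w [Sw wF w_neq0]] := transport cM cFF Ft (fun x t => F2 _)
  (w := fun=> w0) (salg_mxcst alg w0) w0FF (fun=> w00).
(* On the image of [f] the offset [v] is [0], so the transported section has only a normal
   component. *)
have wE x : w x = row_mx (lsubmx (w x) *m (1%:M - P x)) 0.
  have zx : near_pt f e (f x) x by exact: near_pt_self.
  rewrite -{1}(wF x) /FF scale1r (FE _ _ zx).
  have [vn QE KE] := nP _ _ zx.
  have v0 : v (f x) = 0 by rewrite /v (tvE _ _ _ _ _ zx) subrr.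
  have q0 : q (f x) = 0 by rewrite /q v0 /dotr mul0mx mxE.
  have Y0 : Y (f x) = 0 by rewrite /Y v0 mul0mx trmx0 row_mx0.
  have Df := D0 _ (ex_intro _ x zx).
  have DE : D (f x) = a (f x) ^+ 2 by rewrite /D q0 addr0.
  rewrite q0 Y0 mul0r !scale0r trmx0 !scaler0 -DE divff // scale1r QE.
  by rewrite -{1}(hsubmxK (w x)) mul_row_block !mulmx0 !addr0.
exists (fun x => lsubmx (w x) *m (1%:M - P x)); split.
- apply: (salg_mxM alg).
    move=> i j; apply: (salg_eq alg (f := fun x => w x i (lshift _ j))) => [x _|]; last exact: Sw.
    by rewrite mxE.
  by apply: (salg_mxB alg) => //; exact: (salg_mxcst alg).
- by move=> x; rewrite -mulmxA mulmxBl mul1mx P2 subrr mulmx0.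
- move=> x; apply/eqP => E; have := w_neq0 x.
  by rewrite wE E row_mx0 eqxx.
Qed.

End NormalField.

(** * Convex integration *)

Section ComplexFunctions.
Context {R : realType}.
Local Notation C := R[i].
Implicit Types z w : C.

Definition nsq z : R := complex.Re z ^+ 2 + complex.Im z ^+ 2.

Lemma nsqM z w : nsq (z * w) = nsq z * nsq w.
Proof. by case: z w => [a b] [c e]; rewrite /nsq /=; ring. Qed.

Lemma nsq_ge0 z : 0 <= nsq z.
Proof. by rewrite addr_ge0 // sqr_ge0. Qed.

Lemma nsq_eq0 z : (nsq z == 0) = (z == 0).
Proof. by case: z => a b; rewrite /nsq paddr_eq0 ?sqr_ge0 // !sqrf_eq0 eq_complex. Qed.

Lemma nsq_conj z : nsq (conjc z) = nsq z.
Proof. by case: z => a b; rewrite /nsq /= sqrrN. Qed.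

Lemma mul_conjc z : z * conjc z = (nsq z)%:C%C.
Proof. by case: z => a b; rewrite /nsq; apply/eqP; rewrite eq_complex /=; apply/andP; split; apply/eqP; ring. Qed.

Context {X : Type} {D : set X} {S : (X -> R) -> Prop} (alg : smooth_algebra D S).
Implicit Types f g : X -> C.

Definition salg_c f : Prop :=
  S (fun x => complex.Re (f x)) /\ S (fun x => complex.Im (f x)).

Lemma salg_cc (c : C) : salg_c (fun=> c).
Proof. by split; exact: (salg_cst alg). Qed.

Lemma salg_cR (h : X -> R) : S h -> salg_c (fun x => (h x)%:C%C).
Proof. by split=> //; exact: (salg_cst alg). Qed.

Lemma salg_cD f g : salg_c f -> salg_c g -> salg_c (fun x => f x + g x).
Proof.
move=> [f1 f2] [g1 g2]; split.
  apply: (salg_eq alg (f := fun x => complex.Re (f x) + complex.Re (g x))); last exact: (salgD alg).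
  by move=> x _; case: (f x); case: (g x).
apply: (salg_eq alg (f := fun x => complex.Im (f x) + complex.Im (g x))); last exact: (salgD alg).
by move=> x _; case: (f x); case: (g x).
Qed.

Lemma salg_cM f g : salg_c f -> salg_c g -> salg_c (fun x => f x * g x).
Proof.
move=> [f1 f2] [g1 g2]; split.
  apply: (salg_eq alg (f := fun x => complex.Re (f x) * complex.Re (g x) -
    complex.Im (f x) * complex.Im (g x))); last by apply: (salgB alg); exact: (salgM alg).
  by move=> x _; case: (f x); case: (g x).
apply: (salg_eq alg (f := fun x => complex.Re (f x) * complex.Im (g x) +
    complex.Im (f x) * complex.Re (g x))); last by apply: (salgD alg); exact: (salgM alg).
by move=> x _; case: (f x); case: (g x).
Qed.

Lemma salg_cN f : salg_c f -> salg_c (fun x => - f x).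
Proof.
by move=> [f1 f2]; split; [move/(salgN alg): f1|move/(salgN alg): f2];
  apply: (salg_eq alg) => x _; case: (f x).
Qed.

Lemma salg_cJ f : salg_c f -> salg_c (fun x => conjc (f x)).
Proof.
move=> [f1 f2]; split; first by move: f1; apply: (salg_eq alg) => x _; case: (f x).
by move/(salgN alg): f2; apply: (salg_eq alg) => x _; case: (f x).
Qed.

Lemma salg_nsq f : salg_c f -> S (fun x => nsq (f x)).
Proof. by move=> [f1 f2]; apply: (salgD alg); exact: (salgX alg). Qed.

Lemma salg_cV f : (forall x, D x -> f x != 0) -> salg_c f ->
  salg_c (fun x => (f x)^-1).
Proof.
move=> f0 Sf; have SV : S (fun x => (nsq (f x))^-1).
  by apply: (salgV alg); [move=> x Dx; rewrite nsq_eq0 f0|exact: salg_nsq].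
have := salg_cM (salg_cJ Sf) (salg_cR SV).
have E x : D x -> conjc (f x) * ((nsq (f x))^-1)%:C%C = (f x)^-1.
  move=> Dx; have fx := f0 x Dx; apply: (mulfI fx).
  rewrite mulfV // mulrA mul_conjc -rmorphM mulfV ?nsq_eq0 //.
by move=> [h1 h2]; split; [move: h1|move: h2]; apply: (salg_eq alg) => x Dx; rewrite E.
Qed.

End ComplexFunctions.

Arguments salg_c {R X} S f.

(** * Loops with prescribed mean that avoid one complex value *)

Section Loop.
Context {R : realType}.
Local Notation C := R[i].
Variables (e q : C).

Definition loop_t := q * e.
Definition loop_rho : R := 1 + nsq (1 - loop_t).
(** Scaled so that [3 * loop_b ^+ 2] is t^2 / rho, with rho = 1 + |1 - t|^2. As |t|^2 is at most 2
    rho, |b|^2 is at most 2/3. *)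
Definition loop_sigma : R := (Num.sqrt (3 * loop_rho))^-1.
(** This is (1 - t^2 / rho) / (1 - t) written without the division, using (1 - t) conj(1 - t) = rho
    - 1. At t = 1 the product in the comment on [loop] must have mean 0. Its third power allows
    this, whereas (1 - b / z) (1 + b z) has mean 1 - b^2, which is nonzero for |b| < 1. *)
Definition loop_G : C :=
  1 + loop_t + loop_t ^+ 2 * conjc (1 - loop_t) * (loop_rho^-1)%:C%C.
Definition loop_s : C := q * loop_sigma%:C%C.
Definition loop_b : C := loop_t * loop_sigma%:C%C.
Definition loop_gm : C := - (loop_G^-1 * loop_s).
Definition loop_g1 : C := loop_G^-1 * ((3 - 3 * loop_b ^+ 2) * loop_s).
Definition loop_g2 : C := loop_G^-1 * ((3 * loop_b - loop_b ^+ 3) * loop_s).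
Definition loop_g3 : C := loop_G^-1 * (loop_b ^+ 2 * loop_s).

(* A loop with mean [0] along which [1 + e * (loop - q)] does not vanish: up to
   the factor [loop_G^-1], that function is [(1 - b / z) * (1 + b * z) ^+ 3] with
   [|b| < 1], whose mean [1 - 3 * b ^+ 2] is [loop_G * (1 - q * e)]. *)
Definition loop (z : C) : C :=
  loop_gm * conjc z + loop_g1 * z + loop_g2 * z ^+ 2 + loop_g3 * z ^+ 3.

Lemma loop_rho_ge1 : 1 <= loop_rho.
Proof. by rewrite /loop_rho lerDl nsq_ge0. Qed.

Lemma loop_rho_gt0 : 0 < loop_rho.
Proof. exact: lt_le_trans ltr01 loop_rho_ge1. Qed.

Lemma loop_sigma_sqr : 3 * loop_rho * loop_sigma ^+ 2 = 1.
Proof.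
have r0 : 0 < 3 * loop_rho by rewrite mulr_gt0 // loop_rho_gt0.
by rewrite /loop_sigma exprVn sqr_sqrtr ?ltW // mulfV // gt_eqF.
Qed.

Lemma loop_nsq_b : nsq loop_b < 1.
Proof.
rewrite /loop_b nsqM.
have -> : nsq (loop_sigma%:C)%C = loop_sigma ^+ 2 by rewrite /nsq /= expr0n addr0.
have le2 : nsq loop_t <= 2 * loop_rho.
  rewrite /loop_rho /nsq; case: loop_t => a b /=.
  have := sqr_ge0 (a - 2); have := sqr_ge0 b; nra.
have s0 : 0 <= loop_sigma ^+ 2 by exact: sqr_ge0.
have := loop_sigma_sqr; have : nsq loop_t * loop_sigma ^+ 2 <= 2 * loop_rho * loop_sigma ^+ 2.
  exact: ler_wpM2r.
by move: (loop_sigma ^+ 2) => s; nra.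
Qed.

Lemma loop_mean : loop_G * (1 - loop_t) = 1 - 3 * loop_b ^+ 2.
Proof.
have -> : 3 * loop_b ^+ 2 = loop_t ^+ 2 * (loop_rho^-1)%:C%C :> C.
  rewrite /loop_b exprMn mulrCA; congr (_ * _).
  have r0 := gt_eqF loop_rho_gt0.
  have -> : loop_rho^-1 = 3 * loop_sigma ^+ 2.
    by apply: (mulfI (negbT r0)); rewrite mulfV ?r0 // mulrA (mulrC _ 3) loop_sigma_sqr.
  by rewrite rmorphM rmorphXn /=; congr (_ * _); rewrite rmorph_nat.
have tt : (1 - loop_t) * conjc (1 - loop_t) = loop_rho%:C%C - 1.
  rewrite mul_conjc /loop_rho; move: (nsq _) => r; apply/eqP; rewrite eq_complex /=.
  by apply/andP; split; apply/eqP; ring.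
have rr : (loop_rho^-1)%:C%C * loop_rho%:C%C = 1 :> C.
  by rewrite -rmorphM mulVf ?gt_eqF ?loop_rho_gt0.
rewrite /loop_G; move: (loop_rho^-1)%:C%C (loop_rho%:C)%C (conjc _) tt rr => u r s tt rr.
rewrite (_ : (1 + loop_t + loop_t ^+ 2 * s * u) * (1 - loop_t) =
  1 - loop_t ^+ 2 + loop_t ^+ 2 * u * ((1 - loop_t) * s)); last by ring.
rewrite tt (_ : 1 - _ + _ * (r - 1) = 1 - loop_t ^+ 2 + loop_t ^+ 2 * (u * r) - loop_t ^+ 2 * u); last by ring.
by rewrite rr; ring.
Qed.

(** If it vanished, t^2 would be the positive real number rho; then t is real, and t^2 = 1 + (1 -
    t)^2 gives t = 1, where the value is 2. *)
Lemma loop_G_neq0 : loop_G != 0.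
Proof.
apply/eqP => G0; have := loop_mean; rewrite G0 mul0r => /esym/eqP.
have -> : 1 - 3 * loop_b ^+ 2 = 1 - loop_t ^+ 2 * (loop_rho^-1)%:C%C.
  rewrite /loop_b exprMn mulrCA; congr (1 - _ * _).
  have r0 := gt_eqF loop_rho_gt0.
  have -> : loop_rho^-1 = 3 * loop_sigma ^+ 2.
    by apply: (mulfI (negbT r0)); rewrite mulfV ?r0 // mulrA (mulrC _ 3) loop_sigma_sqr.
  by rewrite rmorphM rmorphXn /=; congr (_ * _); rewrite rmorph_nat.
rewrite subr_eq0 eq_sym => /eqP E.
have {}E : loop_t ^+ 2 = loop_rho%:C%C.
  have rr : (loop_rho^-1)%:C%C * loop_rho%:C%C = 1 :> C.
    by rewrite -rmorphM mulVf ?gt_eqF ?loop_rho_gt0.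
  by rewrite -[LHS]mulr1 -rr mulrA E mul1r.
have t1 : loop_t = 1.
  move: E; have := loop_rho_gt0; rewrite /loop_rho /nsq; case: loop_t => a b /=.
  move=> r0 /eqP; rewrite expr2 eq_complex /= => /andP[/eqP E1 /eqP E2].
  have /eqP : a * b = 0 by lra.
  rewrite mulf_eq0 => /orP[] /eqP z0; last first.
    by rewrite z0 in E1 *; apply/eqP; rewrite eq_complex /= eqxx andbT; apply/eqP; nra.
  have F : False by move: E1; rewrite z0 => {G0 r0 E2} E1; nra.
  by case: F.
move/eqP: G0; rewrite /loop_G t1 expr1n subrr conjc0 !(mulr0, mul0r, addr0).
by rewrite -[1 + 1]/(2%:R) pnatr_eq0.
Qed.

Lemma loop_avoid z : nsq z = 1 -> 1 + e * (loop z - q) != 0.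
Proof.
move=> z1; have zz : z * conjc z = 1 by rewrite mul_conjc z1.
have G0 := loop_G_neq0.
suff E : loop_G * (1 + e * (loop z - q)) = (1 - loop_b * conjc z) * (1 + loop_b * z) ^+ 3.
  have b1 := loop_nsq_b.
  have neq w : nsq w = 1 -> 1 + loop_b * w != 0.
    move=> w1; apply/eqP => /eqP; rewrite addr_eq0 => /eqP F.
    have : nsq (loop_b * w) = 1.
      rewrite -[loop_b * w]opprK -F; rewrite /nsq /= sqrrN expr1n oppr0 expr0n addr0 //.
    by rewrite nsqM w1 mulr1; lra.
  apply/eqP => F; move: E; rewrite F mulr0 => /esym/eqP.
  rewrite mulf_eq0 expf_eq0 /= (negPf (neq z z1)) orbF.
  rewrite -mulrN; apply/negP; apply: neq.
  by rewrite -z1 -(nsq_conj z) /nsq; case: (conjc z) => a b /=; rewrite !sqrrN.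
have eb : e * loop_s = loop_b by rewrite /loop_s /loop_b /loop_t; ring.
have GV : loop_G * loop_G^-1 = 1 by rewrite mulfV.
rewrite (_ : loop_G * _ = loop_G * (1 - loop_t) + loop_G * loop_G^-1 *
  (e * loop_s) * (- conjc z + (3 - 3 * loop_b ^+ 2) * z + (3 * loop_b - loop_b ^+ 3) * z ^+ 2
   + loop_b ^+ 2 * z ^+ 3)); last first.
  by rewrite /loop /loop_gm /loop_g1 /loop_g2 /loop_g3 /loop_t; ring.
rewrite loop_mean GV mul1r eb; move: (conjc z) zz => w zz.
rewrite (_ : (1 - loop_b * w) * (1 + loop_b * z) ^+ 3 =
  (1 + loop_b * z) ^+ 3 - loop_b * w - 3 * loop_b ^+ 2 * (z * w)
  - 3 * loop_b ^+ 3 * z * (z * w) - loop_b ^+ 4 * z ^+ 2 * (z * w)); last by ring.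
by rewrite zz; ring.
Qed.

End Loop.

Lemma loop_q0 (R : realType) (e z : R[i]) : loop e 0 z = 0.
Proof.
rewrite /loop /loop_gm /loop_g1 /loop_g2 /loop_g3 /loop_s !mul0r !mulr0 oppr0.
by rewrite !mul0r !addr0.
Qed.

Lemma add5_eq0 (R : realType) (a b c d e : R) :
  0 <= a -> 0 <= b -> 0 <= c -> 0 <= d -> 0 <= e -> a + b + (c + d) + e = 0 ->
  [/\ a = 0, b = 0, c = 0, d = 0 & e = 0].
Proof. by move=> *; split; lra. Qed.

(** * Degenerate values of a rank-one perturbation *)

Section GramJ.
Context {R : realType} {N : nat}.
Variable (J : 'M[R]_N).
Hypothesis (J2 : J *m J = - 1%:M).
Implicit Types (X A B : 'M[R]_N) (k a : 'cV[R]_N) (xi eta : 'rV[R]_N).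

(** Its invertibility says that the rows of [X] and [X *m J] span the whole space ([gramJ_full]),
    and it is an open condition on a matrix depending smoothly on [X]. *)
Definition gramJ X : 'M[R]_N := X^T *m X + (X *m J)^T *m (X *m J).

Lemma col_sqr_eq0 m (c : 'cV[R]_m) : ((c^T *m c) 0 0 == 0) = (c == 0).
Proof.
have -> : (c^T *m c) 0 0 = dotr c^T c^T by rewrite /dotr trmxK.
by rewrite dotr_eq0; apply/eqP/eqP => [/(congr1 trmx)|->]; rewrite ?trmxK trmx0.
Qed.

Lemma col_sqr_ge0 m (c : 'cV[R]_m) : 0 <= (c^T *m c) 0 0.
Proof.
have -> : (c^T *m c) 0 0 = dotr c^T c^T by rewrite /dotr trmxK.
exact: dotr_ge0.
Qed.

Lemma unit_colP (W : 'M[R]_N) : W \in unitmx <-> forall k, W *m k = 0 -> k = 0.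
Proof.
split=> [uW k E|H]; first by rewrite -[k](mulKmx uW) E mulmx0.
rewrite -unitmx_tr -row_free_unit; apply/inj_row_free => v E.
apply: (@trmx_inj _ _ _); rewrite trmx0; apply: H.
by rewrite -[LHS]trmxK trmx_mul trmxK E trmx0.
Qed.

Lemma gramJ_apply X k :
  gramJ X *m k = X^T *m (X *m k) + (X *m J)^T *m (X *m (J *m k)).
Proof. by rewrite /gramJ mulmxDl !mulmxA. Qed.

Lemma gramJ_unitP X : gramJ X \in unitmx <->
  forall k, X *m k = 0 -> X *m J *m k = 0 -> k = 0.
Proof.
split=> [/unit_colP H k E1 E2|H].
  by apply: H; rewrite /gramJ mulmxDl -!mulmxA E1 (mulmxA X) E2 !mulmx0 addr0.
apply/unit_colP => k E.
have : (k^T *m (gramJ X *m k)) 0 0 = 0 by rewrite E mulmx0 mxE.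
have -> : k^T *m (gramJ X *m k) =
    (X *m k)^T *m (X *m k) + (X *m J *m k)^T *m (X *m J *m k).
  by rewrite /gramJ mulmxDl mulmxDr !trmx_mul !mulmxA.
rewrite mxE => F.
have := col_sqr_ge0 (X *m k); have := col_sqr_ge0 (X *m J *m k) => g1 g2.
by apply: H; apply/eqP; rewrite -col_sqr_eq0; apply/eqP; lra.
Qed.

Lemma gramJ_full m (Y : 'M[R]_(m, N)) X : (X == Y)%MS ->
  gramJ X \in unitmx <-> row_full (Y + Y *m J)%MS.
Proof.
move=> /eqmxP XY.
have -> : row_full (Y + Y *m J)%MS = row_full (col_mx X (X *m J)).
  rewrite -!sub1mx; apply/idP/idP => H; apply: (submx_trans H);
    by rewrite -addsmxE addsmxS // ?submxMr // XY.
split=> [/gramJ_unitP H|/row_fullP[Z ZX]].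
  rewrite /row_full -mxrank_tr; apply/row_freeP/row_freeP.
  apply/inj_row_free => v E; apply: (@trmx_inj _ _ _); rewrite trmx0.
  have {}E : col_mx X (X *m J) *m v^T = 0.
    by rewrite -[LHS]trmxK trmx_mul trmxK E trmx0.
  move: E; rewrite mul_col_mx -(col_mx0 _ N N) => /eq_col_mx[E1 E2]; exact: H.
apply/gramJ_unitP => k E1 E2.
by rewrite -[k]mul1mx -ZX -mulmxA mul_col_mx E1 E2 col_mx0 mulmx0.
Qed.

Section Degenerate.
Variables (A B P : 'M[R]_N) (a : 'cV[R]_N) (xi eta : 'rV[R]_N) (kap : R).
Hypotheses (PE : 1%:M - P = xi^T *m xi + eta^T *m eta).
Hypotheses (PA : P *m A = A) (uT : A *m P + (1%:M - P) \in unitmx).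
Hypotheses (uB : B \in unitmx) (good : gramJ (A *m B) \in unitmx).
Hypotheses (kap0 : 0 <= kap) (kap_a : kap = 0 -> a != 0).

Let X := A *m B.
(** If [A - a c] degenerates, there is a vector k with [X *m k = a] and [X *m J *m k = 0], and the
    normal equations determine it as [k0]. The numbers [m1], [m2] and [n1], [n2] are the components
    along [xi] and [eta] of B k0 and B J k0. *)
Let k0 := invmx (gramJ X) *m (X^T *m a).
Let m1 : R := (xi *m (B *m k0)) 0 0.
Let m2 : R := (eta *m (B *m k0)) 0 0.
Let n1 : R := (xi *m (B *m (J *m k0))) 0 0.
Let n2 : R := (eta *m (B *m (J *m k0))) 0 0.
Let r1 := X *m k0 - a.
Let r2 := X *m J *m k0.

(** When a degenerate value exists and [kap] is 0, the residuals [r1] and [r2] vanish and this is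
    n1^2 + n2^2. The added squares and [kap] keep it nonzero at all other points, so [deg_eps] is
    smooth everywhere. *)
Definition deg_den : R :=
  n1 ^+ 2 + n2 ^+ 2 + ((r1^T *m r1) 0 0 + (r2^T *m r2) 0 0) + kap.

(* The reciprocal of the only value of [c] for which [A - a c] can degenerate. *)
Definition deg_eps : R[i] :=
  Complex ((m1 * n2 - m2 * n1) * n2 / deg_den) ((m1 * n2 - m2 * n1) * n1 / deg_den).

(** If every term vanishes, w = B J k0 satisfies P w = w and A w = 0, so the invertibility of the
    tangential part of [A] gives k0 = 0. Then r1 = 0 reads a = 0, which [kap = 0] excludes. *)
Lemma deg_den_neq0 : deg_den != 0.
Proof.
apply/eqP; rewrite /deg_den => E.
have [/eqP n10 /eqP n20 /eqP r10 /eqP r20 k00] := add5_eq0 (sqr_ge0 n1) (sqr_ge0 n2)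
  (col_sqr_ge0 r1) (col_sqr_ge0 r2) kap0 E.
move: n10 n20 r10 r20; rewrite !sqrf_eq0 !col_sqr_eq0.
move=> /eqP n10 /eqP n20 /eqP r10 /eqP r20.
set w := B *m (J *m k0).
have w0 (u : 'rV[R]_N) : (u *m w) 0 0 = 0 -> u *m w = 0.
  by move=> F; apply/matrixP => i j; rewrite !ord1 F mxE.
have Pw : P *m w = w.
  apply/eqP; rewrite -subr_eq0 -opprB oppr_eq0 -{1}[w]mul1mx -mulmxBl PE mulmxDl.
  by rewrite -!mulmxA (w0 _ n10) (w0 _ n20) !mulmx0 addr0.
have Aw : A *m w = 0 by rewrite /w (mulmxA A B) (mulmxA _ J); exact: r20.
have {}w0 : w = 0.
  apply: ((unit_colP _).1 uT); rewrite mulmxDl mulmxBl mul1mx -mulmxA Pw Aw.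
  by rewrite subrr addr0.
have k00' : k0 = 0.
  have : J *m k0 = 0 by rewrite -[LHS](mulKmx uB) -/w w0 mulmx0.
  by move/(congr1 (mulmx J)); rewrite mulmxA J2 mulNmx mul1mx mulmx0 => /eqP; rewrite oppr_eq0 => /eqP.
have := kap_a k00; move: r10; rewrite /r1 k00' mulmx0 sub0r => /eqP.
by rewrite oppr_eq0 => ->.
Qed.

(** Evaluating c on B k0 and B J k0 gives the equations c1 m1 + c2 m2 = 1 and c1 n1 + c2 n2 = 0.
    Their only solution, read as the complex number c1 + i c2, is the inverse of [deg_eps]. *)
Lemma deg_epsP (c1 c2 : R) : kap = 0 ->
  gramJ ((A - a *m (c1 *: xi + c2 *: eta)) *m B) \notin unitmx ->
  deg_eps * Complex c1 c2 = 1.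
Proof.
move=> k00 bad; have a0 := kap_a k00; have d0 := deg_den_neq0.
pose cn := c1 *: xi + c2 *: eta.
have [k [kn [E1 E2]]] : exists k, k != 0 /\ (A - a *m cn) *m B *m k = 0 /\
    (A - a *m cn) *m B *m J *m k = 0.
  apply: contrapT => H; move/negP: bad; apply; apply/gramJ_unitP => k E1 E2.
  by apply/eqP; apply: contrapT => kn; apply: H; exists k; split => //; exact/negP.
pose phi (z : 'cV[R]_N) := (cn *m (B *m z)) 0 0.
have step z : (A - a *m cn) *m B *m z = 0 -> X *m z = phi z *: a.
  rewrite /X !mulmxBl => /eqP; rewrite subr_eq0 => /eqP ->.
  rewrite -!mulmxA [cn *m _]mx11_scalar -/(phi z); exact: mul_mx_scalar.
pose x := phi k; pose y := phi (J *m k).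
have X1 : X *m k = x *: a by exact: step.
have X2 : X *m (J *m k) = y *: a by apply: step; rewrite mulmxA.
have JJk : J *m (J *m k) = - k by rewrite mulmxA J2 mulNmx mul1mx.
have xy0 : x ^+ 2 + y ^+ 2 != 0.
  apply/eqP => xy; have x0 : x = 0 by apply/eqP; rewrite -sqrf_eq0; apply/eqP; nra.
  have y0 : y = 0 by apply/eqP; rewrite -sqrf_eq0; apply/eqP; nra.
  move/eqP: kn; apply; apply: ((gramJ_unitP X).1 good).
    by rewrite X1 x0 scale0r.
  by rewrite -mulmxA X2 y0 scale0r.
pose s := (x ^+ 2 + y ^+ 2)^-1.
(* [X] sends k and J k to x a and y a. This combination, still killed by the degenerate map together
   with its image under [J], is normalized so that the two multiples become 1 and 0. *)
pose k' := s *: (x *: k + y *: (J *m k)).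
have Xk' : X *m k' = a.
  rewrite /k' -scalemxAr mulmxDr -!scalemxAr X1 X2 !scalerA -scalerDl scalerA.
  by rewrite -!expr2 /s mulVf // scale1r.
have Jk' : J *m k' = s *: (x *: (J *m k) - y *: k).
  by rewrite /k' -scalemxAr mulmxDr -!scalemxAr JJk scalerN.
have XJk' : X *m (J *m k') = 0.
  rewrite Jk' -scalemxAr mulmxBr -!scalemxAr X1 X2 !scalerA (mulrC y x) subrr.
  by rewrite scaler0.
have k'0 : k' = k0.
  rewrite /k0 -[LHS](mulKmx good); congr (_ *m _).
  by rewrite gramJ_apply Xk' XJk' mulmx0 addr0.
have pk : (A - a *m cn) *m B *m k' = 0.
  by rewrite /k' -scalemxAr mulmxDr -!scalemxAr E1 (mulmxA _ J) E2 !scaler0 addr0 scaler0.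
have pJk : (A - a *m cn) *m B *m (J *m k') = 0.
  by rewrite Jk' -scalemxAr mulmxBr -!scalemxAr E1 (mulmxA _ J) E2 !scaler0 subr0 scaler0.
have a1 (z : R) : z *: a = a -> z = 1.
  move/eqP; rewrite -subr_eq0 -{2}[a]scale1r -scalerBl scaler_eq0 (negPf a0) orbF.
  by rewrite subr_eq0 => /eqP.
have h1 : c1 * m1 + c2 * m2 = 1.
  have := step _ pk; rewrite Xk' => /esym/a1.
  by rewrite /phi k'0 /cn mulmxDl -!scalemxAl mxE [X in X + _]mxE [X in _ + X]mxE.
have h2 : c1 * n1 + c2 * n2 = 0.
  have := step _ pJk; rewrite XJk' => /esym/eqP; rewrite scaler_eq0 (negPf a0) orbF.
  by rewrite /phi k'0 /cn mulmxDl -!scalemxAl mxE [X in X + _]mxE [X in _ + X]mxE => /eqP.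
have den : deg_den = n1 ^+ 2 + n2 ^+ 2.
  rewrite /deg_den /r1 /r2 -(mulmxA X) -k'0 Xk' XJk' subrr k00 trmx0 !mul0mx !mxE.
  by rewrite !addr0.
apply/eqP; rewrite /deg_eps eq_complex /=; apply/andP; split; apply/eqP.
  have -> : (m1 * n2 - m2 * n1) * n2 / deg_den * c1 - (m1 * n2 - m2 * n1) * n1 / deg_den * c2
    = ((m1 * n2 - m2 * n1) * (n2 * c1 - n1 * c2)) / deg_den by field.
  apply: (mulIf d0); rewrite mulfVK // mul1r den.
  have -> : (m1 * n2 - m2 * n1) * (n2 * c1 - n1 * c2) =
    (c1 * m1 + c2 * m2) * (n1 ^+ 2 + n2 ^+ 2) -
    (c1 * n1 + c2 * n2) * (m1 * n1 + m2 * n2) by ring.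
  by rewrite h1 h2 mul1r mul0r subr0.
have -> : (m1 * n2 - m2 * n1) * n2 / deg_den * c2 + (m1 * n2 - m2 * n1) * n1 / deg_den * c1
  = (m1 * n2 - m2 * n1) * (c1 * n1 + c2 * n2) / deg_den by field.
by rewrite h2 mulr0 mul0r.
Qed.

(** Where [kap] is nonzero, q = 0 makes the loop identically 0 and nothing changes. Elsewhere
    [loop_avoid] says that the loop misses the only degenerate value. *)
Lemma loop_good (q z : R[i]) : (kap != 0 -> q = 0) -> nsq z = 1 ->
  let g := loop deg_eps q z - q in
  gramJ ((A + a *m (complex.Re g *: xi + complex.Im g *: eta)) *m B) \in unitmx.
Proof.
move=> kq z1 /=; set g := loop _ _ _ - q; have [k00|k0'] := eqVneq kap 0; last first.
  by rewrite /g (kq k0') loop_q0 subr0 !scale0r addr0 mulmx0 addr0.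
apply: contraT => bad.
have E : deg_eps * Complex (- complex.Re g) (- complex.Im g) = 1.
  apply: deg_epsP => //; move: bad; rewrite !scaleNr -opprD mulmxN opprK //.
have := loop_avoid deg_eps q z1; rewrite -/g.
have -> : 1 + deg_eps * g = 1 - deg_eps * Complex (- complex.Re g) (- complex.Im g).
  have -> : Complex (- complex.Re g) (- complex.Im g) = - g by case: (g).
  by rewrite mulrN opprK.
by rewrite E subrr eqxx.
Qed.

End Degenerate.
End GramJ.

Section LoopSmooth.
Context {R : realType} {X : Type} {D : set X} {S : (X -> R) -> Prop}.
Hypothesis alg : smooth_algebra D S.
Variables (e q : X -> R[i]).
Hypotheses (Se : salg_c S e) (Sq : salg_c S q).

Lemma salg_loop_t : salg_c S (fun x => loop_t (e x) (q x)).
Proof. exact: (salg_cM alg). Qed.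

Lemma salg_loop_rho : S (fun x => loop_rho (e x) (q x)).
Proof.
apply: (salgD alg); first exact: (salg_cst alg).
apply: (salg_nsq alg); apply: (salg_cD alg); first exact: (salg_cc alg).
by apply: (salg_cN alg); exact: salg_loop_t.
Qed.

Lemma salg_loop_sigma : S (fun x => loop_sigma (e x) (q x)).
Proof.
have r0 x : 0 < 3 * loop_rho (e x) (q x) by rewrite mulr_gt0 // loop_rho_gt0.
apply: (salgV alg) => [x _|]; first by rewrite gt_eqF // sqrtr_gt0.
apply: (salg_comp1 alg smooth_sqrt) => [x _|]; first exact: r0.
by apply: (salgM alg); [exact: (salg_cst alg)|exact: salg_loop_rho].
Qed.

Lemma salg_loop_G : salg_c S (fun x => (loop_G (e x) (q x))^-1).
Proof.
apply: (salg_cV alg) => [x _|]; first exact: loop_G_neq0.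
have St := salg_loop_t.
apply: (salg_cD alg); first by apply: (salg_cD alg) => //; exact: (salg_cc alg).
apply: (salg_cM alg); last first.
  apply: (salg_cR alg); apply: (salgV alg) => [x _|]; last exact: salg_loop_rho.
  by rewrite gt_eqF // loop_rho_gt0.
apply: (salg_cM alg); first exact: (salg_cM alg).
apply: (salg_cJ alg); apply: (salg_cD alg); first exact: (salg_cc alg).
exact: (salg_cN alg).
Qed.

Lemma salg_loop_s : salg_c S (fun x => loop_s (e x) (q x)).
Proof. by apply: (salg_cM alg) => //; apply: (salg_cR alg); exact: salg_loop_sigma. Qed.

Lemma salg_loop_b : salg_c S (fun x => loop_b (e x) (q x)).
Proof.
by apply: (salg_cM alg); [exact: salg_loop_t|apply: (salg_cR alg); exact: salg_loop_sigma].
Qed.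

Lemma salg_loop_coef :
  [/\ salg_c S (fun x => loop_gm (e x) (q x)), salg_c S (fun x => loop_g1 (e x) (q x)),
      salg_c S (fun x => loop_g2 (e x) (q x)) & salg_c S (fun x => loop_g3 (e x) (q x))].
Proof.
have [SG Ss Sb] := And3 salg_loop_G salg_loop_s salg_loop_b.
have Sbb : salg_c S (fun x => loop_b (e x) (q x) ^+ 2) by exact: (salg_cM alg).
have Sc c : salg_c S (fun=> c) := salg_cc alg c.
split.
- by apply: (salg_cN alg); exact: (salg_cM alg).
- apply: (salg_cM alg) => //; apply: (salg_cM alg) => //; apply: (salg_cD alg) => //.
  by apply: (salg_cN alg); exact: (salg_cM alg).
- apply: (salg_cM alg) => //; apply: (salg_cM alg) => //; apply: (salg_cD alg).
    exact: (salg_cM alg).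
  by apply: (salg_cN alg); apply: (salg_cM alg).
- by apply: (salg_cM alg) => //; exact: (salg_cM alg).
Qed.

End LoopSmooth.

Section DegSmooth.
Context {R : realType} {X : Type} {D : set X} {S : (X -> R) -> Prop}.
Hypothesis alg : smooth_algebra D S.

Lemma salg_gramJ N (J : 'M[R]_N) (A : X -> 'M[R]_N) : salg_mx S A ->
  salg_mx S (fun x => gramJ J (A x)).
Proof.
move=> SA; have SAJ : salg_mx S (fun x => A x *m J).
  by apply: (salg_mxM alg) => //; exact: (salg_mxcst alg).
by apply: (salg_mxD alg); apply: (salg_mxM alg) => //; exact: (salg_mxT alg).
Qed.

Lemma salg_deg_eps N (J : 'M[R]_N) (A B : X -> 'M[R]_N) (a : X -> 'cV[R]_N)
    (xi eta : X -> 'rV[R]_N) (kap : X -> R) :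
  (forall x, gramJ J (A x *m B x) \in unitmx) ->
  (forall x, deg_den J (A x) (B x) (a x) (xi x) (eta x) (kap x) != 0) ->
  salg_mx S A -> salg_mx S B -> salg_mx S a -> salg_mx S xi -> salg_mx S eta -> S kap ->
  salg_c S (fun x => deg_eps J (A x) (B x) (a x) (xi x) (eta x) (kap x)).
Proof.
move=> good den SA SB Sa Sxi Seta Sk.
have SX : salg_mx S (fun x => A x *m B x) by exact: (salg_mxM alg).
have Sc m n (E : 'M[R]_(m, n)) : salg_mx S (fun=> E) := salg_mxcst alg E.
pose k0 x := invmx (gramJ J (A x *m B x)) *m ((A x *m B x)^T *m a x).
have Sk0 : salg_mx S k0.
  apply: (salg_mxM alg); first by apply: (salg_mxV alg) => //; exact: salg_gramJ.
  by apply: (salg_mxM alg) => //; exact: (salg_mxT alg).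
have SB0 : salg_mx S (fun x => B x *m k0 x) by exact: (salg_mxM alg).
have SB1 : salg_mx S (fun x => B x *m (J *m k0 x)).
  by apply: (salg_mxM alg) => //; exact: (salg_mxM alg).
have Sm (u : X -> 'rV[R]_N) (w : X -> 'cV[R]_N) : salg_mx S u -> salg_mx S w ->
    S (fun x => (u x *m w x) 0 0).
  by move=> Su Sw; exact: (salg_mxM alg Su Sw).
have S1 : salg_mx S (fun x => A x *m B x *m k0 x - a x).
  by apply: (salg_mxB alg) => //; exact: (salg_mxM alg).
have S2 : salg_mx S (fun x => A x *m B x *m J *m k0 x).
  by apply: (salg_mxM alg) => //; exact: (salg_mxM alg).
have Sden : S (fun x => (deg_den J (A x) (B x) (a x) (xi x) (eta x) (kap x))^-1).
  apply: (salgV alg) => [x _|]; first exact: den.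
  apply: (salgD alg) => //; apply: (salgD alg); apply: (salgD alg).
  - by apply: (salgX alg); exact: Sm.
  - by apply: (salgX alg); exact: Sm.
  - by apply: Sm => //; exact: (salg_mxT alg).
  - by apply: Sm => //; exact: (salg_mxT alg).
have SD : S (fun x => (xi x *m (B x *m k0 x)) 0 0 * (eta x *m (B x *m (J *m k0 x))) 0 0 -
    (eta x *m (B x *m k0 x)) 0 0 * (xi x *m (B x *m (J *m k0 x))) 0 0).
  by apply: (salgB alg); apply: (salgM alg); exact: Sm.
split; apply: (salgM alg) => //; apply: (salgM alg) => //; exact: Sm.
Qed.

End DegSmooth.

(** * Oscillating corrections and their derivatives *)

Section Oscillation.
Context {R : realType}.
Local Notation C := R[i].

(* The real and imaginary parts of [z, z ^+ 2, z ^+ 3] at [z = u + i v]. *)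
Definition osc (i : nat) (u v : R) : R :=
  nth 0 [:: u; v; u ^+ 2 - v ^+ 2; 2 * u * v; u ^+ 3 - 3 * u * v ^+ 2;
            3 * u ^+ 2 * v - v ^+ 3] i.

(* The derivative of [osc] along [u' = - v, v' = u]. *)
Definition dosc (i : nat) (u v : R) : R :=
  nth 0 [:: - v; u; - (4 * u * v); 2 * (u ^+ 2 - v ^+ 2);
            - 3 * (3 * u ^+ 2 * v - v ^+ 3); 3 * (u ^+ 3 - 3 * u * v ^+ 2)] i.

Lemma salg_osc (X : Type) (D : set X) (S : (X -> R) -> Prop)
    (alg : smooth_algebra D S) i (u v : X -> R) : S u -> S v ->
  S (fun x => osc i (u x) (v x)) /\ S (fun x => dosc i (u x) (v x)).
Proof.
move=> Su Sv; have Sc := salg_cst alg.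
have SX2 h : S h -> S (fun x => h x ^+ 2) by move=> ?; exact: (salgX alg).
have SX3 h : S h -> S (fun x => h x ^+ 3) by move=> ?; exact: (salgX alg).
have S2 : S (fun x => u x ^+ 2 - v x ^+ 2) by apply: (salgB alg); exact: SX2.
have Suv : S (fun x => 2 * u x * v x) by apply: (salgM alg) => //; exact: (salgM alg).
have S4uv : S (fun x => 4 * u x * v x) by apply: (salgM alg) => //; exact: (salgM alg).
have S31 : S (fun x => u x ^+ 3 - 3 * u x * v x ^+ 2).
  by apply: (salgB alg); [exact: SX3|apply: (salgM alg); [exact: (salgM alg)|exact: SX2]].
have S32 : S (fun x => 3 * u x ^+ 2 * v x - v x ^+ 3).
  by apply: (salgB alg); [apply: (salgM alg) => //; apply: (salgM alg) => //; exact: SX2|exact: SX3].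
by split; case: i => [|[|[|[|[|[|i]]]]]] //=;
  first [exact: (salgN alg)|by apply: (salgM alg)|exact: (salg_cst alg)].
Qed.

Lemma is_derive_osc i (k t : R) :
  is_derive t 1 (fun t => osc i (cos (k * t)) (sin (k * t)))
    (k * dosc i (cos (k * t)) (sin (k * t))).
Proof.
have dc : is_derive t 1 (fun t => cos (k * t)) (- (k * sin (k * t))).
  apply: is_derive_eq; rewrite /GRing.scale /=; ring.
have ds : is_derive t 1 (fun t => sin (k * t)) (k * cos (k * t)).
  apply: is_derive_eq; rewrite /GRing.scale /=; ring.
case: i => [|[|[|[|[|[|i]]]]]]; rewrite /osc /dosc /= ?nth_nil ?mulr0.
- by apply: is_derive_eq; ring.
- by apply: is_derive_eq; ring.
- by apply: is_derive_eq; rewrite /GRing.scale /=; ring.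
- by apply: is_derive_eq; rewrite /GRing.scale /=; ring.
- by apply: is_derive_eq; rewrite /GRing.scale /=; ring.
- by apply: is_derive_eq; rewrite /GRing.scale /=; ring.
- exact: is_derive_cst.
Qed.

Definition nuvec N (xi eta : 'rV[R]_N) (c : C) : 'rV[R]_N :=
  complex.Re c *: xi + complex.Im c *: eta.

Lemma nuvecB N (xi eta : 'rV[R]_N) c c' :
  nuvec xi eta (c - c') = nuvec xi eta c - nuvec xi eta c'.
Proof.
by case: c c' => [a b] [a' b']; rewrite /nuvec /= !scalerBl opprD addrACA.
Qed.

(** The coefficients of a primitive of the loop in the angle: the coefficient of z^n is divided by i
    n, that of the conjugate of z by -i. The primitive is periodic because the loop has mean 0. *)
Definition loop_coef (e q : C) (i : nat) : C :=
  let I : C := Complex 0 1 in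
  nth 0 [:: I * (loop_gm e q - loop_g1 e q); loop_gm e q + loop_g1 e q;
    - (I * ((2^-1)%:C%C * loop_g2 e q)); (2^-1)%:C%C * loop_g2 e q;
    - (I * ((3^-1)%:C%C * loop_g3 e q)); (3^-1)%:C%C * loop_g3 e q] i.

Lemma loop_coefE N (xi eta : 'rV[R]_N) (e q : C) (u v : R) :
  \sum_(i < 6) dosc i u v *: nuvec xi eta (loop_coef e q i) =
  nuvec xi eta (loop e q (Complex u v)).
Proof.
rewrite !big_ord_recl big_ord0 /dosc /loop_coef /loop /=.
case: (loop_gm e q) (loop_g1 e q) (loop_g2 e q) (loop_g3 e q) => [a b] [a1 b1] [a2 b2] [a3 b3].
rewrite /nuvec !exprS expr0 /=; apply/rowP => j; rewrite !mxE; by field.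
Qed.

End Oscillation.

Section AmbientDerivative.
Context {R : realType} {d N : nat} {M : smooth_space R d}.
Variable f : M -> 'rV[R]_N.
Hypothesis imm : immersion f.

Definition Dmat m (g : M -> 'rV[R]_m) x : 'M[R]_(N, m) :=
  \matrix_(l, j) der f l (fun y => g y 0 j) x.

Lemma DmatE m (g : M -> 'rV[R]_m) x : Dmat g x = pinv f x *m tmx g x.
Proof. exact: der_matrix. Qed.

Lemma tproj_Dmat m (g : M -> 'rV[R]_m) x : tproj f x *m Dmat g x = Dmat g x.
Proof. by rewrite DmatE mulmxA tproj_pinv. Qed.

Lemma smooth_Dmat m (g : M -> 'rV[R]_m) : smoothM_row g ->
  salg_mx (@smoothM _ _ M) (Dmat g).
Proof.
move=> Sg l j; apply: (salg_eq (smoothM_algebra M)) (smoothM_der imm l (Sg 0 j)).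
by move=> x _; rewrite mxE.
Qed.

Lemma der_sum n l (h : 'I_n -> M -> R) x : (forall i, smoothM (h i)) ->
  der f l (fun y => \sum_i h i y) x = \sum_i der f l (h i) x.
Proof.
elim: n h => [|n IH] h Sh.
  rewrite big_ord0 -[RHS](der_cst f l 0 x); congr (der f l _ x).
  by apply/funext => y; rewrite big_ord0.
rewrite big_ord_recl -(IH _ (fun i => Sh _)).
rewrite -(derD f l x (Sh ord0)); last first.
  by apply: (salg_sum (smoothM_algebra M)) => i _; exact: Sh.
by congr (der f l _ x); apply/funext => y; rewrite big_ord_recl.
Qed.

Lemma derZ l c (h : M -> R) x : smoothM h ->
  der f l (fun y => c * h y) x = c * der f l h x.
Proof.
move=> Sh; rewrite (derM f l x (salg_cst (smoothM_algebra M) c) Sh).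
by rewrite der_cst mulr0 addr0.
Qed.

(** Differentiating the phase [k * y] undoes the factor 1/k. Up to a term of order 1/k, the
    derivative changes by the rank-one product of dy with the oscillating vector. *)
Lemma Dmat_osc m (g : M -> 'rV[R]_m) (V : 'I_6 -> M -> 'rV[R]_m) (y : M -> R) (k : R) x :
  smoothM_row g -> (forall i, smoothM_row (V i)) -> smoothM y -> k != 0 ->
  Dmat (fun x => g x + k^-1 *: \sum_(i < 6) osc i (cos (k * y x)) (sin (k * y x)) *: V i x) x =
  Dmat g x + (\col_l der f l y x) *m
      (\sum_(i < 6) dosc i (cos (k * y x)) (sin (k * y x)) *: V i x) +
    k^-1 *: \sum_(i < 6) osc i (cos (k * y x)) (sin (k * y x)) *: Dmat (V i) x.
Proof.
move=> Sg SV Sy k0; have alg := smoothM_algebra M.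
have Sky : smoothM (fun x => k * y x) by apply: (salgM alg) => //; exact: (salg_cst alg).
have Sc : smoothM (fun x => cos (k * y x)) by exact: (salg_comp1 alg smooth_cos).
have Ss : smoothM (fun x => sin (k * y x)) by exact: (salg_comp1 alg smooth_sin).
have So (i : 'I_6) : smoothM (fun x => osc i (cos (k * y x)) (sin (k * y x))).
  by have [] := salg_osc alg i Sc Ss.
have SoV (i : 'I_6) j : smoothM (fun x => osc i (cos (k * y x)) (sin (k * y x)) * V i x 0 j).
  by apply: (salgM alg) => //; exact: SV.
apply/matrixP => l j; rewrite [LHS]mxE.
rewrite (_ : (fun _ => _) = (fun x => g x 0 j + k^-1 * \sum_(i < 6)
    osc i (cos (k * y x)) (sin (k * y x)) * V i x 0 j)); last first.
  apply/funext => z; rewrite mxE [X in _ + X]mxE summxE; congr (_ + _ * _).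
  by apply: eq_bigr => i _; rewrite mxE.
have Ssum : smoothM (fun x => \sum_(i < 6) osc i (cos (k * y x)) (sin (k * y x)) * V i x 0 j).
  by apply: (salg_sum alg).
rewrite (derD f l x (Sg 0 j)); last by apply: (salgM alg) => //; exact: (salg_cst alg).
rewrite derZ // der_sum // !mxE -addrA; congr (_ + _).
have E1 : (\sum_(i < 6) dosc i (cos (k * y x)) (sin (k * y x)) *: V i x) 0 j =
    \sum_(i < 6) dosc i (cos (k * y x)) (sin (k * y x)) * V i x 0 j.
  by rewrite summxE; apply: eq_bigr => i _; rewrite mxE.
have E2 : (\sum_(i < 6) osc i (cos (k * y x)) (sin (k * y x)) *: Dmat (V i) x) l j =
    \sum_(i < 6) osc i (cos (k * y x)) (sin (k * y x)) * der f l (fun z => V i z 0 j) x.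
  by rewrite summxE; apply: eq_bigr => i _; rewrite !mxE.
rewrite E2 big_ord1 E1 mxE !mulr_sumr -big_split /=; apply: eq_bigr => i _.
rewrite (derM f l x (So i) (SV i 0 j)).
rewrite (der_comp1 f l Sy (is_derive_osc i k (y x))).
by field.
Qed.

End AmbientDerivative.

Lemma compact_perturb {R : realType} (X : topologicalType) (K : set X)
    (P : X -> R -> Prop) : compact K ->
  (forall x, K x -> nbhs (x, 0 : R) [set w | P w.1 w.2]) ->
  exists2 r : R, 0 < r & forall t, `|t| < r -> forall x, K x -> P x t.
Proof.
move=> cK H; have near0 : \forall t \near (0 : R), forall x, K x -> P x t.
  exact: ((compact_near_coveringP _).1 cK R (nbhs (0 : R)) (fun t x => P x t)).
have [r r0 Hr] := (near_ballP _ _).1 near0.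
by exists r => // t tr x Kx; apply: Hr => //; rewrite subr0.
Qed.

Lemma circle_compact {R : realType} :
  compact [set w : R * R | w.1 ^+ 2 + w.2 ^+ 2 = 1].
Proof.
have c1 : compact (`[-1 : R, 1] `*` `[-1 : R, 1]).
  by apply: compact_setX; exact: segment_compact.
apply: (subclosed_compact _ c1).
  apply: (@closed_comp _ _ (fun w : R * R => w.1 ^+ 2 + w.2 ^+ 2) [set 1]).
    have alg := @continuous_algebra R (R * R)%type.
    move=> w _; apply: (salgD alg); apply: (salgX alg) => z;
      [exact: cvg_fst|exact: cvg_snd].
  exact: closed_eq.
move=> [u v] /= uv; split; rewrite /= in_itv /=; apply/andP; split; nra.
Qed.

(** * One step of convex integration *)

Section OscillationStep.
Context {R : realType} {d N : nat} {M : smooth_space R d}.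
Variables (J : 'M[R]_N) (f : M -> 'rV[R]_N) (B : M -> 'M[R]_N) (xi eta : M -> 'rV[R]_N).
Hypotheses (J2 : J *m J = - 1%:M) (cM : compact [set: M]) (imm : immersion f).
Hypotheses (SB : salg_mx (@smoothM _ _ M) B) (uB : forall x, B x \in unitmx).
Hypotheses (Sxi : smoothM_row xi) (Seta : smoothM_row eta).
Hypotheses (xiP : forall x, xi x *m tproj f x = 0) (etaP : forall x, eta x *m tproj f x = 0).
Hypothesis PE : forall x, 1%:M - tproj f x = (xi x)^T *m xi x + (eta x)^T *m eta x.
Let P := tproj f.
Let alg := smoothM_algebra M.

(* The second condition says that [A] is transverse to the normal spaces of [f]. *)
Definition formal_solution (A : M -> 'M[R]_N) : Prop :=
  salg_mx (@smoothM _ _ M) A /\ forall x, [/\ P x *m A x = A x,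
    A x *m P x + (1%:M - P x) \in unitmx & gramJ J (A x *m B x) \in unitmx].

Lemma nuvec_tproj x c : nuvec (xi x) (eta x) c *m P x = 0.
Proof. by rewrite /nuvec mulmxDl -!scalemxAl xiP etaP !scaler0 addr0. Qed.

Lemma smooth_nuvec (c : M -> R[i]) : salg_c (@smoothM _ _ M) c ->
  smoothM_row (fun x => nuvec (xi x) (eta x) (c x)).
Proof. by move=> [c1 c2]; apply: (salg_mxD alg); exact: (salg_mxZ alg). Qed.

(** Along [col j (P x)], the formal term given by [q x] is traded for an actual derivative. For fast
    oscillation the new formal solution is uniformly close to [A] plus that column times the normal
    vector of loop - q, which is nondegenerate at every phase. *)
Lemma oscillation_step (g : M -> 'rV[R]_N) (A : M -> 'M[R]_N) (q : M -> R[i])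
    (kap : M -> R) (j : 'I_N) (t0 : R) :
  smoothM_row g -> formal_solution A -> salg_c (@smoothM _ _ M) q -> smoothM kap ->
  (forall x, 0 <= kap x) -> (forall x, kap x = 0 -> col j (P x) != 0) ->
  (forall x, kap x != 0 -> q x = 0) -> 0 < t0 ->
  exists g', [/\ smoothM_row g', forall x, `|g' x - g x| < t0,
    forall x, (g' x - g x) *m P x = 0 &
    formal_solution (fun x => A x + (Dmat f g' x - Dmat f g x) -
      col j (P x) *m nuvec (xi x) (eta x) (q x))].
Proof.
move=> Sg [SA HA] Sq Sk k_ge0 k_a k_q t00; have [Sf rf] := imm.
pose a x := col j (P x).
have SP : salg_mx (@smoothM _ _ M) P.
  by apply: (salg_mxeq alg _ (smooth_Dmat imm Sf)) => x _; rewrite DmatE.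
have Sa : salg_mx (@smoothM _ _ M) a.
  move=> l i; apply: (salg_eq alg (f := fun x => P x l j)) => [x _|]; last exact: SP.
  by rewrite [RHS]mxE.
have kapa x : kap x = 0 -> a x != 0 by exact: k_a.
pose e x := deg_eps J (A x) (B x) (a x) (xi x) (eta x) (kap x).
have Se : salg_c (@smoothM _ _ M) e.
  apply: (salg_deg_eps alg) => // x; first by have [_ _] := HA x.
  have [_ uT _] := HA x; exact: deg_den_neq0 (PE x) uT (uB x) (k_ge0 x) (kapa x).
have [Sgm Sg1 Sg2 Sg3] := salg_loop_coef alg Se Sq.
pose V (i : 'I_6) x := nuvec (xi x) (eta x) (loop_coef (e x) (q x) i).
have SV i : smoothM_row (V i).
  apply: smooth_nuvec; have Sc c := salg_cc alg (c : R[i]).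
  case: i => -[|[|[|[|[|[|i]]]]]] //= _; rewrite /loop_coef /=.
  - by apply: (salg_cM alg) => //; apply: (salg_cD alg) => //; exact: (salg_cN alg).
  - exact: (salg_cD alg).
  - by apply: (salg_cN alg); apply: (salg_cM alg) => //; exact: (salg_cM alg).
  - exact: (salg_cM alg).
  - by apply: (salg_cN alg); apply: (salg_cM alg) => //; exact: (salg_cM alg).
  - exact: (salg_cM alg).
pose Y := ((M * (R * R)) * R)%type.
(* The argument is a point of [M], a phase on the circle and a parameter t standing for 1/k. The
   conditions hold at t = 0 by [loop_good]. Compactness of [M] times the circle makes them persist
   for small t, whatever phase is reached at [x]. *)
pose Z (w : Y) := A w.1.1 + a w.1.1 *m (\sum_(i < 6) dosc i w.1.2.1 w.1.2.2 *: V i w.1.1 -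
    nuvec (xi w.1.1) (eta w.1.1) (q w.1.1)) +
  w.2 *: \sum_(i < 6) osc i w.1.2.1 w.1.2.2 *: Dmat f (V i) w.1.1.
pose W (w : Y) := w.2 *: \sum_(i < 6) osc i w.1.2.1 w.1.2.2 *: V i w.1.1.
have algY := @continuous_algebra R Y.
have cX (h : M -> R) : smoothM h -> continuous (fun w : Y => h w.1.1).
  move=> Sh w; apply: (@continuous_comp _ _ _ (fun w : Y => w.1.1) h).
    by apply: (@continuous_comp _ _ _ fst fst); exact: cvg_fst.
  exact: smoothM_continuous.
have cXm m n (h : M -> 'M[R]_(m, n)) : salg_mx (@smoothM _ _ M) h ->
    salg_mx (fun h : Y -> R => continuous h) (fun w => h w.1.1).
  by move=> Sh k l; exact: cX (Sh k l).
have cu : continuous (fun w : Y => w.1.2.1).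
  move=> w; apply: (@continuous_comp _ _ _ (fun w : Y => w.1.2) fst); last exact: cvg_fst.
  by apply: (@continuous_comp _ _ _ fst snd); [exact: cvg_fst|exact: cvg_snd].
have cv : continuous (fun w : Y => w.1.2.2).
  move=> w; apply: (@continuous_comp _ _ _ (fun w : Y => w.1.2) snd); last exact: cvg_snd.
  by apply: (@continuous_comp _ _ _ fst snd); [exact: cvg_fst|exact: cvg_snd].
have ct : continuous (fun w : Y => w.2) by move=> w; exact: cvg_snd.
have csum m (U : 'I_6 -> Y -> 'M[R]_(m, N)) (o : nat -> R -> R -> R) :
    (forall i : 'I_6, continuous (fun w : Y => o i w.1.2.1 w.1.2.2)) ->
    (forall i, salg_mx (fun h : Y -> R => continuous h) (U i)) ->
    salg_mx (fun h : Y -> R => continuous h)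
      (fun w => \sum_(i < 6) o i w.1.2.1 w.1.2.2 *: U i w).
  move=> co cU k l; apply: (salg_eq algY (f := fun w => \sum_(i < 6)
      o i w.1.2.1 w.1.2.2 * U i w k l)) => [w _|].
    by rewrite summxE; apply: eq_bigr => i _; rewrite mxE.
  by apply: (salg_sum algY) => i _; apply: (salgM algY) => //; exact: cU.
have cosc (i : 'I_6) : continuous (fun w : Y => osc i w.1.2.1 w.1.2.2).
  by have [] := salg_osc algY i cu cv.
have cdosc (i : 'I_6) : continuous (fun w : Y => dosc i w.1.2.1 w.1.2.2).
  by have [] := salg_osc algY i cu cv.
have cZ : salg_mx (fun h : Y -> R => continuous h) Z.
  apply: (salg_mxD algY); last first.
    apply: (salg_mxZ algY) => //.
    apply: (csum _ (fun i w => Dmat f (V i) w.1.1)) => // i.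
    by apply: cXm; exact: smooth_Dmat.
  apply: (salg_mxD algY); first exact: cXm.
  apply: (salg_mxM algY); first exact: cXm.
  apply: (salg_mxB algY); last by apply: (cXm _ _ (fun x => nuvec (xi x) (eta x) (q x))); exact: smooth_nuvec.
  by apply: (csum _ (fun i w => V i w.1.1)) => // i; apply: cXm; exact: SV.
have cW : salg_mx (fun h : Y -> R => continuous h) W.
  apply: (salg_mxZ algY) => //.
  by apply: (csum _ (fun i w => V i w.1.1)) => // i; apply: cXm; exact: SV.
have cP := cXm _ _ _ SP; have cB := cXm _ _ _ SB.
pose Q (w : M * (R * R)) (t : R) := [/\ Z (w, t) *m P w.1 + (1%:M - P w.1) \in unitmx,
  gramJ J (Z (w, t) *m B w.1) \in unitmx & `|W (w, t)| < t0].
have Z0 x u v : u ^+ 2 + v ^+ 2 = 1 -> Z ((x, (u, v)), 0) = A x + a x *m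
    nuvec (xi x) (eta x) (loop (e x) (q x) (Complex u v) - q x).
  by move=> uv; rewrite /Z /= scale0r addr0 loop_coefE -nuvecB.
have cK : compact ([set: M] `*` [set w : R * R | w.1 ^+ 2 + w.2 ^+ 2 = 1]).
  by apply: compact_setX => //; exact: circle_compact.
have [r r0 HQ] : exists2 r : R, 0 < r & forall t, `|t| < r -> forall x,
    ([set: M] `*` [set w : R * R | w.1 ^+ 2 + w.2 ^+ 2 = 1]) x -> Q x t.
  apply: compact_perturb cK _ => -[x [u v]] [_ /= uv].
  have [PA uT good] := HA x.
  have n1 : \forall w \near (((x, (u, v)), 0 : R) : Y),
      Z w *m P w.1.1 + (1%:M - P w.1.1) \in unitmx.
    apply: near_unitmx.
      apply: (salg_det algY); apply: (salg_mxD algY); first exact: (salg_mxM algY).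
      by apply: (salg_mxB algY) => //; exact: (salg_mxcst algY).
    rewrite Z0 // mulmxDl -mulmxA nuvec_tproj mulmx0 addr0 //.
  have n2 : \forall w \near (((x, (u, v)), 0 : R) : Y), gramJ J (Z w *m B w.1.1) \in unitmx.
    apply: near_unitmx.
      by apply: (salg_det algY); apply: (salg_gramJ algY); exact: (salg_mxM algY).
    rewrite Z0 //; apply: (loop_good J2 (PE x) uT (uB x) good (k_ge0 x) (kapa x)).
      exact: k_q.
    by rewrite /nsq /=.
  have n3 : \forall w \near (((x, (u, v)), 0 : R) : Y), `|W w| < t0.
    have cW' : {for (((x, (u, v)), 0 : R) : Y), continuous W} by exact: continuous_mx cW _.
    have := @cvgr_norm_lt _ _ _ _ (nbhs_filter (((x, (u, v)), 0 : R) : Y)) _ _ cW' t0.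
    by apply; rewrite /W /= scale0r normr0.
  exact: (@filterS3 _ _ (nbhs_filter (((x, (u, v)), 0 : R) : Y)) _ _ _ _
    (fun w h1 h2 h3 => And3 h1 h2 h3) n1 n2 n3).
pose k : R := (Num.truncn r^-1).+1%:R.
have k0 : 0 < k by rewrite ltr0n.
have kr : `|k^-1| < r.
  by rewrite gtr0_norm ?invr_gt0 // invf_plt ?posrE // truncnS_gt.
pose y x := f x 0 j.
have Sy : smoothM y by exact: Sf.
pose w x : M * (R * R) := (x, (cos (k * y x), sin (k * y x))).
have HQx x : Q (w x) k^-1 by apply: HQ => //; split => //=; exact: cos2Dsin2.
pose g' x := g x + k^-1 *: \sum_(i < 6) osc i (cos (k * y x)) (sin (k * y x)) *: V i x.
have g'E x : g' x - g x = W (w x, k^-1) by rewrite /g' addrC addKr.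
have Sky : smoothM (fun x => k * y x) by apply: (salgM alg) => //; exact: (salg_cst alg).
have Sc : smoothM (fun x => cos (k * y x)) by exact: (salg_comp1 alg smooth_cos).
have Ss : smoothM (fun x => sin (k * y x)) by exact: (salg_comp1 alg smooth_sin).
have Sg' : smoothM_row g'.
  apply: (salg_mxD alg) => //; apply: (salg_mxZ alg); first exact: (salg_cst alg).
  move=> z l; apply: (salg_eq alg (f := fun x => \sum_(i < 6)
      osc i (cos (k * y x)) (sin (k * y x)) * V i x z l)) => [x _|].
    by rewrite summxE; apply: eq_bigr => i _; rewrite [RHS]mxE.
  apply: (salg_sum alg) => i _; apply: (salgM alg); last exact: SV.
  by have [] := salg_osc alg i Sc Ss.
have dyE x : \col_l der f l y x = a x.
  by apply/matrixP => l z; rewrite mxE [RHS]mxE; exact: der_coord.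
have ZE x : A x + (Dmat f g' x - Dmat f g x) - a x *m nuvec (xi x) (eta x) (q x) =
    Z (w x, k^-1).
  rewrite /g' (Dmat_osc f x Sg SV Sy) ?gt_eqF // dyE /Z /= mulmxBr -!addrA.
  congr (_ + _); set S1 := a x *m \sum_(i < 6) _; set E1 := k^-1 *: _.
  set Q1 := a x *m nuvec _ _ _; move: (Dmat f g x) S1 E1 Q1 => D1 S1 E1 Q1.
  by apply/matrixP => l z; rewrite !mxE; ring.
exists g'; split=> //.
- by move=> x; rewrite g'E; have [] := HQx x.
- move=> x; rewrite g'E /W /= -scalemxAl mulmx_suml big1 ?scaler0 // => i _.
  by rewrite -scalemxAl nuvec_tproj scaler0.
- split; last first.
    move=> x; have [h1 h2 h3] := HQx x; have [PA _ _] := HA x.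
    rewrite -/(a x) ZE; split=> //; rewrite -ZE mulmxBr mulmxDr mulmxBr !tproj_Dmat // PA.
    by rewrite mulmxA /a !colE mulmxA tproj_idem.
  apply: (salg_mxB alg).
    by apply: (salg_mxD alg) => //; apply: (salg_mxB alg); exact: smooth_Dmat.
  by apply: (salg_mxM alg) => //; exact: smooth_nuvec.
Qed.

End OscillationStep.

Lemma dotr_CauchySchwarz (R : realType) n (a b : 'rV[R]_n) :
  dotr a b ^+ 2 <= dotr a a * dotr b b.
Proof.
have [/eqP|b0] := eqVneq (dotr b b) 0.
  have z (c : 'rV[R]_n) : dotr c 0 = 0 by rewrite dotrC /dotr mul0mx mxE.
  by rewrite dotr_eq0 => /eqP ->; rewrite !z expr0n mulr0.
have bp : 0 < dotr b b by rewrite lt_neqAle eq_sym b0 dotr_ge0.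
have := dotr_ge0 (dotr b b *: a - dotr a b *: b).
rewrite !(dotrDl, dotrDr, dotrNl, dotrNr, dotrZl, dotrZr) (dotrC b a).
nra.
Qed.

(** * Decomposition into coordinate directions and iteration *)

Section ConvexIntegration.
Context {R : realType} {d : nat} {M : smooth_space R d}.
Local Notation N := (d + (1 + 1))%N.
Variables (J : 'M[R]_N) (o : orientation M).
Hypotheses (J2 : J *m J = - 1%:M) (cM : compact [set: M]).
Let alg := smoothM_algebra M.

Lemma smooth_normal_frame (f : M -> 'rV[R]_N) : immersion f -> injective f ->
  exists xi eta : M -> 'rV[R]_N, [/\ smoothM_row xi, smoothM_row eta,
    forall x, orthonormal2 (xi x) (eta x),
    forall x, col_mx (xi x) (eta x) *m tproj f x = 0 &
    forall x, 1%:M - tproj f x = (xi x)^T *m xi x + (eta x)^T *m eta x].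
Proof.
move=> imm inj; have [n [Sn nP n0]] := normal_field_exists o cM imm inj.
have SK := smooth_normal_rot o imm.
have nn x : 0 < dotr (n x) (n x) by rewrite dotr_gt0.
pose c x := (Num.sqrt (dotr (n x) (n x)))^-1.
have c2 x : c x ^+ 2 * dotr (n x) (n x) = 1.
  by rewrite /c exprVn sqr_sqrtr ?ltW // mulVf // gt_eqF.
have Sc : smoothM c.
  apply: (salgV alg) => [x _|]; first by rewrite gt_eqF // sqrtr_gt0.
  apply: (salg_comp1 alg smooth_sqrt) => [x _|]; first exact: nn.
  by apply: (salg_mxM alg Sn (salg_mxT alg Sn)).
pose xi x := c x *: n x; pose eta x := xi x *m normal_rot f o x.
have Sxi : smoothM_row xi by exact: (salg_mxZ alg).
have Seta : smoothM_row eta by exact: (salg_mxM alg).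
have xiP x : xi x *m tproj f x = 0 by rewrite /xi -scalemxAl nP scaler0.
have KT x := normal_rot_tr o imm x.
have xx x : dotr (xi x) (xi x) = 1.
  by rewrite /xi dotrZl dotrZr mulrA -expr2 c2.
exists xi, eta; split=> // x.
- split=> //; last by rewrite dotrC; exact: skew_dotr.
  rewrite /eta dotr_mull KT mulmxN -mulmxA (normal_rot_sqr o imm) mulmxN opprK.
  by rewrite mulmxBr mulmx1 xiP subr0.
- have [_ KP] := normal_rot_proj o imm x.
  by rewrite mul_col_mx xiP /eta -mulmxA KP mulmx0 col_mx0.
- by rewrite /eta (normal_span o imm (xiP x)) xx scale1r.
Qed.

Section WeightMatrix.
Variables (P : 'M[R]_N) (chi : 'I_N -> R) (r : R).
Hypotheses (P2 : P *m P = P) (PT : P^T = P) (chi0 : forall j, 0 <= chi j).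
Hypotheses (rN : r * N%:R < 1).
Hypothesis chi_r : forall j, chi j = 0 -> ((col j P)^T *m col j P) 0 0 <= r.

(** With all weights equal to 1 this is the identity, because the columns of an orthogonal
    projection satisfy sum_j p_j p_j^T = P. The weights switch off short columns, along which no
    oscillation is produced; the inverse of this matrix restores the decomposition. *)
Definition weight_mx : 'M[R]_N :=
  \sum_j chi j *: (col j P *m (col j P)^T) + (1%:M - P).

(** A kernel vector v satisfies P v = v, and its coordinate v_j is 0 unless [chi j = 0], in which
    case v_j^2 <= r |v|^2 by Cauchy-Schwarz. Summing gives |v|^2 <= r N |v|^2 with r N < 1. *)
Lemma weight_mx_unit : weight_mx \in unitmx.
Proof.
apply/unit_colP => v Wv.
have colP j : ((col j P)^T *m v) 0 0 = (P *m v) j 0.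
  rewrite !mxE; apply: eq_bigr => i _; rewrite !mxE; congr (_ * _).
  by rewrite -{1}PT mxE.
have E0 : (v^T *m (weight_mx *m v)) 0 0 =
    \sum_j chi j * (P *m v) j 0 ^+ 2 + ((v - P *m v)^T *m (v - P *m v)) 0 0.
  have -> : (v - P *m v)^T *m (v - P *m v) = v^T *m ((1%:M - P) *m v).
    have -> : v - P *m v = (1%:M - P) *m v by rewrite mulmxBl mul1mx.
    rewrite trmx_mul linearB /= trmx1 PT.
    rewrite -mulmxA (mulmxA (1%:M - P)); congr (_ *m (_ *m _)).
    by rewrite mulmxBl mul1mx mulmxBr mulmx1 P2 subrr subr0.
  have -> : v^T *m (weight_mx *m v) = v^T *m ((\sum_j chi j *: (col j P *m (col j P)^T)) *m v)
      + v^T *m ((1%:M - P) *m v).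
    by rewrite -mulmxDr; congr (_ *m _); exact: mulmxDl.
  rewrite [LHS]mxE; congr +%R.
  rewrite mulmx_suml mulmx_sumr summxE; apply: eq_bigr => j _.
  rewrite -scalemxAl -scalemxAr mxE; congr (_ * _).
  have -> : v^T *m (col j P *m (col j P)^T *m v) = ((col j P)^T *m v)^T *m ((col j P)^T *m v).
    by rewrite trmx_mul trmxK !mulmxA.
  by rewrite -colP [LHS]mxE big_ord1 [X in X * _]mxE expr2.
have s0 : 0 <= \sum_j chi j * (P *m v) j 0 ^+ 2.
  by apply: sumr_ge0 => j _; rewrite mulr_ge0 ?sqr_ge0.
have t0 := col_sqr_ge0 (v - P *m v).
have {}E0 : \sum_j chi j * (P *m v) j 0 ^+ 2 = 0 /\
    ((v - P *m v)^T *m (v - P *m v)) 0 0 = 0.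
  by move: E0; rewrite Wv mulmx0 mxE => E0; split; lra.
have [/eqP S0 /eqP] := E0; rewrite col_sqr_eq0 subr_eq0 => /eqP vP.
move: S0; rewrite psumr_eq0 => [/allP S0|j _]; last by rewrite mulr_ge0 ?sqr_ge0.
have {}S0 j : chi j * v j 0 ^+ 2 = 0.
  by have := S0 j (mem_index_enum _); rewrite /= -vP => /eqP.
pose s := (v^T *m v) 0 0; have sE : s = \sum_j v j 0 ^+ 2.
  by rewrite /s mxE; apply: eq_bigr => j _; rewrite mxE expr2.
have vj j : v j 0 ^+ 2 <= r * s.
  have /eqP := S0 j; rewrite mulf_eq0 => /orP[/eqP/chi_r cr|/eqP ->]; last first.
    have [r0|r0] := lerP 0 r; first by rewrite mulr_ge0 // col_sqr_ge0.
    have : s = 0.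
      rewrite sE big1 // => i _; have /eqP := S0 i; rewrite mulf_eq0 => /orP[/eqP/chi_r|/eqP//].
      by move=> h; have := le_trans (col_sqr_ge0 (col i P)) h; rewrite leNgt r0.
    by move=> ->; rewrite mulr0.
  rewrite {1}vP -colP; apply: (@le_trans _ _ (((col j P)^T *m col j P) 0 0 * s)).
    by have := dotr_CauchySchwarz (col j P)^T v^T; rewrite /dotr !trmxK.
  by rewrite ler_wpM2r // col_sqr_ge0.
have : s <= r * N%:R * s.
  rewrite {1}sE; apply: (le_trans (ler_sum _ (fun j _ => vj j))).
  by rewrite sumr_const card_ord -[_ *+ _]mulr_natr (mulrAC r s) lexx.
have s_ge0 : 0 <= s := col_sqr_ge0 v; move=> h.
apply/eqP; rewrite -col_sqr_eq0 -/s; apply: contraT => sn.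
have sp : 0 < s by rewrite lt_neqAle eq_sym sn.
by move: h; rewrite ler_pMl // leNgt rN.
Qed.

Lemma weight_mx_decomp (u : 'cV[R]_N) : P *m u = u ->
  \sum_j (chi j * ((col j P)^T *m (invmx weight_mx *m u)) 0 0) *: col j P = u.
Proof.
move=> Pu; have uW := weight_mx_unit; set s := invmx weight_mx *m u.
have Ws : weight_mx *m s = u by rewrite mulKVmx.
have Pc j : P *m col j P = col j P by rewrite !colE mulmxA P2.
have PW : (1%:M - P) *m weight_mx = 1%:M - P.
  rewrite /weight_mx mulmxDr mulmx_sumr big1 ?add0r.
    by rewrite mulmxBl mul1mx mulmxBr mulmx1 P2 subrr subr0.
  by move=> j _; rewrite -scalemxAr mulmxA mulmxBl mul1mx Pc subrr mul0mx scaler0.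
have Ps : (1%:M - P) *m s = 0.
  by rewrite -PW -mulmxA Ws mulmxBl mul1mx Pu subrr.
rewrite -[RHS]Ws /weight_mx mulmxDl Ps addr0 mulmx_suml; apply: eq_bigr => j _.
rewrite -scalemxAl -scalerA; congr (_ *: _); rewrite -mulmxA -mul_mx_scalar.
by congr (_ *m _); exact/esym/mx11_scalar.
Qed.

End WeightMatrix.

(** [C] is the formal normal part of the derivative. As the corrections are normal to [f], the
    tangential component of the formal derivative is kept equal to [tproj f], whence the condition
    [C x *m tproj f x = 0]. *)
Lemma convex_integration (f : M -> 'rV[R]_N) (B C : M -> 'M[R]_N) :
  immersion f -> injective f ->
  salg_mx (@smoothM _ _ M) B -> (forall x, B x \in unitmx) ->
  salg_mx (@smoothM _ _ M) C -> (forall x, tproj f x *m C x = C x) ->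
  (forall x, C x *m tproj f x = 0) ->
  (forall x, gramJ J ((tproj f x + C x) *m B x) \in unitmx) ->
  exists f' : M -> 'rV[R]_N, [/\ immersion f', injective f' &
    forall x, row_full (tmx f' x *m B x + tmx f' x *m B x *m J)%MS].
Proof.
move=> imm inj SB uB SC PC CP good; have [Sf rf] := imm.
have [xi [eta [Sxi Seta on VP PE]]] := smooth_normal_frame imm inj.
pose P := tproj f.
have SP : salg_mx (@smoothM _ _ M) P := smoothM_tproj imm.
have P2 x : P x *m P x = P x by exact: tproj_idem.
have PT x : (P x)^T = P x by exact: tr_tproj.
have xeP x : xi x *m P x = 0 /\ eta x *m P x = 0.
  by have := VP x; rewrite mul_col_mx -(col_mx0 _ 1 1) => /eq_col_mx.
have xiP x := (xeP x).1; have etaP x := (xeP x).2.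
pose a (j : 'I_N) x := col j (P x).
have Sa j : salg_mx (@smoothM _ _ M) (a j).
  move=> l i; apply: (salg_eq alg (f := fun x => P x l j)) => [x _|]; last exact: SP.
  by rewrite [RHS]mxE.
pose aa j x := ((a j x)^T *m a j x) 0 0.
have Saa j : smoothM (aa j) by apply: (salg_mxM alg (salg_mxT alg (Sa j)) (Sa j)).
pose r : R := N.+1%:R^-1.
have r0 : 0 < r by rewrite invr_gt0 ltr0n.
have rN : r * N%:R < 1 by rewrite mulrC ltr_pdivrMr ?ltr0n // mul1r ltr_nat.
(* At each point [chi j] or [kap j] vanishes: [chi j] where the column is short, so that [q j] is 0
   there, and [kap j] where it is long, so that it is nonzero. *)
pose chi j x := flat_exp 1 (aa j x - r); pose kap j x := flat_exp 1 (r - aa j x).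
have Schi j : smoothM (chi j).
  apply: (salg_comp1 alg (smooth_flat_exp 1)) => //.
  by apply: (salgB alg) => //; exact: (salg_cst alg).
have Skap j : smoothM (kap j).
  apply: (salg_comp1 alg (smooth_flat_exp 1)) => //.
  by apply: (salgB alg) => //; exact: (salg_cst alg).
have chi0 x j : 0 <= chi j x by exact: flat_exp1_ge0.
have chi_r x j : chi j x = 0 -> aa j x <= r.
  move=> E; have := flat_exp1_gt0 (aa j x - r); rewrite -/(chi j x) E ltxx.
  by move/esym/negbT; rewrite -leNgt subr_le0.
pose W x := weight_mx (P x) (chi ^~ x).
have uW x : W x \in unitmx by exact: (weight_mx_unit (P2 x) (PT x) (chi0 x) rN (chi_r x)).
have SW : salg_mx (@smoothM _ _ M) W.
  apply: (salg_mxD alg); last by apply: (salg_mxB alg) => //; exact: (salg_mxcst alg).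
  move=> k l; apply: (salg_eq alg (f := fun x => \sum_j chi j x * (a j x *m (a j x)^T) k l)).
    by move=> x _; rewrite summxE; apply: eq_bigr => j _; rewrite [RHS]mxE.
  apply: (salg_sum alg) => j _; apply: (salgM alg) => //.
  by apply: (salg_mxM alg) => //; exact: (salg_mxT alg).
pose co (nu : M -> 'rV[R]_N) j x : R :=
  chi j x * ((a j x)^T *m (invmx (W x) *m (C x *m (nu x)^T))) 0 0.
have Sco nu j : smoothM_row nu -> smoothM (co nu j).
  move=> Snu; apply: (salgM alg) => //; apply: (salg_mxM alg); first exact: (salg_mxT alg).
  apply: (salg_mxM alg); first by apply: (salg_mxV alg).
  by apply: (salg_mxM alg) => //; exact: (salg_mxT alg).
pose q j x : R[i] := Complex (co xi j x) (co eta j x).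
have Sq j : salg_c (@smoothM _ _ M) (q j) by split; exact: Sco.
have kap0 j x : 0 <= kap j x by exact: flat_exp1_ge0.
have kap_a j x : kap j x = 0 -> a j x != 0.
  move=> E; have := flat_exp1_gt0 (r - aa j x); rewrite -/(kap j x) E ltxx.
  move/esym/negbT; rewrite subr_gt0 -leNgt => h; rewrite -col_sqr_eq0 -/(aa j x).
  by rewrite gt_eqF // (lt_le_trans r0).
have kap_q j x : kap j x != 0 -> q j x = 0.
  move=> E; have : 0 < r - aa j x.
    rewrite -flat_exp1_gt0 lt_neqAle flat_exp1_ge0 andbT eq_sym; exact: E.
  move=> h; have c0 : chi j x = 0 by rewrite /chi flat_exp_eq0 //; lra.
  by rewrite /q /co c0 !mul0r.
have sumC x : \sum_j a j x *m nuvec (xi x) (eta x) (q j x) = C x.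
  have col_sum nu : \sum_j co nu j x *: a j x = C x *m (nu x)^T.
    apply: (weight_mx_decomp (P2 x) (PT x) (chi0 x) rN (chi_r x)).
    by rewrite mulmxA PC.
  have -> : C x = C x *m (xi x)^T *m xi x + C x *m (eta x)^T *m eta x.
    by rewrite -!mulmxA -mulmxDr -PE mulmxBr mulmx1 CP subr0.
  rewrite -!col_sum.
  rewrite !mulmx_suml -big_split /=; apply: eq_bigr => j _.
  by rewrite /nuvec /= mulmxDr -!scalemxAr -!scalemxAl.
have [e [e0 uniq _]] := tube_exists imm inj cM.
(* All [N] steps together move [f] by less than the radius [e] of the tube. As the displacement is
   normal, the foot point recovers [x], and [g] stays injective. *)
pose t0 := e / N.+1%:R.
have t00 : 0 < t0 by rewrite divr_gt0 // ltr0n.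
(* The components of index below [m] are already realized by [g]; the others are still formal. *)
pose A m (g : M -> 'rV[R]_N) x :=
  Dmat f g x + \sum_(j < N | (m <= j)%N) a j x *m nuvec (xi x) (eta x) (q j x).
have step m : (m <= N)%N -> exists g : M -> 'rV[R]_N, [/\ smoothM_row g,
    forall x, `|g x - f x| <= m%:R * t0, forall x, (g x - f x) *m P x = 0 &
    formal_solution J f B (A m g)].
  elim: m => [_|m IH mN].
    exists f; split=> //; first by move=> x; rewrite subrr normr0 mul0r.
      by move=> x; rewrite subrr mul0mx.
    have AE x : A 0%N f x = P x + C x by rewrite /A DmatE -sumC; congr (_ + _); exact: eq_bigl.
    split.
      by apply: (salg_mxeq alg (A := fun x => P x + C x)) => [x _|]; [rewrite AE|exact: (salg_mxD alg)].
    move=> x; rewrite AE; split=> //; first by rewrite mulmxDr P2 PC.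
    by rewrite mulmxDl P2 CP addr0 addrC subrK unitmx1.
  have [g [Sg gf gP HA]] := IH (ltnW mN); pose j := Ordinal mN.
  have [g' [Sg' g'g g'P HA']] := oscillation_step J2 cM imm SB uB Sxi Seta xiP etaP PE
    (j := j) Sg HA (Sq j) (Skap j) (kap0 j) (kap_a j) (kap_q j) t00.
  exists g'; split=> //.
  - move=> x; rewrite -(subrK (g x) (g' x)) -addrA -natr1 mulrDl mul1r addrC.
    by apply: le_trans (ler_normD _ _) _; apply: lerD; [exact: gf|exact: ltW].
  - by move=> x; rewrite -(subrK (g x) (g' x)) -addrA mulmxDl g'P gP addr0.
  - rewrite (_ : A m.+1 g' = fun x => A m g x + (Dmat f g' x - Dmat f g x) -
      col j (P x) *m nuvec (xi x) (eta x) (q j x)) //.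
    apply/funext => x; rewrite /A (bigD1 (P := fun i : 'I_N => (m <= i)%N) j) //=.
    have -> : \sum_(i < N | (m <= i)%N && (i != j)) a i x *m nuvec (xi x) (eta x) (q i x) =
        \sum_(i < N | (m < i)%N) a i x *m nuvec (xi x) (eta x) (q i x).
      by apply: eq_bigl => i; rewrite ltn_neqAle andbC eq_sym.
    rewrite -/(a j x); move: (Dmat f g x) (Dmat f g' x) (a j x *m _) (\sum_(_ | _) _) => X Y Z S.
    by rewrite addrC -!addrA [RHS]addrC !addrA; apply/matrixP => k l; rewrite !mxE; ring.
have [g [Sg gf gP [_ HA]]] := step N (leqnn N).
have AE x : A N g x = Dmat f g x.
  by rewrite /A big_pred0 ?addr0 // => j; rewrite leqNgt ltn_ord.
have tE x : tmx f x *m Dmat f g x = tmx g x.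
  by rewrite DmatE mulmxA tmx_pinv // mul1mx.
exists g; split.
- split=> // x; have [_ uT _] := HA x; rewrite AE in uT.
  apply/inj_row_free => v vg; have : v *m tmx f x *m Dmat f g x = 0 by rewrite -mulmxA tE.
  set w := v *m tmx f x => wD.
  have wP : w *m P x = w by rewrite /w -mulmxA tmx_tproj.
  have w0 : w = 0.
    rewrite -[w](mulmxK uT) mulmxDr mulmxBr mulmx1 wP subrr addr0 mulmxA wD.
    by rewrite mul0mx mul0mx.
  have /row_freeP[Z fZ] := rf x.
  by rewrite -[v]mulmx1 -fZ mulmxA -/w w0 mul0mx.
- move=> x x' E.
  have small y : `|g y - f y| < e.
    apply: le_lt_trans (gf y) _; by rewrite /t0 mulrA ltr_pdivrMr ?ltr0n // mulrC ltr_pM2l // ltr_nat.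
  apply: (uniq x x' (g x - f x) (g x' - f x')); [exact: gP|exact: gP|exact: small|exact: small|].
  by rewrite !(addrC (f _)) !subrK.
- move=> x; have [_ _ G] := HA x; rewrite AE in G.
  apply/(@gramJ_full _ _ J _ _ (Dmat f g x *m B x)) => //.
  apply/andP; split; last by rewrite -tE -mulmxA submxMl.
  by rewrite DmatE -mulmxA submxMl.
Qed.

End ConvexIntegration.

(** * From pseudo-holomorphic to CR regular embeddings *)

Lemma compact_finite_cover (X : topologicalType) (K : set X) (W : X -> set X) :
  compact K -> (forall x, K x -> nbhs x (W x)) ->
  exists s : seq X, forall x, K x -> exists2 p, p \in s & W p x.
Proof.
move=> cK HW.
(* The filter of finite sequences directed by inclusion, fed to the near-covering form of
   compactness. *)
pose F : set_system (seq X) := [set P : set (seq X) | exists s0 : seq X,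
  forall s : seq X, {subset s0 <= s} -> P s].
have FF : ProperFilter F.
  apply: Build_ProperFilter_ex.
    by move=> P [s0 H]; exists s0; exact: H.
  split; first by exists [::].
    move=> P Q [s HP] [t HQ]; exists (s ++ t) => u su.
    by split; [apply: HP|apply: HQ] => y ys; apply: su; rewrite mem_cat ys ?orbT.
  by move=> P Q PQ [s HP]; exists s => u /HP /PQ.
have [s H] : F (fun s => forall x, K x -> exists2 p, p \in s & W p x).
  apply: ((compact_near_coveringP _).1 cK _ F (fun s x => exists2 p, p \in s & W p x)).
  move=> x Kx; exists (W x, [set t : seq X | x \in t]).
    split; first exact: HW.
    by exists [:: x] => s; apply; rewrite inE.
  by move=> [y s] /= [Wy xs]; exists x.
by exists s; exact: H.
Qed.

(** Once [k] exceeds n b^(d+1), the k^(d+2) points of a grid outnumber the n (b k)^(d+1) boxes. *)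
Lemma no_small_code d n b : exists k, (0 < k)%N /\
  forall g : {ffun 'I_d.+2 -> 'I_k} -> 'I_n * {ffun 'I_d.+1 -> 'I_(b * k)}, ~ injective g.
Proof.
pose k := (n * b ^ d.+1).+1; exists k; split=> // g /leq_card.
rewrite card_prod !card_ffun !card_ord expnMn (expnS k d.+1) mulnA.
by rewrite leq_pmul2r ?expn_gt0 // ltnn.
Qed.

Lemma near_dist_lt (R : realType) (X : topologicalType) (V : normedModType R)
    (g : X -> V) p (e : R) : {for p, continuous g} -> 0 < e ->
  \forall x \near p, `|g x - g p| < e.
Proof. by move=> cg e0; exact: (@cvgr_distC_lt R V X _ (nbhs_filter p) g (g p) cg e e0). Qed.

(** * A direction missed for reasons of dimension *)

Section MissedDirection.
Context {R : realType} {d : nat} {M : smooth_space R d}.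
Hypothesis cM : compact [set: M].

Lemma trunc_close (u v : R) : 0 <= u -> 0 <= v -> Num.truncn u = Num.truncn v ->
  `|u - v| < 1.
Proof.
move=> u0 v0 E; have /andP[h1 h2] := truncn_itv u0; have /andP[h3 h4] := truncn_itv v0.
rewrite E in h1 h2; move: h2 h4; rewrite -natr1 => h2 h4.
by rewrite ltr_norml; apply/andP; split; lra.
Qed.

Lemma natr_dist_lt1 (a b : nat) : `|a%:R - b%:R : R| < 1 -> a = b.
Proof.
rewrite ltr_norml => /andP[h1 h2]; apply/eqP; rewrite eqn_leq.
by apply/andP; split; rewrite -ltnS -(ltr_nat R) -natr1; lra.
Qed.

(* The charts are Lipschitz images of cubes, so the cone over [m] is covered by
   too few small boxes to meet all the points of a fine grid. *)
Lemma missed_direction (m : M -> 'rV[R]_d.+2) : smoothM_row m ->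
  (forall x, m x != 0) ->
  exists c, forall x t, 0 <= t <= 1 -> (1 - t) *: m x + t *: c != 0.
Proof.
move=> Sm m0; have cm := smoothM_row_continuous Sm.
pose F (p : M) := m \o chart_inv (pref p).
pose ch (p x : M) : 'rV[R]_d := chart (pref p) x.
pose good (p : M) (C : nat) (x : M) := [/\ forall l, `|(ch p x - ch p p) 0 l| < 1, 1 <= C%:R * `|m x|,
  `|m x| <= C%:R & dom (pref p) x].
pose Lip (p : M) (C : nat) (V : set 'rV[R]_d) := forall y y', V y -> V y' ->
  `|F p y - F p y'| <= C%:R * `|y - y'|.
have local p : exists C : nat, exists V : set 'rV[R]_d,
    Lip p C V /\ nbhs p [set x | good p C x /\ V (ch p x)].
  have dp := dom_pref p; have oC := @open_cod _ _ M (pref p).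
  have [r r0 Hr] := strict_jac oC (chart_in dp) (smoothM_row_on (pref p) Sm 1%N) ltr01.
  have mp : 0 < `|m p| by rewrite normr_gt0.
  pose C1 := (Num.truncn (1 + d%:R * `|jac (F p) (ch p p)|)).+1.
  pose C2 := (Num.truncn (`|m p| + 1)).+1; pose C3 := (Num.truncn (2 / `|m p|)).+1.
  pose C := (C1 + C2 + C3)%N.
  have CE : C%:R = C1%:R + C2%:R + C3%:R :> R by rewrite /C !natrD.
  have [h1 h2 h3] : [/\ 1 + d%:R * `|jac (F p) (ch p p)| <= C1%:R :> R,
      `|m p| + 1 <= C2%:R & 2 / `|m p| <= C3%:R].
    by split; apply: ltW; exact: truncnS_gt.
  have [n1 n2 n3] := And3 (ler0n R C1) (ler0n R C2) (ler0n R C3).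
  exists C, [set y | `|y - ch p p| < r]; split.
    move=> y y' yr y'r; have := Hr y y' yr y'r; rewrite mul1r => H.
    rewrite -(subrK ((y - y') *m jac (F p) (ch p p)) (F p y - F p y')).
    apply: le_trans (ler_normD _ _) _.
    apply: (@le_trans _ _ (`|y - y'| + d%:R * (`|y - y'| * `|jac (F p) (ch p p)|))).
      by apply: lerD; [exact: H|exact: mulmx_norm_le].
    rewrite (_ : _ + _ = (1 + d%:R * `|jac (F p) (ch p p)|) * `|y - y'|); last by ring.
    by rewrite ler_wpM2r //; lra.
  have N1 : \forall x \near p, dom (pref p) x by apply: open_nbhs_nbhs; split=> //; exact: open_dom.
  have N2 : \forall x \near p, `|ch p x - ch p p| < Num.min r 1.
    have e0 : 0 < Num.min r 1 :> R by rewrite lt_min r0 ltr01.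
    exact: near_dist_lt (chart_cont dp) e0.
  have N3 : \forall x \near p, `|m x - m p| < Num.min 1 (`|m p| / 2).
    have e0 : 0 < Num.min 1 (`|m p| / 2) by rewrite lt_min ltr01 divr_gt0.
    exact: near_dist_lt (cm p) e0.
  apply: (@filterS3 _ _ (nbhs_filter p) _ _ _ _ _ N1 N2 N3) => x dx.
  rewrite !lt_min => /andP[xr x1] /andP[m1 m2]; split=> //; split=> //.
  - by move=> l; apply: le_lt_trans (mx_norm_coord _ _ _) x1.
  - have : `|m p| / 2 <= `|m x|.
      have := ler_normD (m x) (m p - m x).
      by rewrite (distrC (m p)) addrC subrK; lra.
    have : 1 <= C3%:R * (`|m p| / 2).
      by move: h3; rewrite ler_pdivrMr // => h3; lra.
    have := normr_ge0 (m x); nra.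
  - by have := ler_normD (m p) (m x - m p); rewrite addrC subrK; lra.
pose Cp p := projT1 (cid (local p)).
pose Vp p := projT1 (cid (projT2 (cid (local p)))).
have Lp p : Lip p (Cp p) (Vp p) /\ nbhs p [set x | good p (Cp p) x /\ Vp p (ch p x)].
  by rewrite /Cp /Vp; case: cid => C /= ?; case: cid.
have [s cov] := compact_finite_cover cM (fun x _ => (Lp x).2).
pose C := \sum_(p <- s) Cp p.
have Cle p : p \in s -> (Cp p)%:R <= C%:R :> R.
  by move=> ps; rewrite ler_nat /C (big_rem p) //= leq_addr.
(* Within a parameter box of side 1/(K k), a point -l m(x) with l <= 2C moves by at most 4C^2 + C
   times the side: 2C C from [m] and (2C + 1) C from l. That is less than the spacing 1/k of the
   grid. *)
pose K := (4 * C ^ 2 + C).+1; have KE : K%:R = 4 * C%:R ^+ 2 + C%:R + 1 :> R.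
  by rewrite /K -natr1 natrD natrM natrX.
have [k [k0 Hk]] := no_small_code d (size s) (2 * K).
have kR : 0 < k%:R :> R by rewrite ltr0n.
have KR : 0 < K%:R :> R by rewrite ltr0n.
apply: contrapT => hit.
pose c (a : {ffun 'I_d.+2 -> 'I_k}) : 'rV[R]_d.+2 := \row_i (1 + (a i)%:R / k%:R).
have c_le a i : 1 <= c a 0 i <= 2.
  rewrite mxE lerDl divr_ge0 ?ler0n //= (_ : 2 = 1 + 1) // lerD2l.
  by rewrite ler_pdivrMr // mul1r ler_nat ltnW.
have cn a : `|c a| <= 2.
  by apply: mx_norm_le => // i j; rewrite ord1; have := c_le a j; rewrite ler_norml; lra.
(* A grid point that is hit has the form -l m(x) with l = (1 - t) / t. Its norm is at most 2 and
   |m(x)| at least 1/C, whence l <= 2C. *)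
have ray a : exists w : M * R, [/\ 0 <= w.2 <= 2 * C%:R & c a = - (w.2 *: m w.1)].
  have : exists x t, 0 <= t <= 1 /\ (1 - t) *: m x + t *: c a = 0.
    apply: contrapT => H; apply: hit; exists (c a) => x t t01; apply/eqP => E.
    by apply: H; exists x, t.
  move=> [x [t [/andP[t0 t1] E]]].
  have tn : t != 0.
    apply/eqP => tz; move/eqP: E; rewrite tz subr0 scale1r scale0r addr0.
    by rewrite (negPf (m0 x)).
  have tp : 0 < t by rewrite lt_neqAle eq_sym tn.
  have cE : c a = - (((1 - t) / t) *: m x).
    rewrite mulrC -scalerA -scalerN; apply: (scalerI tn).
    by rewrite scalerA mulfV // scale1r; apply/eqP; rewrite -addr_eq0 addrC E.
  exists (x, (1 - t) / t); split=> //=; rewrite divr_ge0 ?subr_ge0 //=.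
  have [p ps [[_ mx _ _] _]] := cov x I.
  have := cn a; rewrite cE normrN normrZ ger0_norm ?divr_ge0 ?subr_ge0 // => le2.
  have l0 : 0 <= (1 - t) / t by rewrite divr_ge0 ?subr_ge0.
  have := Cle p ps => CC; have := normr_ge0 (m x); have := ler0n R (Cp p).
  move: ((1 - t) / t) (Cp p)%:R (C%:R) `|m x| l0 le2 mx CC => l u v w l0 le2 mx CC u0 w0.
  have : l * 1 <= l * (u * w) by rewrite ler_wpM2l.
  have : u * (l * w) <= u * 2 by rewrite ler_wpM2l.
  nra.
pose w a := projT1 (cid (ray a)).
have Hw a : 0 <= (w a).2 <= 2 * C%:R /\ c a = - ((w a).2 *: m (w a).1).
  by rewrite /w; case: cid => ? [].
have pt a : exists2 p, p \in s & good p (Cp p) (w a).1 /\ Vp p (ch p (w a).1).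
  exact: cov.
pose p a := s2val (cid2 (pt a)).
have ps a : p a \in s by rewrite /p; case: cid2.
have Hp a : good (p a) (Cp (p a)) (w a).1 /\ Vp (p a) (ch (p a) (w a).1).
  by rewrite /p; case: cid2.
have idx a : (index (p a) s < size s)%N by rewrite index_mem.
pose y a l := (ch (p a) (w a).1 - ch (p a) (p a)) 0 l + 1.
have y_itv a l : 0 <= y a l < 2.
  have [[/(_ l) h _ _ _] _] := Hp a; move: h; rewrite ltr_norml /y => /andP[h1 h2].
  by apply/andP; split; lra.
pose z a := (w a).2 / (2 * C%:R + 1).
have C0 : 0 < 2 * C%:R + 1 :> R by rewrite ltr_wpDl // mulr_ge0.
have z_itv a : 0 <= z a < 2.
  have [/andP[h1 h2] _] := Hw a; rewrite /z; apply/andP; split; first by rewrite divr_ge0 // ltW.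
  rewrite ltr_pdivrMr //.
  by have := ler0n R C; lra.
have code_lt (u : R) : 0 <= u < 2 -> (Num.truncn (u * (K * k)%:R) < 2 * K * k)%N.
  move=> /andP[u0 u2]; rewrite -(ltr_nat R).
  have u0' : 0 <= u * (K * k)%:R by rewrite mulr_ge0.
  have /andP[h _] := truncn_itv u0'; apply: (le_lt_trans h).
  by rewrite -mulnA (natrM R 2 (K * k)) ltr_pM2r // ltr0n muln_gt0 k0.
pose coord a (i : 'I_d.+1) : R := if unlift ord_max i is Some l then y a l else z a.
have coord_itv a i : 0 <= coord a i < 2 by rewrite /coord; case: unlift.
pose g a := (Ordinal (idx a),
  [ffun i : 'I_d.+1 => Ordinal (code_lt _ (coord_itv a i))]).
apply: (Hk g) => a a' [E1 /ffunP E2].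
have pE : p a = p a' by rewrite -(nth_index (p a) (ps a)) E1 nth_index.
have Kk0 : 0 < (K * k)%:R :> R by rewrite ltr0n muln_gt0 k0.
have close i : `|coord a i - coord a' i| < (K * k)%:R^-1.
  have := congr1 val (E2 i); rewrite !ffunE /= => E.
  have [/andP[h1 _] /andP[h2 _]] := (coord_itv a i, coord_itv a' i).
  have := trunc_close (mulr_ge0 h1 (ltW Kk0)) (mulr_ge0 h2 (ltW Kk0)) E.
  by rewrite -mulrBl normrM (gtr0_norm Kk0) -ltr_pdivlMr // div1r.
have [[[_ _ _ _] Va] [[_ _ ma' _] Va']] := (Hp a, Hp a').
have [[/andP[wa0 waC] ca] [/andP[wa'0 wa'C] ca']] := (Hw a, Hw a').
rewrite -pE in Va' ma'.
have m_close : `|m (w a).1 - m (w a').1| <= C%:R * (K * k)%:R^-1.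
  have [[[_ _ _ da] _] [[_ _ _ da'] _]] := (Hp a, Hp a'); rewrite -pE in da'.
  have := (Lp (p a)).1 _ _ Va Va'; rewrite /F /= /ch !chartK // => h.
  apply: (le_trans h); apply: ler_pM; rewrite ?ler0n ?Cle //.
  apply: mx_norm_le => [|i l]; first by rewrite invr_ge0 ltW.
  have := close (lift ord_max l); rewrite /coord liftK /y -pE => /ltW; rewrite ord1 !mxE.
  by rewrite (_ : forall u v t : R, u - t + 1 - (v - t + 1) = u - v) // => *; ring.
have w_close : `|(w a).2 - (w a').2| <= (2 * C%:R + 1) * (K * k)%:R^-1.
  have := close ord_max; rewrite /coord unlift_none /z -mulrBl normrM.
  rewrite (gtr0_norm (x := (2 * C%:R + 1)^-1)) ?invr_gt0 // ltr_pdivrMr // => /ltW h.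
  by rewrite mulrC.
have cc : `|c a - c a'| < k%:R^-1.
  have -> : c a - c a' = (w a).2 *: (m (w a').1 - m (w a).1) +
      ((w a').2 - (w a).2) *: m (w a').1.
    by rewrite ca ca' scalerBr scalerBl; apply/rowP => i; rewrite !mxE; ring.
  apply: (le_lt_trans (ler_normD _ _)); rewrite !normrZ (ger0_norm wa0).
  rewrite (distrC (m (w a').1)) (distrC (w a').2).
  apply: (@le_lt_trans _ _ (2 * C%:R * (C%:R * (K * k)%:R^-1) +
      (2 * C%:R + 1) * (K * k)%:R^-1 * C%:R)).
    apply: lerD; apply: ler_pM => //.
    by apply: (le_trans ma'); exact: Cle.
  rewrite (_ : _ + _ = (4 * C%:R ^+ 2 + C%:R) * (K * k)%:R^-1); last by ring.
  rewrite natrM invfM mulrA gtr_pMl ?invr_gt0 // ltr_pdivrMr // mul1r KE.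
  by rewrite ltrDl ltr01.
apply/ffunP => i; apply: val_inj.
have : `|(a i)%:R - (a' i)%:R : R| < 1.
  have := le_lt_trans (mx_norm_coord (c a - c a') 0 i) cc.
  rewrite !mxE (_ : 1 + _ - _ = ((a i)%:R - (a' i)%:R) / k%:R); last by ring.
  by rewrite normrM (gtr0_norm (x := k%:R^-1)) ?invr_gt0 // ltr_pdivrMr // mulVf ?gt_eqF.
exact: natr_dist_lt1.
Qed.

End MissedDirection.

Lemma missed_direction_cast {R : realType} {d N : nat} {M : smooth_space R d}
    (m : M -> 'rV[R]_N) : d.+2 = N -> compact [set: M] -> smoothM_row m ->
  (forall x, m x != 0) ->
  exists c, forall x t, 0 <= t <= 1 -> (1 - t) *: m x + t *: c != 0.
Proof. by move=> E cM; case: N / E m => m Sm m0; exact: missed_direction. Qed.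

(** * Linear algebra of the formal solution *)

Section ComplexLine.
Context {R : realType} {N : nat}.
Variable J : 'M[R]_N.
Hypotheses (J2 : J *m J = - 1%:M) (JT : J^T = - J).
Implicit Types u w : 'rV[R]_N.

Definition line_gram u : 'M[R]_N := u^T *m u + (u *m J)^T *m (u *m J).

(** For nonzero [u], the orthogonal projection onto the complement of the complex line of [u]; [u]
    and [u *m J] are orthogonal and of equal length. *)
Definition line_perp u : 'M[R]_N := 1%:M - (dotr u u)^-1 *: line_gram u.

Lemma line_perp_idem u : u != 0 -> line_perp u *m line_perp u = line_perp u.
Proof.
rewrite -dotr_gt0 => u0; have uJu : dotr (u *m J) u = 0 by exact: skew_dotr.
have uuJ : dotr u (u *m J) = 0 by rewrite dotrC.
have JJ : dotr (u *m J) (u *m J) = dotr u u by exact: dotrJJ.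
have QQ : line_gram u *m line_gram u = dotr u u *: line_gram u.
  rewrite /line_gram; move: (u *m J) uJu uuJ JJ => v uJu uuJ JJ.
  rewrite mulmxDl !mulmxDr -!mulmxA !(mulmxA _ (_^T)) !mul_row_dotr.
  by rewrite uJu uuJ JJ !mul_scalar_mx !scale0r !mulmx0 addr0 add0r -!scalemxAr scalerDr.
rewrite /line_perp mulmxBl mul1mx mulmxBr mulmx1 -scalemxAl -scalemxAr QQ !scalerA.
by rewrite mulfVK ?gt_eqF // subrr subr0.
Qed.

Lemma line_perp_fix u w : u != 0 -> w *m line_perp u = w ->
  dotr w u = 0 /\ dotr w (u *m J) = 0.
Proof.
rewrite -dotr_gt0 => u0 wF.
have : w *m line_gram u = 0.
  apply: (scalerI (invr_neq0 (negbT (gt_eqF u0)))); rewrite scaler0 scalemxAr.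
  apply/eqP; rewrite -oppr_eq0 -[X in _ == X](subrr w) -{2}wF /line_perp mulmxBr mulmx1.
  by rewrite addrAC subrr sub0r.
move/(congr1 (mulmx^~ w^T)); rewrite /line_gram; move: (u *m J) => v.
rewrite mulmxDr mulmxDl mul0mx -!mulmxA !mul_row_dotr !mul_mx_scalar -!scalemxAr.
rewrite !mul_row_dotr => /matrixP/(_ 0 0).
rewrite !mxE !eqxx !mulr1n (dotrC u) (dotrC v) => E.
by split; apply/eqP; rewrite -sqrf_eq0; apply/eqP; nra.
Qed.

Lemma line_perp_neq0 u : u != 0 -> (2 < N)%N -> line_perp u != 0.
Proof.
rewrite -dotr_gt0 => u0 N2; apply/eqP => /(congr1 mxtrace).
rewrite /line_perp /line_gram linearB linearZ linearD /= mxtrace1 !(mxtrace_mulC _^T).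
rewrite !mul_row_dotr (dotrJJ J2 JT) !mxtrace_scalar !mulr1n mxtrace0.
rewrite (_ : _ * (_ + _) = 2); last by field; rewrite gt_eqF.
by move/eqP; rewrite subr_eq0 eqr_nat => /eqP E; rewrite E in N2.
Qed.

End ComplexLine.

Section NormalPlane.
Context {R : realType} {N : nat}.
Variables (P j : 'M[R]_N) (xi eta : 'rV[R]_N).
Hypotheses (j2 : j *m j = - 1%:M) (Pj : P *m j *m P = P *m j).
Hypotheses (PT : P^T = P).

(** As [j] preserves the row space of [P], the column [j *m xi^T] stays in the plane of [xi^T] and
    [eta^T]. Without an [eta] component, [xi^T] would be a real eigenvector of [j]. *)
Lemma normal_plane_rot : xi != 0 -> xi *m P = 0 ->
  1%:M - P = xi^T *m xi + eta^T *m eta -> (eta *m j *m xi^T) 0 0 != 0.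
Proof.
move=> x0 xP PE; apply/eqP => E.
have Pxi : P *m xi^T = 0 by rewrite -PT -trmx_mul xP trmx0.
have jx : j *m xi^T = (xi *m j *m xi^T) 0 0 *: xi^T.
  have : (1%:M - P) *m (j *m xi^T) = j *m xi^T.
    by rewrite mulmxBl mul1mx mulmxA -Pj -!mulmxA Pxi !mulmx0 subr0.
  rewrite PE mulmxDl -!mulmxA (mulmxA xi) (mulmxA eta).
  rewrite [eta *m j *m _]mx11_scalar E raddf0 mulmx0 addr0 => <-.
  by rewrite [xi *m j *m _ in LHS]mx11_scalar mul_mx_scalar.
set l := _ 0 0 in jx; have : (l ^+ 2 + 1) *: xi^T = 0.
  have := congr1 (mulmx j) jx; rewrite mulmxA j2 mulNmx mul1mx -scalemxAr jx scalerA.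
  by rewrite scalerDl scale1r expr2 => <-; rewrite addNr.
move/eqP; rewrite scaler_eq0 => /orP[/eqP|/eqP/(congr1 trmx)].
  by have := sqr_ge0 l; lra.
by rewrite trmxK trmx0; apply/eqP.
Qed.

End NormalPlane.

Section FormalSolution.
Context {R : realType} {N : nat}.
Variables (P j : 'M[R]_N) (xi eta e : 'rV[R]_N).
Hypotheses (j2 : j *m j = - 1%:M) (Pj : P *m j *m P = P *m j).
Hypotheses (PT : P^T = P) (on : orthonormal2 xi eta).
Hypotheses (xP : xi *m P = 0) (yP : eta *m P = 0).
Hypothesis (PE : 1%:M - P = xi^T *m xi + eta^T *m eta).

(** By [normal_plane_rot] the covector [xi] and its composite with [j] span the conormal plane, so
    the two equations cut out the tangent space. *)
Lemma tangent_of_orthogonal : e *m xi^T = 0 -> e *m j *m xi^T = 0 -> e *m P = e.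
Proof.
move=> ex ejx; have x0 : xi != 0 by rewrite -dotr_gt0; have [-> _ _] := on; exact: ltr01.
have Pxi : P *m xi^T = 0 by rewrite -PT -trmx_mul xP trmx0.
set s := (e *m eta^T) 0 0.
have rE : e *m (1%:M - P) = s *: eta.
  by rewrite PE mulmxDr !mulmxA ex mul0mx add0r -mul_scalar_mx -mx11_scalar.
have : e *m (1%:M - P) *m j *m xi^T = 0.
  by rewrite mulmxBr mulmx1 !mulmxBl ejx sub0r -!mulmxA (mulmxA P) -Pj -!mulmxA Pxi !mulmx0 oppr0.
rewrite rE -!scalemxAl => /matrixP/(_ 0 0)/eqP.
rewrite mxE [X in _ == X]mxE mulf_eq0 (negPf (normal_plane_rot j2 Pj PT x0 xP PE)) orbF.
by move=> /eqP s0; move/eqP: rE; rewrite s0 scale0r mulmxBr mulmx1 subr_eq0 => /eqP <-.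
Qed.

(** With a and b the values of [xi] on k and j k, stability of the tangent space turns the equations
    into a (P j e^T) = b e^T and b (P j e^T) = - a e^T, so a = b = 0. Then k is a multiple of
    [eta^T], and [normal_plane_rot] with [xi] and [eta] exchanged makes it 0. *)
Lemma formal_nondegenerate (k : 'cV[R]_N) : e != 0 -> e *m P = e ->
  (P + e^T *m xi) *m k = 0 -> (P + e^T *m xi) *m (j *m k) = 0 -> k = 0.
Proof.
move=> e0 eP; have Pe : P *m e^T = e^T by rewrite -{1}PT -trmx_mul eP.
have [xx yy xy] := on.
have y0 : eta != 0 by rewrite -dotr_gt0 yy ltr01.
rewrite !mulmxDl -!mulmxA [xi *m k]mx11_scalar [xi *m (j *m k)]mx11_scalar.
set a := (xi *m k) 0 0; set b := (xi *m (j *m k)) 0 0; rewrite !mul_mx_scalar => Ek Ejk.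
have Pk : P *m k = - (a *: e^T) by apply/eqP; rewrite -addr_eq0 Ek.
have Pjk : P *m (j *m k) = - (b *: e^T) by apply/eqP; rewrite -addr_eq0 Ejk.
have ab : a *: (P *m j *m e^T) = b *: e^T.
  apply: oppr_inj; rewrite -Pjk -scalerN -mulmxN scalemxAr scalerN -Pk.
  by rewrite (mulmxA (P *m j)) Pj mulmxA.
have ba : b *: (P *m j *m e^T) = - (a *: e^T).
  rewrite scalemxAr -ab -scalemxAr !mulmxA Pj -(mulmxA P j j) j2 mulmxN mulmx1 mulNmx Pe.
  by rewrite scalerN.
have : (a ^+ 2 + b ^+ 2) *: e^T = 0.
  rewrite scalerDl !expr2 -!scalerA -ab -[a *: e^T]opprK -ba scalerN !scalerA mulrC.
  by rewrite addNr.
move/eqP; rewrite scaler_eq0 => /orP[/eqP ab0|/eqP/(congr1 trmx)]; last first.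
  by rewrite trmxK trmx0 => /eqP; rewrite (negPf e0).
have a0 : a = 0 by apply/eqP; rewrite -sqrf_eq0; apply/eqP; nra.
have b0 : b = 0 by apply/eqP; rewrite -sqrf_eq0; apply/eqP; nra.
have xk : xi *m k = 0 by rewrite [LHS]mx11_scalar -/a a0 raddf0.
have kE : k = (eta *m k) 0 0 *: eta^T.
  have : (1%:M - P) *m k = k by rewrite mulmxBl mul1mx Pk a0 scale0r oppr0 subr0.
  rewrite PE mulmxDl -!mulmxA xk mulmx0 add0r => {1}<-.
  by rewrite {1}[eta *m k]mx11_scalar mul_mx_scalar.
have : b = (eta *m k) 0 0 * (xi *m j *m eta^T) 0 0.
  by rewrite /b {1}kE -!scalemxAr mxE mulmxA.
have PE' : 1%:M - P = eta^T *m eta + xi^T *m xi by rewrite PE addrC.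
rewrite b0 => /esym/eqP; rewrite mulf_eq0.
rewrite (negPf (normal_plane_rot j2 Pj PT y0 yP PE')) orbF => /eqP s0.
by rewrite kE s0 scale0r.
Qed.

End FormalSolution.

(** * Normalization of a formal tangent map close to the inclusion *)

Section Compression.
Context {R : realType} {N : nat}.
Variables (P h : 'M[R]_N).
Hypotheses (P2 : P *m P = P) (PT : P^T = P) (hs : `|h - 1%:M| * N%:R < 1).

Definition compression_den : 'M[R]_N := P *m h *m P + (1%:M - P).

(* The formal tangent map [P -> P * h], normalized to have tangential part [P]. *)
Definition compression : 'M[R]_N := P *m invmx compression_den *m P *m h.

Lemma compression_den_mul : compression_den *m P = P *m h *m P.
Proof. by rewrite /compression_den mulmxDl mulmxBl mul1mx P2 subrr addr0 -mulmxA P2. Qed.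

Lemma compression_denC : P *m compression_den = compression_den *m P.
Proof.
rewrite compression_den_mul /compression_den mulmxDr mulmxBr mulmx1 P2 subrr addr0.
by rewrite !mulmxA P2.
Qed.

(** For nonzero tangent v, closeness of [h] to the identity makes the inner product of v h and v
    positive, so the tangential part of P h is injective. *)
Lemma compression_den_unit : compression_den \in unitmx.
Proof.
rewrite -row_free_unit; apply/inj_row_free => v vX.
have E : v *m P *m h *m P = 0.
  have : v *m (compression_den *m P) = 0 by rewrite mulmxA vX mul0mx.
  by rewrite compression_den_mul !mulmxA.
have vP : v *m (1%:M - P) = 0.
  by move: vX; rewrite /compression_den mulmxDr !mulmxA E add0r.
have [Pv|Pv] := eqVneq (v *m P) 0.
  by rewrite -[v]mulmx1 -(subrK P 1%:M) mulmxDr vP Pv addr0.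
have := near_id_pos hs Pv; rewrite addrC subrK.
by rewrite -{2}PT -dotr_mull E /dotr mul0mx mxE ltxx.
Qed.

Lemma compression_denVC : P *m invmx compression_den = invmx compression_den *m P.
Proof.
have uX := compression_den_unit.
by rewrite -[LHS](mulKmx uX) (mulmxA compression_den) -compression_denC mulmxK.
Qed.

Lemma mul_compression : P *m compression = compression.
Proof. by rewrite /compression !mulmxA P2. Qed.

Lemma compression_mul : compression *m P = P.
Proof.
rewrite /compression compression_denVC -!mulmxA (mulmxA P P) P2 (mulmxA P h).
by rewrite -compression_den_mul mulKmx // compression_den_unit.
Qed.

Lemma compression_inj (u : 'cV[R]_N) : compression *m u = 0 -> P *m (h *m u) = 0.
Proof.
have uX := compression_den_unit.
rewrite /compression compression_denVC -(mulmxA _ P P) P2 -!mulmxA => E.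
by rewrite -[LHS](mulKVmx uX) E mulmx0.
Qed.

End Compression.

(** * Formal solutions in a trivialization *)

Section ConstantTrivialization.
Context {R : realType} {d : nat} {M : smooth_space R d}.
Local Notation N := (d + (1 + 1))%N.
Variables (J : 'M[R]_N) (o : orientation M).
Hypotheses (d_gt0 : (0 < d)%N) (cM : compact [set: M]).
Hypotheses (J2 : J *m J = - 1%:M) (JT : J^T = - J).
Let alg := smoothM_algebra M.

(* [j] is the complex structure along [f], trivialized by [B]. *)
Lemma formal_solution_exists (f : M -> 'rV[R]_N) (j B : M -> 'M[R]_N) :
  immersion f -> injective f ->
  salg_mx (@smoothM _ _ M) B -> (forall x, B x \in unitmx) ->
  (forall x, j x *m j x = - 1%:M) ->
  (forall x, tproj f x *m j x *m tproj f x = tproj f x *m j x) ->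
  (forall x, j x *m B x = B x *m J) ->
  exists C : M -> 'M[R]_N, [/\ salg_mx (@smoothM _ _ M) C,
    forall x, tproj f x *m C x = C x, forall x, C x *m tproj f x = 0 &
    forall x, gramJ J ((tproj f x + C x) *m B x) \in unitmx].
Proof.
move=> imm inj SB uB j2 Pj jB.
have [xi [eta [Sxi Seta on VP PE]]] := smooth_normal_frame o cM imm inj.
have xeP x : xi x *m tproj f x = 0 /\ eta x *m tproj f x = 0.
  by have := VP x; rewrite mul_col_mx -(col_mx0 _ 1 1) => /eq_col_mx.
(* Read through [B], the tangent space consists of the rows orthogonal to [m x] and [m x *m J], the
   two covectors of [tangent_of_orthogonal]. *)
pose m x := xi x *m (invmx (B x))^T.
have Sm : smoothM_row m.
  by apply: (salg_mxM alg) => //; apply: (salg_mxT alg); exact: (salg_mxV alg).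
have uBT x : (invmx (B x))^T \in unitmx by rewrite unitmx_tr unitmx_inv.
have xi0 x : xi x != 0 by rewrite -dotr_gt0; have [-> _ _] := on x; exact: ltr01.
have m0 x : m x != 0.
  apply/eqP => E; move/eqP: (xi0 x); apply.
  by rewrite -[LHS](mulmxK (uBT x)) -/(m x) E mul0mx.
have [c Hc] := missed_direction_cast (esym (addn2 d) : d.+2 = N) cM Sm m0.
(* Clamps t to [0, 1]: [transport] takes projections for every real parameter, while [u] is known to
   be nonzero on the segment from [c] to [m x] only. *)
pose tau (t : R) : R := (1 + `|t| - `|t - 1|) / 2.
have tau01 t : 0 <= tau t <= 1.
  have := ler_normD (t - 1) 1; have := ler_normB t 1; rewrite subrK normr1 /tau => h1 h2.
  have : `|t - 1| <= `|t| + 1 by [].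
  by lra.
pose u x t := tau t *: m x + (1 - tau t) *: c.
have u0 x t : u x t != 0.
  have t01 : 0 <= 1 - tau t <= 1 by have := tau01 t; lra.
  by have := Hc x _ t01; rewrite subKr.
have cu : salg_mx (fun h : M * R -> R => continuous h) (fun w => u w.1 w.2).
  have algX := @continuous_algebra R (M * R)%type.
  have ct : continuous (fun w : M * R => tau w.2).
    have cn (v : M * R -> R) : continuous v -> continuous (fun w => `|v w|).
      by move=> cv w; apply: (continuous_comp (cv w)); exact: norm_continuous.
    have c2 : continuous (fun w : M * R => w.2) by move=> w; exact: cvg_snd.
    apply: (salgM algX); last exact: (salg_cst algX).
    apply: (salgB algX); last by apply: cn; apply: (salgB algX) => //; exact: (salg_cst algX).
    by apply: (salgD algX); [exact: (salg_cst algX)|exact: cn].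
  apply: (salg_mxD algX); apply: (salg_mxZ algX) => //.
  - move=> k l w; apply: (@continuous_comp _ _ _ fst (fun x => m x k l)); first exact: cvg_fst.
    exact: smoothM_continuous (Sm k l) _.
  - by apply: (salgB algX) => //; exact: (salg_cst algX).
  - exact: (salg_mxcst algX).
have smooth_perp (X : Type) (D : set X) (S : (X -> R) -> Prop) (al : smooth_algebra D S)
    (v : X -> 'rV[R]_N) : (forall x, v x != 0) -> salg_mx S v ->
    salg_mx S (fun x => line_perp J (v x)).
  move=> v0 Sv; apply: (salg_mxB al); first exact: (salg_mxcst al).
  have SvJ : salg_mx S (fun x => v x *m J) by apply: (salg_mxM al) => //; exact: (salg_mxcst al).
  apply: (salg_mxZ al).
    apply: (salgV al) => [x _|]; first by rewrite dotr_eq0.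
    exact: (salg_mxM al Sv (salg_mxT al Sv)).
  by apply: (salg_mxD al); apply: (salg_mxM al) => //; exact: (salg_mxT al).
have N2 : (2 < N)%N by rewrite addn2.
have tau0 : tau 0 = 0 by rewrite /tau normr0 sub0r normrN normr1 addr0 subrr mul0r.
have tau1 : tau 1 = 1 by rewrite /tau subrr normr0 normr1 subr0 -mulr2n mulfV ?pnatr_eq0.
have uc x : u x 0 = c by rewrite /u tau0 scale0r add0r subr0 scale1r.
have um x : u x 1 = m x by rewrite /u tau1 subrr scale0r addr0 scale1r.
(* That [c] is nonzero is read off the path at a point of [M], so the empty manifold is treated
   apart. *)
have [[x0]|noM] := pselect (inhabited M); last first.
  have noM' (x : M) : False by apply: noM; exists; exact: x.
  by exists (fun=> 0); split=> [|x|x|x]; [exact: (salg_mxcst alg)|case: (noM' x)..].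
have c0 : c != 0 by rewrite -(uc x0) u0.
pose F x t := line_perp J (u x t).
have cF : continuous (fun w : M * R => F w.1 w.2).
  apply: continuous_mx; apply: (smooth_perp _ _ _ (@continuous_algebra R (M * R)%type)) => //.
have SF t : salg_mx (@smoothM _ _ M) (F ^~ t).
  apply: (smooth_perp _ _ _ alg) => //; apply: (salg_mxD alg).
    by apply: (salg_mxZ alg) => //; exact: (salg_cst alg).
  exact: (salg_mxcst alg).
have F2 x t : F x t *m F x t = F x t by exact: line_perp_idem.
have [w0 w00 w0F] := idem_section (line_perp_idem J2 JT c0) (line_perp_neq0 J2 JT c0 N2).
have w0F' x : w0 *m F x 0 = w0 by rewrite /F uc.
have [w [Sw wF wn0]] := transport cM cF SF F2 (salg_mxcst alg w0) w0F' (fun=> w00).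
have wm x : dotr (w x) (m x) = 0 /\ dotr (w x) (m x *m J) = 0.
  by apply: (line_perp_fix (m0 x)); rewrite -um; exact: wF.
pose e x := w x *m invmx (B x).
have Se : smoothM_row e by apply: (salg_mxM alg) => //; exact: (salg_mxV alg).
have mT x : (m x)^T = invmx (B x) *m (xi x)^T by rewrite /m trmx_mul trmxK.
have BJ x : invmx (B x) *m j x = J *m invmx (B x).
  by rewrite -[LHS](mulmxK (uB x)) -(mulmxA _ (j x)) jB mulmxA mulVmx // mul1mx.
have eP x : e x *m tproj f x = e x.
  have [h1 h2] := wm x.
  apply: (tangent_of_orthogonal (j2 x) (Pj x) (tr_tproj f x) (on x) (xeP x).1 (PE x)).
    by rewrite /e -mulmxA -mT mul_row_dotr h1 raddf0.
  have JmT : J *m (m x)^T = - (m x *m J)^T by rewrite (trmx_mul (m x) J) JT mulNmx opprK.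
  by rewrite /e -(mulmxA (w x)) BJ -!mulmxA -mT JmT mulmxN mul_row_dotr h2 raddf0 oppr0.
have e0 x : e x != 0.
  apply/eqP => E; move/eqP: (wn0 x); apply.
  by rewrite -[LHS](mulmxK (_ : invmx (B x) \in unitmx)) ?unitmx_inv // -/(e x) E mul0mx.
exists (fun x => (e x)^T *m xi x); split.
- by apply: (salg_mxM alg) => //; exact: (salg_mxT alg).
- by move=> x; rewrite mulmxA -{1}(tr_tproj f x) -trmx_mul eP.
- by move=> x; rewrite -mulmxA (xeP x).1 mulmx0.
- move=> x; apply/gramJ_unitP => v; rewrite -(mulmxA _ (B x) J) -jB -!mulmxA => h1 h2.
  have := formal_nondegenerate (j2 x) (Pj x) (tr_tproj f x) (on x)
    (xeP x).2 (PE x) (e0 x) (eP x) h1 h2.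
  by move=> Bv; rewrite -[v](mulKmx (uB x)) Bv mulmx0.
Qed.

(** The tangent map of [f] twisted by [h] is a formal solution for [B]. [compression] normalizes its
    tangential part to the projection that [convex_integration] requires, and the closeness of [h]
    to the identity makes this possible. *)
Lemma change_trivialization (f : M -> 'rV[R]_N) (h B : M -> 'M[R]_N) :
  immersion f -> injective f ->
  salg_mx (@smoothM _ _ M) B -> (forall x, B x \in unitmx) ->
  salg_mx (@smoothM _ _ M) h ->
  (forall x, `|h x - 1%:M| * N%:R < 1) ->
  (forall x, row_full (tmx f x *m (h x *m B x) + tmx f x *m (h x *m B x) *m J)%MS) ->
  exists f' : M -> 'rV[R]_N, [/\ immersion f', injective f' &
    forall x, row_full (tmx f' x *m B x + tmx f' x *m B x *m J)%MS].
Proof.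
move=> imm inj SB uB Sh hs full.
pose P := tproj f; have P2 x : P x *m P x = P x := tproj_idem imm x.
have PT x : (P x)^T = P x := tr_tproj f x.
have SP : salg_mx (@smoothM _ _ M) P := smoothM_tproj imm.
pose A x := compression (P x) (h x).
apply: (convex_integration o J2 cM imm inj SB uB (C := fun x => A x - P x)).
- have Sc E : salg_mx (@smoothM _ _ M) (fun=> E : 'M[R]_N) := salg_mxcst alg E.
  have SX : salg_mx (@smoothM _ _ M) (fun x => compression_den (P x) (h x)).
    apply: (salg_mxD alg); last exact: (salg_mxB alg).
    by apply: (salg_mxM alg) => //; exact: (salg_mxM alg).
  apply: (salg_mxB alg) => //; apply: (salg_mxM alg) => //; apply: (salg_mxM alg) => //.
  apply: (salg_mxM alg) => //; apply: (salg_mxV alg) => // x _.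
  exact: compression_den_unit.
- by move=> x; rewrite mulmxBr P2 mul_compression.
- by move=> x; rewrite mulmxBl compression_mul // P2 subrr.
- move=> x; rewrite addrC subrK; apply/gramJ_unitP => v h1 h2.
  have G : gramJ J (P x *m (h x *m B x)) \in unitmx.
    apply/(@gramJ_full _ _ J _ (tmx f x *m (h x *m B x))); last exact: full.
    apply/andP; split; last by rewrite -{1}(tmx_tproj imm) -mulmxA submxMl.
    by rewrite /P /tproj -mulmxA submxMl.
  have inj_A (u : 'cV[R]_N) : A x *m u = 0 -> P x *m (h x *m u) = 0.
    exact: compression_inj.
  apply: ((gramJ_unitP _ _).1 G); rewrite -!(mulmxA (P x)) -!(mulmxA (h x)).
    by apply: inj_A; rewrite mulmxA.
  by apply: inj_A; rewrite (mulmxA (A x)) (mulmxA (A x)).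
Qed.

End ConstantTrivialization.

Lemma proj_stable {R : comRingType} m n (A : 'M[R]_(m, n)) (Q : 'M[R]_(n, m))
    (j : 'M[R]_n) (T : 'M[R]_m) : A *m Q = 1%:M -> A *m j = T *m A ->
  Q *m A *m j *m (Q *m A) = Q *m A *m j.
Proof.
move=> AQ E; rewrite -(mulmxA Q A j) E !mulmxA -(mulmxA (Q *m T) A Q) AQ.
by rewrite mulmx1.
Qed.

(** * Passage from [Jhat] to the constant structure *)

Section Backward.
Context {R : realType} {d : nat} {M : smooth_space R d}.
Local Notation N := (d + (1 + 1))%N.
Variables (J : 'M[R]_N) (o : orientation M).
Hypotheses (d_gt0 : (0 < d)%N) (cM : compact [set: M]).
Hypotheses (J2 : J *m J = - 1%:M) (JT : J^T = - J).
Hypothesis J_conj : forall K : 'M[R]_N, K *m K = - 1%:M ->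
  exists2 L, L \in unitmx & L *m K = J *m L.
Let alg := smoothM_algebra M.

(** It intertwines [j] and [j'], and is the identity when they coincide, so it is close to the
    identity for close structures. *)
Definition interp (j j' : 'M[R]_N) : 'M[R]_N := 2^-1 *: (1%:M - j' *m j).

Lemma interpE (j j' : 'M[R]_N) : j *m j = - 1%:M -> j' *m j' = - 1%:M ->
  j' *m interp j j' = interp j j' *m j.
Proof.
move=> jj jj'; rewrite /interp -scalemxAr -scalemxAl; congr (_ *: _).
rewrite mulmxBr mulmxBl mulmx1 mul1mx mulmxA jj' -mulmxA jj mulNmx mul1mx mulmxN mulmx1.
by rewrite !opprK addrC.
Qed.

Lemma near_interp (y : 'rV[R]_N -> 'M[R]_N) (f : M -> 'rV[R]_N) :
  continuous y -> continuous f -> (forall z, y z *m y z = - 1%:M) ->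
  exists K, (0 < K)%N /\ forall x k, (k < K)%N ->
    `|interp (y ((k%:R / K%:R) *: f x)) (y ((k.+1%:R / K%:R) *: f x)) - 1%:M| * N%:R < 1.
Proof.
move=> cy cf y2.
pose G (w : (M * R) * R) := interp (y (w.1.2 *: f w.1.1)) (y ((w.1.2 + w.2) *: f w.1.1)) - 1%:M.
have algX := @continuous_algebra R ((M * R) * R)%type.
have c11 : continuous (fun w : (M * R) * R => w.1.1).
  by move=> w; apply: (@continuous_comp _ _ _ fst fst); exact: cvg_fst.
have c12 : continuous (fun w : (M * R) * R => w.1.2).
  by move=> w; apply: (@continuous_comp _ _ _ fst snd); [exact: cvg_fst|exact: cvg_snd].
have c2 : continuous (fun w : (M * R) * R => w.2) by move=> w; exact: cvg_snd.
have cyf (s : (M * R) * R -> R) : continuous s ->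
    salg_mx (fun h : (M * R) * R -> R => continuous h) (fun w => y (s w *: f w.1.1)).
  move=> cs; apply: salg_mx_continuous => w.
  apply: (@continuous_comp _ _ _ (fun w : (M * R) * R => s w *: f w.1.1) y); last exact: cy.
  apply: cvgZ; first exact: cs.
  by apply: (@continuous_comp _ _ _ (fun w : (M * R) * R => w.1.1) f); [exact: c11|exact: cf].
have cG : continuous G.
  apply: continuous_mx; apply: (salg_mxB algX); last exact: (salg_mxcst algX).
  apply: (salg_mxZ algX); first exact: (salg_cst algX).
  apply: (salg_mxB algX); first exact: (salg_mxcst algX).
  by apply: (salg_mxM algX); apply: cyf => //; exact: (salgD algX).
have G0 x t : G ((x, t), 0) = 0.
  by rewrite /G /interp /= addr0 y2 opprK scalerDr -scalerDl (_ : 2^-1 + 2^-1 = 1 :> R)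
    ?scale1r ?subrr //; lra.
have cX : compact ([set: M] `*` `[0 : R, 1]).
  by apply: compact_setX => //; exact: segment_compact.
have e0 : 0 < N.+1%:R^-1 :> R by rewrite invr_gt0 ltr0n.
have [r r0 H] : exists2 r : R, 0 < r & forall t, `|t| < r ->
    forall x, ([set: M] `*` `[0 : R, 1]) x -> `|G (x, t)| < N.+1%:R^-1.
  apply: compact_perturb cX _ => -[x t] _.
  have cG' : {for (((x, t), 0 : R)), continuous G} by exact: cG.
  have := near_dist_lt cG' e0; rewrite G0.
  by apply: (@filterS _ _ (nbhs_filter ((x, t), 0 : R))) => w; rewrite /= subr0; case: w.
pose K := (Num.truncn r^-1).+1.
have K0 : 0 < K%:R :> R by rewrite ltr0n.
have Kr : `|K%:R^-1| < r.
  by rewrite gtr0_norm ?invr_gt0 // invf_plt ?posrE // truncnS_gt.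
exists K; split=> // x k kK.
have kK' : ([set: M] `*` `[0 : R, 1]) (x, k%:R / K%:R).
  split=> //=; rewrite in_itv /= divr_ge0 ?ler0n //= ler_pdivrMr // mul1r.
  by rewrite ler_nat ltnW.
have e1 : k%:R / K%:R + K%:R^-1 = k.+1%:R / K%:R :> R by rewrite -natr1 mulrDl mul1r.
have := H _ Kr _ kK'; rewrite /G /= e1 => h.
apply: (@le_lt_trans _ _ (N.+1%:R^-1 * N%:R)); first by rewrite ler_wpM2r ?ler0n // ltW.
by rewrite mulrC ltr_pdivrMr ?ltr0n // mul1r ltr_nat.
Qed.

Lemma tmx_mulr m e (g : M -> 'rV[R]_m) (L : 'M[R]_(m, e)) x : smoothM_row g ->
  tmx (fun x => g x *m L) x = tmx g x *m L.
Proof.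
move=> Sg; have dx := dom_pref x.
have SL : smooth_on setT (fun v : 'rV[R]_m => v *m L).
  apply/(smooth_on_mxE _ openT); have algT := smooth_on_algebra (@openT 'rV[R]_m).
  apply: (salg_mxM algT); last exact: (salg_mxcst algT).
  by move=> i j; rewrite ord1; apply: smooth_on_coord; exact: openT.
have jL (v : 'rV[R]_m) : jac (fun v : 'rV[R]_m => v *m L) v = L.
  have [dL <-] := jacobianE openT (I : setT v) (SL 1%N).
  apply/row_matrixP => i; rewrite !rowE /jacobian mul_rV_lin1.
  have -> : 'd (fun v : 'rV[R]_m => v *m L) v = mulmxr L :> ('rV[R]_m -> 'rV[R]_e).
    exact: (@diff_lin _ _ _ (mulmxr L : {linear 'rV[R]_m -> 'rV[R]_e}) v (@mulmxr_continuous _ _ _ L)).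
  by [].
rewrite /tmx -[in RHS](jL ((g \o chart_inv (pref x)) (chart (pref x) x))).
apply: (jac_comp (@open_cod _ _ M (pref x)) openT (chart_in dx) I).
  exact: (smoothM_row_on (pref x) Sg).
exact: SL.
Qed.

Lemma CR_of_pseudo_holomorphic (JM : almost_complex M)
    (Jhat : almost_complex (euclid R N)) (f : M -> euclid R N) :
  pseudo_holomorphic_embedding JM Jhat f ->
  exists f' : M -> euclid R N, smooth_embedding f' /\
    forall x, row_full (tangent_map f' x + tangent_map f' x *m J)%MS.
Proof.
move=> [emb hol]; have [imm inj] := (embeddingP f cM).1 emb.
have [Sf rf] := imm; have cf := smoothM_row_continuous Sf.
pose y (z : 'rV[R]_N) : 'M[R]_N := acs Jhat z.
have y2 z : y z *m y z = - 1%:M by exact: acs_sqr.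
have Sy := (smooth_on_mxE y (@openT 'rV[R]_N)).1 (smooth_acs_euclid Jhat).
have cy : continuous y.
  by apply: continuous_mx => i j z; exact: (Ck_on_continuous (Sy i j 0%N) I).
have [K [K0 HK]] := near_interp cy cf y2.
have KR : K%:R != 0 :> R by rewrite pnatr_eq0 -lt0n.
pose j k x := y ((k%:R / K%:R) *: f x).
have j2 k x : j k x *m j k x = - 1%:M by exact: y2.
have Sj k : salg_mx (@smoothM _ _ M) (j k).
  move=> a b; apply: (@smoothM_comp _ _ _ _ (fun x => (k%:R / K%:R) *: f x) setT
    (fun z => y z a b)) => //; first exact: openT.
  by apply: (salg_mxZ alg) => //; exact: (salg_cst alg).
pose h k x := interp (j k x) (j k.+1 x).
have Sh k : salg_mx (@smoothM _ _ M) (h k).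
  apply: (salg_mxZ alg); first exact: (salg_cst alg).
  apply: (salg_mxB alg); first exact: (salg_mxcst alg).
  exact: (salg_mxM alg (Sj k.+1) (Sj k)).
have hs k x : (k < K)%N -> `|h k x - 1%:M| * N%:R < 1 by exact: HK.
have uh k x : (k < K)%N -> h k x \in unitmx.
  by move=> kK; have := near_id_unit (hs k x kK); rewrite addrC subrK.
have [L uL LJ] := J_conj (y2 0).
(* [B k] intertwines [J] with the structure [j k]. It is computed once from the original [f] and
   remains the same function on [M] while the embedding is replaced. *)
pose B := fix B (k : nat) (x : M) : 'M[R]_N :=
  if k is k'.+1 then h k' x *m B k' x else invmx L.
have SB k : salg_mx (@smoothM _ _ M) (B k).
  elim: k => [|k IH] /=; first exact: (salg_mxcst alg).
  exact: (salg_mxM alg (Sh k) IH).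
have uB k x : (k <= K)%N -> B k x \in unitmx.
  elim: k => [|k IH] kK /=; first by rewrite unitmx_inv.
  by rewrite unitmx_mul uh // IH // ltnW.
have jB k x : j k x *m B k x = B k x *m J.
  elim: k => [|k IH] /=.
    have y0E : y 0 = invmx L *m J *m L by rewrite -mulmxA -LJ mulKmx.
    by rewrite /j mul0r scale0r y0E mulmxK.
  by rewrite mulmxA (interpE (j2 k x) (j2 k.+1 x)) -mulmxA IH mulmxA.
(* The index runs down from [B K], which trivializes [Jhat] along [f], to the constant
   [B 0 = invmx L]. A formal solution is constructed from tangency at the start only; afterwards
   each regular embedding supplies the next one. *)
have step k : (k <= K)%N -> exists f' : M -> 'rV[R]_N, [/\ immersion f', injective f' &
    forall x, row_full (tmx f' x *m B (K - k)%N x + tmx f' x *m B (K - k)%N x *m J)%MS].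
  elim: k => [_|k IH kK].
    have tan x : tproj f x *m j K x *m tproj f x = tproj f x *m j K x.
      have E : tmx f x *m j K x = acs JM x *m tmx f x.
        by have := hol x; rewrite (tangent_map_tmx x Sf) /j divff // scale1r.
      exact: proj_stable (tmx_pinv imm x) E.
    have [C [SC PC CP good]] := formal_solution_exists o d_gt0 cM J2 JT imm inj (SB K)
      (fun x => uB K x (leqnn K)) (j2 K) tan (jB K).
    have [f' [imm' inj' full']] := convex_integration o J2 cM imm inj (SB K)
      (fun x => uB K x (leqnn K)) SC PC CP good.
    by exists f'; rewrite subn0.
  have [f' [imm' inj' full']] := IH (ltnW kK).
  have E : (K - k)%N = (K - k.+1).+1 by rewrite subnS prednK // subn_gt0.
  have lt : (K - k.+1 < K)%N by rewrite ltn_subrL K0.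
  rewrite E in full'.
  exact: (change_trivialization o cM J2 imm' inj' (SB _)
    (fun x => uB _ x (ltnW lt)) (Sh _) (fun x => hs _ x lt) full').
have [f' [imm' inj' full']] := step K (leqnn K); rewrite subnn /= in full'.
have uV : invmx L \in unitmx by rewrite unitmx_inv.
(* The remaining trivialization is constant, so it is absorbed by a linear change of coordinates. *)
pose f2 : M -> euclid R N := fun x => f' x *m invmx L.
have Sf2 : smoothM_row (f2 : M -> 'rV[R]_N).
  by have [S' _] := imm'; apply: (salg_mxM alg S'); exact: (salg_mxcst alg).
have tf2 x : tmx (f2 : M -> 'rV[R]_N) x = tmx f' x *m invmx L.
  by have [S' _] := imm'; exact: tmx_mulr.
exists f2; split.
  apply/(embeddingP _ cM); split; last first.
    by move=> x x' /(can_inj (mulmxK uV)) /inj'.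
  split=> // x; rewrite tf2 /row_free mxrankMfree ?row_free_unit //.
  by have [_ rf'] := imm'; exact: (rf' x).
by move=> x; rewrite (tangent_map_tmx x Sf2) tf2.
Qed.

End Backward.

(** Eliminating the equation between dimensions applies the constructions for [d + (1 + 1)] to
    [standard_J], whose size is [n.+1 + n.+1], without casting matrices. *)
Lemma CR_iff_pseudo_holomorphic {R : realType} {d N : nat} {M : smooth_space R d}
    (J : 'M[R]_N) (o : orientation M) : (d + (1 + 1))%N = N -> (0 < d)%N ->
  compact [set: M] -> J *m J = - 1%:M -> J^T = - J ->
  (forall K : 'M[R]_N, K *m K = - 1%:M -> exists2 L, L \in unitmx & L *m K = J *m L) ->
  (exists f : M -> euclid R N, smooth_embedding f /\
     forall x, row_full (tangent_map f x + tangent_map f x *m J)%MS) <->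
  (exists (JM : almost_complex M) (Jhat : almost_complex (euclid R N))
     (f : M -> euclid R N), pseudo_holomorphic_embedding JM Jhat f).
Proof.
move=> E; case: N / E J => J d0 cM J2 JT Jc; split.
  move=> [f [emb full]].
  have [JM [Jhat hol]] := pseudo_holomorphic_of_CR o cM J2 JT emb full.
  by exists JM, Jhat, f.
move=> [JM [Jhat [f hol]]]; exact: (CR_of_pseudo_holomorphic o d0 cM J2 JT Jc hol).
Qed.

Lemma pseudo_holomorphic_cast {R : realType} {d N N' : nat} {M : smooth_space R d} :
  N = N' ->
  (exists (JM : almost_complex M) (Jhat : almost_complex (euclid R N))
     (f : M -> euclid R N), pseudo_holomorphic_embedding JM Jhat f) ->
  (exists (JM : almost_complex M) (Jhat : almost_complex (euclid R N'))
     (f : M -> euclid R N'), pseudo_holomorphic_embedding JM Jhat f).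
Proof. by case: N' /. Qed.

Theorem corollary5 (R : realType) (n : nat) (n_gt0 : (0 < n)%N)
    (M : smooth_space R (2 * n)) (M_closed : closed_manifold M)
    (o : orientation M) :
  (exists f : M -> Cspace R n.+1, CR_regular_embedding f) <->
  (exists (JM : almost_complex M)
          (Jhat : almost_complex (euclid R (2 * n + 2)))
          (f : M -> euclid R (2 * n + 2)),
     pseudo_holomorphic_embedding JM Jhat f).
Proof.
have [_ _ cM] := M_closed.
have E : (2 * n + (1 + 1))%N = (n.+1 + n.+1)%N by lia.
have E' : (n.+1 + n.+1)%N = (2 * n + 2)%N by lia.
have d0 : (0 < 2 * n)%N by lia.
have main := CR_iff_pseudo_holomorphic o E d0 cM (standard_J_sqr (R := R) (m := n.+1))
  (standard_J_tr (R := R) (m := n.+1)) (@complex_frame_ex R n.+1).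
have CR (f : M -> Cspace R n.+1) : smooth_embedding f -> forall x,
    CR_regular f x <-> row_full (tangent_map f x + tangent_map f x *m standard_J R n.+1)%MS.
  move=> [_ _ rf _] x; rewrite -(CR_rankP n_gt0 (rf x)).
  by split=> [/eqP|/eqP].
split.
  move=> [f [emb reg]]; apply: (pseudo_holomorphic_cast E'); apply/main.
  by exists f; split=> // x; apply/CR.
move=> /(pseudo_holomorphic_cast (esym E')) /main[f [emb full]].
by exists f; split=> // x; apply/CR.
Qed.
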